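(* There is a priority queue (in the Word-RAM model, with keys accessed only by comparisons) that supports the operations \textsc{Insert}, \textsc{ExtractMin}, \textsc{DecreaseKey} and \textsc{FindMin}, such that all operations have $O(1)$ amortized cost except \textsc{ExtractMin}, which has amortized cost $O(1+\log|W_x|)$ when extracting the element $x$.
   Context: Working set: for an element $x$ present in the priority queue and each time $t$ between the insertion and the extraction of $x$, let $W_{x,t}$ be the set of elements inserted after $x$ and still present at time $t$, with $x$ itself included. Let $t_0$ be a time maximizing $|W_{x,t}|$; the working set of $x$ is $W_x=W_{x,t_0}$. (\textsc{DecreaseKey} operations do not affect working sets.) Logarithms are base 2. *)

(* Defs.v *)
From HB Require Import structures.
From mathcomp Require Import all_boot all_order all_algebra.
From mathcomp Require Import reals exp.

Set Implicit Arguments.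
Unset Strict Implicit.
Unset Printing Implicit Defensive.

Import Order.TTheory GRing.Theory Num.Theory.

(** * A word RAM with opaque keys

   A machine with [w]-bit words has finitely many registers (a program is a
   finite text), one array of [2 ^ w] words and one array of [2 ^ w] keys, both
   indexed by words.  Keys can be copied between cells of the key array and
   compared with each other; nothing else can be done with them.  Programs are
   syntactic objects that depend neither on [w] nor on the type of keys. *)

Definition word (w : nat) : Type := 'I_(2 ^ w).

Lemma word_subproof (w n : nat) : n %% 2 ^ w < 2 ^ w.
Proof. by rewrite ltn_pmod // expn_gt0. Qed.

Definition mkword (w n : nat) : word w := Ordinal (word_subproof w n).

Inductive binop : Type :=
  BAdd | BSub | BMul | BDiv | BMod | BAnd | BOr | BXor | BShl | BShr | BEq | BLt.

(* [BSub] is subtraction modulo [2 ^ w]; [BDiv] by 0 is 0 and [BMod] by 0 is the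
   left operand. *)
Definition binop_eval (w : nat) (o : binop) (a b : word w) : word w :=
  mkword w
    match o with
    | BAdd => a + b
    | BSub => a + (2 ^ w - b)
    | BMul => a * b
    | BDiv => a %/ b
    | BMod => a %% b
    | BAnd => Nat.land a b
    | BOr  => Nat.lor a b
    | BXor => Nat.lxor a b
    | BShl => a * 2 ^ b
    | BShr => a %/ 2 ^ b
    | BEq  => a == b
    | BLt  => a < b
    end.

(* [KLe e1 e2] compares the keys in the cells [e1] and [e2] of the key array. *)
Inductive expr : Type :=
  | Cst of nat
  | Reg of nat
  | Read of expr
  | Bin of binop & expr & expr
  | KLe of expr & expr.

Inductive cmd : Type :=
  | Skip
  | Assign of nat & expr
  | Write of expr & expr
  | KCopy of expr & expr
  | Seq of cmd & cmd
  | If of expr & cmd & cmd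
  | While of expr & cmd.

Definition upd (A : eqType) (B : Type) (f : A -> B) (a : A) (b : B) : A -> B :=
  fun x => if x == a then b else f x.

Record state (w : nat) (K : Type) : Type := State {
  reg  : nat -> word w;
  wmem : word w -> word w;
  kmem : word w -> K
}.

Definition set_reg (w : nat) (K : Type) (s : state w K) (r : nat) (v : word w) :=
  State (upd (reg s) r v) (wmem s) (kmem s).

Definition set_mem (w : nat) (K : Type) (s : state w K) (a v : word w) :=
  State (reg s) (upd (wmem s) a v) (kmem s).

Definition set_key (w : nat) (K : Type) (s : state w K) (a : word w) (k : K) :=
  State (reg s) (wmem s) (upd (kmem s) a k).

Section Semantics.
Variables (w : nat) (disp : Order.disp_t) (K : orderType disp).
Implicit Types (s : state w K) (e : expr) (c : cmd).

Fixpoint eval s e : word w :=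
  match e with
  | Cst n => mkword w n
  | Reg r => reg s r
  | Read e1 => wmem s (eval s e1)
  | Bin o e1 e2 => binop_eval o (eval s e1) (eval s e2)
  | KLe e1 e2 => mkword w (kmem s (eval s e1) <= kmem s (eval s e2))%O
  end.

Fixpoint ecost e : nat :=
  match e with
  | Cst _ | Reg _ => 1
  | Read e1 => (ecost e1).+1
  | Bin _ e1 e2 | KLe e1 e2 => (ecost e1 + ecost e2).+1
  end.

Definition holds s e : bool := val (eval s e) != 0.

(* [exec c s t s']: started in [s], [c] halts in [s'] after [t] unit-cost
   steps. *)
Inductive exec : cmd -> state w K -> nat -> state w K -> Prop :=
  | exec_skip s : exec Skip s 0 s
  | exec_set s r e :
      exec (Assign r e) s (ecost e).+1 (set_reg s r (eval s e))
  | exec_store s e1 e2 :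
      exec (Write e1 e2) s (ecost e1 + ecost e2).+1
           (set_mem s (eval s e1) (eval s e2))
  | exec_kcopy s e1 e2 :
      exec (KCopy e1 e2) s (ecost e1 + ecost e2).+1
           (set_key s (eval s e1) (kmem s (eval s e2)))
  | exec_seq s1 s2 s3 c1 c2 t1 t2 :
      exec c1 s1 t1 s2 -> exec c2 s2 t2 s3 ->
      exec (Seq c1 c2) s1 (t1 + t2) s3
  | exec_if s s' e c1 c2 t :
      exec (if holds s e then c1 else c2) s t s' ->
      exec (If e c1 c2) s (ecost e + t).+1 s'
  | exec_while_end s e c :
      ~~ holds s e -> exec (While e c) s (ecost e).+1 s
  | exec_while_loop s1 s2 s3 e c t1 t2 :
      holds s1 e -> exec c s1 t1 s2 -> exec (While e c) s2 t2 s3 ->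
      exec (While e c) s1 (ecost e + t1 + t2).+1 s3.

Lemma exec_det c s t1 s1 t2 s2 :
  exec c s t1 s1 -> exec c s t2 s2 -> t1 = t2 /\ s1 = s2.
Proof.
move=> E; elim: E t2 s2 => {c s t1 s1}.
- by move=> s t2 s2 E; inversion E.
- by move=> s r e t2 s2 E; inversion E.
- by move=> s e1 e2 t2 s2 E; inversion E.
- by move=> s e1 e2 t2 s2 E; inversion E.
- move=> s1 s2 s3 c1 c2 t1 t2 _ IH1 _ IH2 t s E.
  inversion E as [| | | |? s' ? ? ? ? ? E1 E2| | |]; subst.
  by have [? ?] := IH1 _ _ E1; subst; have [-> ->] := IH2 _ _ E2.
- move=> s s' e c1 c2 t _ IH t2 s2 E.
  inversion E as [| | | | |? ? ? ? ? ? E1| |]; subst.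
  by have [-> ->] := IH _ _ E1.
- move=> s e c /negP nh t2 s2 E.
  by inversion E.
- move=> s1 s2 s3 e c t1 t2 h _ IH1 _ IH2 t s E.
  inversion E as [| | | | | |? ? ? nh|? s' ? ? ? ? ? ? E1 E2]; subst.
    by rewrite h in nh.
  by have [? ?] := IH1 _ _ E1; subst; have [-> ->] := IH2 _ _ E2.
Qed.

End Semantics.

(** * Histories of a priority queue and working sets

   Elements are named by their rank of insertion: the first inserted element is
   0, the second is 1, and so on. *)

Inductive op (K : Type) : Type :=
  | Insert of K
  | ExtractMin
  | DecreaseKey of nat & K
  | FindMin.
Arguments ExtractMin {K}.
Arguments FindMin {K}.

(* An operation together with its answer: [EvExtractMin x] is an [ExtractMin] that
   removed [x], [EvFindMin x] is a [FindMin] that answered [x]. *)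
Inductive event (K : Type) : Type :=
  | EvInsert of K
  | EvExtractMin of nat
  | EvDecreaseKey of nat & K
  | EvFindMin of nat.
Arguments EvExtractMin {K} x.
Arguments EvFindMin {K} x.

(* The most recent event comes first, so that the past states of the queue are
   those of the histories [drop t h], for [t <= size h]. *)
Definition history (K : Type) : Type := seq (event K).

Section History.
Variables (disp : Order.disp_t) (K : orderType disp).
Implicit Types (h : history K) (x : nat).

Fixpoint insertions h : nat :=
  match h with
  | [::] => 0
  | EvInsert _ :: h' => (insertions h').+1
  | _ :: h' => insertions h'
  end.

Fixpoint present h : seq nat :=
  match h with
  | [::] => [::]
  | EvInsert _ :: h' => insertions h' :: present h'
  | EvExtractMin x :: h' => rem x (present h')
  | _ :: h' => present h'
  end.

Fixpoint key h x : option K :=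
  match h with
  | [::] => None
  | EvInsert k :: h' => if x == insertions h' then Some k else key h' x
  | EvDecreaseKey y k :: h' => if x == y then Some k else key h' x
  | _ :: h' => key h' x
  end.

Definition is_min h x : Prop :=
  x \in present h /\
  forall y kx ky, y \in present h -> key h x = Some kx -> key h y = Some ky ->
    (kx <= ky)%O.

Definition valid h (o : op K) : Prop :=
  match o with
  | Insert _ => True
  | ExtractMin | FindMin => present h <> [::]
  | DecreaseKey x k =>
      x \in present h /\ exists2 k0, key h x = Some k0 & (k <= k0)%O
  end.

(* [W_{x,t}], where [h] is the history up to time [t]. *)
Definition working_set_at h x : seq nat := [seq y <- present h | x <= y].

(* [W_x], where [h] is the history up to just before the extraction of [x]; the
   times between the insertion and the extraction of [x] are those at which [x]
   is present. *)
Definition working_set h x : seq nat :=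
  let W (t : 'I_(size h).+1) := working_set_at (drop t h) x in
  W [arg max_(t > ord0 | x \in present (drop t h)) size (W t)].

End History.

(** * Priority queues on the word RAM *)

Record pq_program : Type := PQProgram {
  pq_init : cmd;
  pq_insert : cmd;
  pq_extract_min : cmd;
  pq_decrease_key : cmd;
  pq_find_min : cmd
}.

(* [handle x] is the word by which the queue and its client refer to [x]; it is
   chosen by the queue when [x] is inserted.  Only its values at inserted
   elements matter. *)
Record config (w : nat) (disp : Order.disp_t) (K : orderType disp) : Type :=
  Config {
    hist : history K;
    handle : nat -> word w;
    mach : state w K
  }.

Section PriorityQueue.
Variables (P : pq_program) (w : nat) (disp : Order.disp_t) (K : orderType disp).
Implicit Types (h : history K) (s : state w K) (a : nat -> word w).

(* [serve g o t g']: in configuration [g], the program for [o] halts after [t]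
   steps with a correct answer.  Words (handles) are passed and returned in
   register 0, keys in cell 0 of the key array; everything else in the machine
   is left untouched between operations. *)
Inductive serve : config w K -> op K -> nat -> config w K -> Prop :=
  | serve_insert h a s k t s' :
      exec (pq_insert P) (set_key s (mkword w 0) k) t s' ->
      (forall y, y \in present h -> a y <> reg s' 0) ->
      serve (Config h a s) (Insert k) t
            (Config (EvInsert k :: h) (upd a (insertions h) (reg s' 0)) s')
  | serve_extract_min h a s x t s' :
      exec (pq_extract_min P) s t s' ->
      is_min h x -> reg s' 0 = a x -> key h x = Some (kmem s' (mkword w 0)) ->
      serve (Config h a s) ExtractMin t (Config (EvExtractMin x :: h) a s')
  | serve_decrease_key h a s x k t s' :
      exec (pq_decrease_key P)
           (set_key (set_reg s 0 (a x)) (mkword w 0) k) t s' ->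
      serve (Config h a s) (DecreaseKey x k) t
            (Config (EvDecreaseKey x k :: h) a s')
  | serve_find_min h a s x t s' :
      exec (pq_find_min P) s t s' ->
      is_min h x -> reg s' 0 = a x -> key h x = Some (kmem s' (mkword w 0)) ->
      serve (Config h a s) FindMin t (Config (EvFindMin x :: h) a s').

(* [run g T]: [g] is reached, in [T] steps overall, by creating an empty queue
   on a machine with arbitrary contents and performing valid operations. *)
Inductive run : config w K -> nat -> Prop :=
  | run_init s t s' :
      exec (pq_init P) s t s' ->
      run (Config [::] (fun=> mkword w 0) s') t
  | run_step g T o t g' :
      run g T -> valid (hist g) o -> serve g o t g' -> run g' (T + t).

End PriorityQueue.

(* The word RAM assumption [w >= log n + O(1)], where [n] is the number of
   insertions: words can address [b * (n + 1)] cells. *)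
Definition fits (b w n : nat) : Prop := b * n.+1 <= 2 ^ w.

(* Since [exec] is deterministic, this says that every valid operation halts
   with a correct answer, after any sequence of valid operations. *)
Definition pq_correct (P : pq_program) (b : nat) : Prop :=
  forall (w : nat) (disp : Order.disp_t) (K : orderType disp),
    fits b w 0 ->
    (forall s : state w K, exists t s', exec (pq_init P) s t s') /\
    (forall (g : config w K) (T : nat) (o : op K),
       run P g T -> valid (hist g) o ->
       fits b w (insertions (hist g) + (if o is Insert _ then 1 else 0)) ->
       exists t g', serve P g o t g').

Local Open Scope ring_scope.

Definition log2 (R : realType) (x : R) : R := ln x / ln 2.

Section Amortized.
Variables (R : realType) (disp : Order.disp_t) (K : orderType disp).

Fixpoint amortized_total (f : history K -> event K -> R) (h : history K) : R :=
  if h is e :: h' then amortized_total f h' + f h' e else 0.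

(* [f h e] bounds the amortized cost of the operation [e] performed after [h],
   and [c0] that of creating the queue: in every run the total cost is at most
   the sum of the amortized costs. *)
Definition amortized_cost (P : pq_program) (b w : nat) (c0 : R)
    (f : history K -> event K -> R) : Prop :=
  forall (g : config w K) (T : nat),
    run P g T -> fits b w (insertions (hist g)) ->
    T%:R <= c0 + amortized_total f (hist g).

End Amortized.

(* Main.v *)
(* The queue has one circle of half-ordered trees (as in rank-pairing heaps, with
   links of equal ranks only) per level.  Elements hold positions below a counter
   M; level j consists of the positions between the boundaries C (j+1) and C j,
   where C j = (M / 2^j) 2^j - 2^j, so that it has at most 2^(j+1) elements and
   higher levels hold older elements.  An insertion increments M: at each
   trailing one of M a whole level moves one step up.  The move of level j is
   made only if at least 2^j elements are more recent; then 2^(j+1) is at most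
   twice the size of the current working set of each element that moves.
   Otherwise few positions below the boundary are occupied: the elements there
   receive new consecutive positions, which is paid for by the positions that
   are freed.  Hence an element of level j always satisfies 2^j <= 2 |W|.

   A mask records the levels whose minimum is smaller than the minima of all
   higher levels, and its lowest bit gives the minimum of the queue.  An
   extraction from level j consolidates that level alone, whose ranks are O(j),
   and recomputes the bits up to j, in amortized time O(1 + j).  A decrease of a
   key cuts a subtree inside its level and clears bits of the mask, in amortized
   time O(1).  The potential adds up the rank differences in the trees, the
   number of trees, the bits of the mask and of M, and the free positions. *)

From HB Require Import structures.
Require Import Defs.
From mathcomp Require Import all_boot all_order all_algebra.
From mathcomp Require Import reals exp.
From mathcomp Require Import zify lra.

Set Implicit Arguments.
Unset Strict Implicit.
Unset Printing Implicit Defensive.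

Import Order.TTheory.

(** * Programs with records of sixteen fields *)

(** The boundaries [C M j] are rounded so that, below a carry, an increment sends each of them
    exactly onto the next ([C_incr_lo]): whole circles are handed up, and no record stores its
    level, which is recomputed from the position by a table of bit lengths.

    Deletions leave holes among the positions. They cause two difficulties. A carry may lack the
    recent elements that would justify it, which is why the counter sometimes drops by [2 ^ i - 1]
    instead of growing by one. And a level may become too high for the current working set; it
    suffices that the set was large at some past moment, because [working_set] maximizes over time
    ([inv_evid]).

    The rank rule inherits a rank only across a gap of 3. With weights 2 per rank difference and 5
    per root, a link frees one unit ([pot_link]) and dismantling a spine costs only a multiple of
    its rank ([spine_pot]).

    Programs are verified on a machine over natural numbers. Each triple asserts that an execution
    exists, and determinism transfers the bounds to every run. *)

Inductive hexp : Type :=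
  | HC of nat
  | HV of nat
  | HF of nat & hexp
  | HB of binop & hexp & hexp
  | HK of hexp & hexp.

Inductive hcmd : Type :=
  | HSet of nat & hexp
  | HPut of nat & hexp & hexp
  | HKey of hexp & hexp
  | HSeq of hcmd & hcmd
  | HIf of hexp & hcmd & hcmd
  | HWhile of hexp & hcmd
  | HSkip.

(* Field [f] of record [i] lives in cell [16 * i + f]. *)
Definition cell (f : nat) (e : expr) : expr :=
  Bin BAdd (Bin BMul e (Cst 16)) (Cst f).

Arguments cell : simpl never.

Fixpoint cexp (e : hexp) : expr :=
  match e with
  | HC n => Cst n
  | HV r => Reg r
  | HF f e => Read (cell f (cexp e))
  | HB o e1 e2 => Bin o (cexp e1) (cexp e2)
  | HK e1 e2 => KLe (cexp e1) (cexp e2)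
  end.

Fixpoint ccmd (c : hcmd) : cmd :=
  match c with
  | HSet r e => Assign r (cexp e)
  | HPut f e1 e2 => Write (cell f (cexp e1)) (cexp e2)
  | HKey e1 e2 => KCopy (cexp e1) (cexp e2)
  | HSeq c1 c2 => Seq (ccmd c1) (ccmd c2)
  | HIf e c1 c2 => If (cexp e) (ccmd c1) (ccmd c2)
  | HWhile e c => While (cexp e) (ccmd c)
  | HSkip => Skip
  end.

(** * Triples with running times on a machine without overflow *)

Section Logic.
Variables (w : nat) (disp : Order.disp_t) (K : orderType disp).

(** Values are unbounded naturals, so that programs are reasoned about with plain arithmetic. The
    word size survives only in the side conditions [df] and in the bounds of [sim]. *)
Record ast : Type := Ast {
  rg : nat -> nat;
  fd : nat -> nat -> nat;
  ky : nat -> K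
}.

(** Register and field numbers are compared with [eqn], which simplification evaluates on numerals;
    indices of records are compared with [==], which stays visible for case analysis. *)
Definition setr (a : ast) r v :=
  Ast (fun r' => if eqn r' r then v else rg a r') (fd a) (ky a).
Definition setf (a : ast) f i v :=
  Ast (rg a) (fun f' i' => if eqn f' f && (i' == i) then v else fd a f' i') (ky a).
Definition setk (a : ast) i k :=
  Ast (rg a) (fd a) (fun i' => if i' == i then k else ky a i').

Definition evop (o : binop) (a b : nat) : nat :=
  match o with
  | BAdd => a + b
  | BSub => a - b
  | BMul => a * b
  | BDiv => a %/ b
  | BMod => a %% b
  | BShl => a * 2 ^ b
  | BShr => a %/ 2 ^ b
  | BEq  => a == b
  | BLt  => a < b
  | _ => 0
  end.

(* No overflow occurs; the bitwise operations are not supported. *)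
Definition dfop (o : binop) (a b : nat) : Prop :=
  match o with
  | BAdd => a + b < 2 ^ w
  | BSub => b <= a
  | BMul => a * b < 2 ^ w
  | BShl => a * 2 ^ b < 2 ^ w
  | BDiv | BMod | BShr | BEq | BLt => True
  | _ => False
  end.

Fixpoint ev (a : ast) (e : hexp) : nat :=
  match e with
  | HC n => n
  | HV r => rg a r
  | HF f e => fd a f (ev a e)
  | HB o e1 e2 => evop o (ev a e1) (ev a e2)
  | HK e1 e2 => (ky a (ev a e1) <= ky a (ev a e2))%O
  end.

Fixpoint df (a : ast) (e : hexp) : Prop :=
  match e with
  | HC n => n < 2 ^ w
  | HV r => True
  | HF f e => [/\ df a e, ev a e * 16 + 16 <= 2 ^ w & f < 16]
  | HB o e1 e2 => [/\ df a e1, df a e2 & dfop o (ev a e1) (ev a e2)]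
  | HK e1 e2 => df a e1 /\ df a e2
  end.

Record sim (s : state w K) (a : ast) : Prop := Sim {
  sim_reg : forall r, reg s r = rg a r :> nat;
  sim_mem : forall f i, f < 16 -> i * 16 + f < 2 ^ w ->
    wmem s (mkword w (i * 16 + f)) = fd a f i :> nat;
  sim_key : forall i, i < 2 ^ w -> kmem s (mkword w i) = ky a i
}.

Hypothesis w16 : 16 < 2 ^ w.

Lemma mkwordK (x : word w) : mkword w x = x.
Proof. by apply: val_inj; rewrite /= modn_small. Qed.

Lemma bool_ltW (b : bool) : b < 2 ^ w.
Proof. by apply: leq_ltn_trans (leq_b1 b) _; apply: leq_trans w16. Qed.

Lemma eval_cell (s : state w K) f e n :
  eval s e = n :> nat -> f < 16 -> n * 16 + 16 <= 2 ^ w ->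
  eval s (cell f e) = mkword w (n * 16 + f).
Proof.
move=> he hf hn; apply: val_inj; rewrite /cell /=.
by rewrite he !(@modn_small _ (2 ^ w)) //; lia.
Qed.

Lemma eval_cexp s a e : sim s a -> df a e -> eval s (cexp e) = ev a e :> nat.
Proof.
case=> hr hm hk; elim: e => [n|r|f e IH|o e1 IH1 e2 IH2|e1 IH1 e2 IH2] /=.
- by move=> h; rewrite modn_small.
- by move=> _; rewrite hr.
- case=> d1 d2 d3; have := eval_cell (IH d1) d3 d2 => /= ->.
  by rewrite hm //; lia.
- case=> /IH1 h1 /IH2 h2; rewrite h1 h2.
  have := ltn_ord (eval s (cexp e1)); rewrite h1 => l1.
  have := ltn_ord (eval s (cexp e2)); rewrite h2 => l2.
  case: o => //= h; try by rewrite modn_small.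
  + by rewrite addnBA 1?ltnW // addnC -addnBA // addnC modnDr modn_small //; lia.
  + by rewrite modn_small //; apply: leq_ltn_trans (leq_div _ _) _.
  + by rewrite modn_small //; apply: leq_ltn_trans (leq_mod _ _) _.
  + by rewrite modn_small //; apply: leq_ltn_trans (leq_div _ _) _.
  + by rewrite -val_eqE /= h1 h2 [LHS]modn_small //; exact: bool_ltW.
  + by rewrite [LHS]modn_small //; exact: bool_ltW.
- case=> /IH1 h1 /IH2 h2.
  have k1 := hk _ (ltn_ord (eval s (cexp e1))); rewrite mkwordK in k1.
  have k2 := hk _ (ltn_ord (eval s (cexp e2))); rewrite mkwordK in k2.
  by rewrite k1 k2 h1 h2 [LHS]modn_small //; exact: bool_ltW.
Qed.

(** A weakest precondition that carries the running time. The starting point is a symbolic state [a]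
    rather than an assertion, so proofs run the program forward on it. Termination is part of the
    claim, and one execution is enough because [exec] is deterministic. *)
Definition tri (c : hcmd) (a : ast) (Q : nat -> ast -> Prop) : Prop :=
  forall s, sim s a ->
  exists t s' a', [/\ exec (ccmd c) s t s', sim s' a' & Q t a'].

Lemma tri_conseq c a (Q Q' : nat -> ast -> Prop) :
  (forall t a', Q t a' -> Q' t a') -> tri c a Q -> tri c a Q'.
Proof.
by move=> h T s /T [t [s' [a' [? ? /h ?]]]]; exists t, s', a'.
Qed.

Lemma tri_skip a (Q : nat -> ast -> Prop) : Q 0 a -> tri HSkip a Q.
Proof. by move=> q s h; exists 0, s, a; split=> //; constructor. Qed.

Lemma tri_set r e a (Q : nat -> ast -> Prop) :
  df a e -> Q (ecost (cexp e)).+1 (setr a r (ev a e)) -> tri (HSet r e) a Q.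
Proof.
move=> d q s h; exists (ecost (cexp e)).+1, (set_reg s r (eval s (cexp e))).
exists (setr a r (ev a e)); split=> //; first by constructor.
case: (h) => hr hm hk; split=> //= r'; rewrite /upd.
by have -> : (r' == r) = eqn r' r by []; case: eqn => //; apply: eval_cexp.
Qed.

Lemma tri_put f e1 e2 a (Q : nat -> ast -> Prop) :
  df a e1 -> df a e2 -> ev a e1 * 16 + 16 <= 2 ^ w -> f < 16 ->
  Q (ecost (cell f (cexp e1)) + ecost (cexp e2)).+1 (setf a f (ev a e1) (ev a e2)) ->
  tri (HPut f e1 e2) a Q.
Proof.
move=> d1 d2 b hf q s h.
exists (ecost (cell f (cexp e1)) + ecost (cexp e2)).+1.
exists (set_mem s (eval s (cell f (cexp e1))) (eval s (cexp e2))).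
exists (setf a f (ev a e1) (ev a e2)); split=> //; first by constructor.
case: (h) => hr hm hk; split=> //= f' i' hf' b'.
have := eval_cell (eval_cexp h d1) hf b => /= ->.
rewrite /upd -val_eqE /= !(@modn_small _ (2 ^ w)) //; last lia.
have -> : (i' * 16 + f' == ev a e1 * 16 + f) = eqn f' f && (i' == ev a e1).
  by have -> : eqn f' f = (f' == f) by []; apply/eqP/andP => [E|[/eqP -> /eqP ->]//]; split; apply/eqP; lia.
by case: andb; [apply: eval_cexp|rewrite hm].
Qed.

Lemma tri_key e1 e2 a (Q : nat -> ast -> Prop) :
  df a e1 -> df a e2 ->
  Q (ecost (cexp e1) + ecost (cexp e2)).+1 (setk a (ev a e1) (ky a (ev a e2))) ->
  tri (HKey e1 e2) a Q.
Proof.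
move=> d1 d2 q s h.
exists (ecost (cexp e1) + ecost (cexp e2)).+1.
exists (set_key s (eval s (cexp e1)) (kmem s (eval s (cexp e2)))).
exists (setk a (ev a e1) (ky a (ev a e2))); split=> //; first by constructor.
case: (h) => hr hm hk; split=> //= i b.
rewrite /upd -val_eqE /= (@modn_small _ (2 ^ w)) // (eval_cexp h d1).
case: eqP => // _; last exact: hk.
by rewrite -hk -(eval_cexp h d2) // mkwordK.
Qed.

Lemma tri_seq c1 c2 a (Q : nat -> ast -> Prop) :
  tri c1 a (fun t1 a1 => tri c2 a1 (fun t2 a2 => Q (t1 + t2) a2)) ->
  tri (HSeq c1 c2) a Q.
Proof.
move=> T s /T [t1 [s1 [a1 [e1 h1 /(_ _ h1)]]]] [t2 [s2 [a2 [e2 h2 q]]]].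
by exists (t1 + t2), s2, a2; split=> //; apply: exec_seq e1 e2.
Qed.

Lemma holds_cexp s a e : sim s a -> df a e -> holds s (cexp e) = (ev a e != 0).
Proof. by move=> h d; rewrite /holds -(eval_cexp h d). Qed.

Lemma tri_if e c1 c2 a (Q : nat -> ast -> Prop) :
  df a e ->
  (ev a e != 0 -> tri c1 a (fun t a' => Q (ecost (cexp e) + t).+1 a')) ->
  (ev a e = 0 -> tri c2 a (fun t a' => Q (ecost (cexp e) + t).+1 a')) ->
  tri (HIf e c1 c2) a Q.
Proof.
move=> d T1 T2 s h; case E: (ev a e != 0).
  have [t [s' [a' [X h' q]]]] := T1 E s h.
  exists (ecost (cexp e) + t).+1, s', a'; split=> //; constructor.
  by rewrite (holds_cexp h d) E.
have [t [s' [a' [X h' q]]]] := T2 (eqP (negbFE E)) s h.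
exists (ecost (cexp e) + t).+1, s', a'; split=> //; constructor.
by rewrite (holds_cexp h d) E.
Qed.

(** A single unfolding, without invariant or variant: every loop below has an induction of its own,
    whose measure also yields the time bound. *)
Lemma tri_while e c a (Q : nat -> ast -> Prop) :
  df a e ->
  (ev a e != 0 -> tri c a (fun t1 a1 =>
     tri (HWhile e c) a1 (fun t2 a2 => Q (ecost (cexp e) + t1 + t2).+1 a2))) ->
  (ev a e = 0 -> Q (ecost (cexp e)).+1 a) ->
  tri (HWhile e c) a Q.
Proof.
move=> d T1 T2 s h; case E: (ev a e != 0).
  have [t1 [s1 [a1 [X1 h1 /(_ _ h1)]]]] := T1 E s h.
  move=> [t2 [s2 [a2 [X2 h2 q]]]].
  exists (ecost (cexp e) + t1 + t2).+1, s2, a2; split=> //.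
  by apply: exec_while_loop X1 X2; rewrite (holds_cexp h d) E.
exists (ecost (cexp e)).+1, s, a; split=> //; last exact: T2 (eqP (negbFE E)).
by apply: exec_while_end; rewrite (holds_cexp h d) E.
Qed.

End Logic.

(** * Bits *)

Definition bit (j m : nat) : bool := odd (m %/ 2 ^ j).

Lemma bit_div j m g : bit j (m %/ 2 ^ g) = bit (g + j) m.
Proof. by rewrite /bit -divnMA -expnD. Qed.

Lemma bit_small j m : m < 2 ^ j -> bit j m = false.
Proof. by move=> h; rewrite /bit divn_small. Qed.

Lemma bit_mod j m g : bit j (m %% 2 ^ g) = (j < g) && bit j m.
Proof.
case: (ltnP j g) => jg /=; last first.
  by apply: bit_small; apply: leq_trans (ltn_pmod _ (expn_gt0 2 g)) _; rewrite leq_exp2l.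
have -> : bit j m = odd (m %/ 2 ^ g * 2 ^ (g - j) + (m %% 2 ^ g) %/ 2 ^ j).
  rewrite -divnMDl ?expn_gt0 // -mulnA -expnD subnK ?(ltnW jg) //.
  by rewrite -divn_eq.
rewrite oddD oddM.
by have -> : odd (2 ^ (g - j)) = false; [rewrite oddX subn_eq0 leqNgt jg|rewrite andbF].
Qed.

Lemma bit_clear j m g : bit j (m %/ 2 ^ g * 2 ^ g) = (g <= j) && bit j m.
Proof.
case: (leqP g j) => jg /=.
  by rewrite /bit -{1}(subnKC jg) expnD divnMA mulnK ?expn_gt0 // -/(bit (j - g) _) bit_div subnKC.
rewrite /bit -{2}(subnK (ltnW jg)) expnD mulnA mulnK ?expn_gt0 // oddM oddX subn_eq0 leqNgt jg.
by rewrite andbF.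
Qed.

Lemma bit_add j m g : ~~ bit g m -> bit j (m + 2 ^ g) = (j == g) || bit j m.
Proof.
move=> bg; case: (ltngtP j g) => /= jg.
- rewrite /bit addnC -{1}(subnK (ltnW jg)) expnD divnMDl ?expn_gt0 // oddD oddX.
  by rewrite subn_eq0 leqNgt jg.
- have -> : j = g + (j - g.+1).+1 by lia.
  rewrite /bit expnD !divnMA -{1}[2 ^ g]mul1n addnC divnMDl ?expn_gt0 // expnS !divnMA.
  congr (odd (_ %/ _)); move: bg; rewrite /bit; lia.
- rewrite jg /bit -{1}[2 ^ g]mul1n addnC divnMDl ?expn_gt0 // oddD /=.
Qed.

Lemma bit_le g m : bit g m -> 2 ^ g <= m.
Proof. by apply: contraTT; rewrite -ltnNge => /bit_small ->. Qed.

Lemma bit_sub j m g : bit g m -> bit j (m - 2 ^ g) = (j != g) && bit j m.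
Proof.
move=> bg; have le := bit_le bg.
have ng : ~~ bit g (m - 2 ^ g).
  apply/negP => h; move: bg; rewrite /bit -{1}(subnK le) -{2}[2 ^ g]mul1n addnC.
  by rewrite divnMDl ?expn_gt0 // oddD -/(bit g (m - 2 ^ g)) h.
rewrite -{2}(subnK le) bit_add //.
by case: eqP => [->|]; [apply: negbTE|].
Qed.

Lemma bit_trunc_log t : 0 < t -> bit (trunc_log 2 t) t.
Proof.
move=> t0; have /andP[h1 h2] : 2 ^ trunc_log 2 t <= t < 2 ^ (trunc_log 2 t).+1.
  exact: trunc_log_bounds.
have : t %/ 2 ^ trunc_log 2 t < 2 by rewrite ltn_divLR ?expn_gt0 // -expnS.
have : 0 < t %/ 2 ^ trunc_log 2 t by rewrite divn_gt0 ?expn_gt0.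
by rewrite /bit; case: (_ %/ _) => [|[|]].
Qed.

Lemma bit_gt_trunc_log t j : trunc_log 2 t < j -> bit j t = false.
Proof.
move=> h; apply: bit_small; apply: leq_trans (@trunc_log_ltn 2 t isT) _.
by rewrite leq_exp2l.
Qed.

Lemma bit_logn s : 0 < s -> bit (logn 2 s) s.
Proof.
move=> s0; have /(pfactor_coprime (isT : prime 2))[m] := s0.
by rewrite coprime2n => om {2}->; rewrite /bit mulnK ?expn_gt0.
Qed.

Lemma bit_lt_logn s j : j < logn 2 s -> bit j s = false.
Proof.
move=> h; have : 2 ^ j.+1 %| s by rewrite pfactor_dvdn //; case: s h; rewrite ?logn0.
by case/dvdnP=> k ->; rewrite /bit expnS mulnA mulnK ?expn_gt0 // oddM andbF.
Qed.

Lemma bits_ltn m k : (forall j, k <= j -> ~~ bit j m) -> m < 2 ^ k.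
Proof.
move=> h; rewrite ltnNge; apply/negP => le.
have m0 : 0 < m by apply: leq_trans le; rewrite expn_gt0.
move: (bit_trunc_log m0); apply/negP/h.
exact: trunc_log_max.
Qed.

Lemma bitsP m : (forall j, ~~ bit j m) -> m = 0.
Proof. by move=> h; have := @bits_ltn m 0 (fun j _ => h j); case: m h. Qed.

Definition popc (w m : nat) : nat := \sum_(j < w) bit j m.

Lemma popc_le w m m' : (forall j, bit j m -> bit j m') -> popc w m <= popc w m'.
Proof. by move=> h; apply: leq_sum => j _; case: (bit j m) (h j) => // ->. Qed.

Lemma sum_eq_ord w g : g < w -> \sum_(j < w) (j == g :> nat) = 1.
Proof.
move=> gw; rewrite (bigD1 (Ordinal gw)) //= eqxx big1 // => j.
by rewrite -val_eqE /= => /negbTE ->.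
Qed.

Lemma popc_add w m g : g < w -> ~~ bit g m -> popc w (m + 2 ^ g) = (popc w m).+1.
Proof.
move=> gw bg; transitivity (popc w m + \sum_(j < w) (j == g :> nat)); last first.
  by rewrite sum_eq_ord // addn1.
rewrite -big_split /=.
by apply: eq_bigr => j _; rewrite bit_add //; case: eqP => [->|_]; rewrite ?(negbTE bg) ?addn0.
Qed.

Lemma popc_sub w m g : g < w -> bit g m -> (popc w (m - 2 ^ g)).+1 = popc w m.
Proof.
move=> gw bg; rewrite -(popc_add gw) ?subnK ?bit_le // bit_sub // eqxx //.
Qed.

Lemma popc_clear w m g : popc w (m %/ 2 ^ g * 2 ^ g) <= popc w m.
Proof. by apply: popc_le => j; rewrite bit_clear => /andP[]. Qed.

(** * Boundaries between levels *)

(* The elements at level at least [j] have positions below [C M j]. *)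
Definition C (M j : nat) : nat := M %/ 2 ^ j * 2 ^ j - 2 ^ j.

Definition inlev (M p j : nat) : bool := (C M j.+1 <= p) && (p < C M j).

Lemma C0 M : C M 0 = M.-1.
Proof. by rewrite /C divn1 muln1 subn1. Qed.

Lemma CS M j : C M j.+1 <= C M j <= C M j.+1 + 2 ^ j.+1.
Proof.
rewrite /C expnSr divnMA; move: (M %/ _) => q; have := expn_gt0 2 j.
move: (2 ^ j) => u /=; have := divn_eq q 2; have := ltn_pmod q (isT : 0 < 2).
move: (q %/ 2) (q %% 2) => a b hb -> hu.
case: a => [|a]; nia.
Qed.

Lemma C_anti M j k : j <= k -> C M k <= C M j.
Proof.
move/subnKC <-; elim: (k - j) => [|d IH]; first by rewrite addn0.
by rewrite addnS; apply: leq_trans IH; case/andP: (CS M (j + d)).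
Qed.

Lemma inlev_uniq M p j k : inlev M p j -> inlev M p k -> j = k.
Proof.
move=> /andP[a b] /andP[c d]; case: (ltngtP j k) => // h.
  by have := C_anti M h; lia.
by have := C_anti M h; lia.
Qed.

Lemma C_gt0 M j : 0 < C M j -> 2 ^ j.+1 <= M.
Proof.
rewrite /C => h; have : 1 < M %/ 2 ^ j by have := expn_gt0 2 j; nia.
by rewrite leq_divRL ?expn_gt0 // expnS.
Qed.

Lemma C_leM M j : 2 ^ j <= M -> C M j + 2 ^ j <= M.
Proof.
move=> h; rewrite /C subnK ?leq_divM //.
by rewrite leq_pmull // divn_gt0 ?expn_gt0.
Qed.

Lemma inlev_gt M p j : inlev M p j -> 2 ^ j.+1 <= M.
Proof. by case/andP=> _ h; apply: C_gt0; lia. Qed.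

(** For [p] in level [j] the distance [M.-1 - p] is at least [2 ^ j] and less than [2 ^ j.+2], so
    its bit length leaves two candidates, and comparing [p] with the boundary [C M m] decides. The
    comparison adds [2 ^ m] to [p] to avoid a truncated subtraction. *)
Lemma find_level M p j : inlev M p j ->
  let m := trunc_log 2 (M.-1 - p) in
  [/\ 0 < M.-1 - p, 2 ^ m <= M.-1 - p &
      j = if p + 2 ^ m < M %/ 2 ^ m * 2 ^ m then m else m.-1].
Proof.
move=> ip; have g := inlev_gt ip; case/andP: (ip) => a b m.
have e1 := expnS 2 j; have e0 := expn_gt0 2 j.
have c1 := @C_leM M j; have c2 := @C_leM M j.+1.
have d0 : 2 ^ j <= M.-1 - p by lia.
have d1 : M.-1 - p < 2 ^ j.+2.
  have := CS M j; rewrite /C in a *; have := divn_eq M (2 ^ j.+1).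
  have := ltn_pmod M (expn_gt0 2 j.+1); rewrite [2 ^ j.+2]expnS; lia.
have p0 : 0 < M.-1 - p by lia.
have /andP[m1 m2] := trunc_log_bounds (isT : 1 < 2) p0.
have mj : j <= m <= j.+1.
  have h1 : j < m.+1 by rewrite -(ltn_exp2l _ _ (isT : 1 < 2)); apply: leq_ltn_trans d0 m2.
  have h2 : m < j.+2 by rewrite -(ltn_exp2l _ _ (isT : 1 < 2)); apply: leq_ltn_trans m1 d1.
  by rewrite -ltnS h1.
split=> //; rewrite addnC -ltn_subRL -/(C M m).
have /orP[/eqP E|/eqP E] : (m == j) || (m == j.+1) by lia.
  by rewrite E b.
by rewrite E ltnNge a.
Qed.

(** The bits of [M] below [i] are ones; if bit [i] is one too, the carry goes on. *)
Lemma dvd_carry i M : 2 ^ i %| M.+1 -> odd (M %/ 2 ^ i) -> 2 ^ i.+1 %| M.+1.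
Proof.
case/dvdnP=> q E; have u := expn_gt0 2 i.
have hq : 0 < q by case: q E.
have -> : M = q.-1 * 2 ^ i + (2 ^ i).-1 by move: (2 ^ i) u E => v; nia.
rewrite divnMDl // divn_small ?addn0; last by lia.
move=> o; have : odd q.-1.+1 = false by rewrite /= o.
rewrite prednK // => o2.
have -> : (q.-1 * 2 ^ i + (2 ^ i).-1).+1 = q./2 * 2 ^ i.+1.
  rewrite expnS mulnA muln2; have := odd_double_half q; rewrite o2 add0n => ->.
  by move: (2 ^ i) u => v; nia.
exact: dvdn_mull.
Qed.

(** * Boundaries under an increment of the counter *)

Section Increment.
Variables (i M : nat).
Hypothesis dv : 2 ^ i %| M.+1.

Lemma incr_lo j : j <= i -> 2 ^ j %| M.+1.
Proof. by move=> h; apply: dvdn_trans dv; rewrite dvdn_exp2l. Qed.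

Lemma div_incr j : j <= i -> (M.+1 %/ 2 ^ j) = (M %/ 2 ^ j).+1.
Proof.
move=> /incr_lo /dvdnP[q E]; have u := expn_gt0 2 j.
rewrite E mulnK //; have hq : 0 < q by case: q E.
have -> : M = q.-1 * 2 ^ j + (2 ^ j).-1 by move: (2 ^ j) u E => v; nia.
rewrite divnMDl // divn_small ?addn0 ?prednK //; lia.
Qed.

(** [M.+1] is a multiple of [2 ^ j.+1], so its boundary [j.+1] falls exactly where boundary [j] was:
    below the carry, level [j] turns into level [j.+1] while all positions stay. *)
Lemma C_incr_lo j : j < i -> C M.+1 j.+1 = C M j.
Proof.
move=> h; rewrite /C divnK ?incr_lo //.
have := divnK (incr_lo (ltnW h)); rewrite div_incr ?(ltnW h) // expnS; nia.
Qed.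

Lemma C_incr_eq : C M i <= C M.+1 i.
Proof. by rewrite /C div_incr // mulSn leq_sub2r // leq_addl. Qed.

Lemma bit_incr_lo j : j < i -> bit j M.
Proof.
move=> h; have := div_incr (ltnW h); rewrite /bit.
have /dvdnP[q ->] := incr_lo h; rewrite expnS mulnA mulnK ?expn_gt0 //; lia.
Qed.

Hypothesis ev : ~~ odd (M %/ 2 ^ i).

Lemma div_incr_hi j : i < j -> M.+1 %/ 2 ^ j = M %/ 2 ^ j.
Proof.
move=> h; have -> : j = i + (j - i.+1).+1 by lia.
by rewrite expnD !divnMA expnS !divnMA div_incr //; congr (_ %/ _); lia.
Qed.

Lemma C_incr_hi j : i < j -> C M.+1 j = C M j.
Proof. by move=> h; rewrite /C div_incr_hi. Qed.

(** The [i] trailing ones vanish and bit [i] appears, as in the classical analysis of a binary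
    counter; each vanished bit pays for one carry. *)
Lemma popc_incr w : i <= w -> popc w M.+1 + i <= (popc w M).+1.
Proof.
move=> iw; have H : forall d : nat, d < i.+1 -> popc d M = d.
  move=> d; rewrite ltnS => di; rewrite -[RHS]card_ord -sum1_card.
  by apply: eq_bigr => j _; rewrite bit_incr_lo //; apply: leq_trans di.
have S m : popc w m = popc i m + \sum_(j < w - i) bit (i + j) m.
  rewrite /popc -!(big_mkord xpredT (fun j => nat_of_bool (bit j m))).
  rewrite (big_cat_nat _ iw) //= -{2}[i]add0n big_addn big_mkord; congr (_ + _).
  by rewrite big_mkord; apply: eq_bigr => j _; rewrite addnC.
rewrite !S (H i) //; have -> : popc i M.+1 = 0.
  apply: big1 => j _; case/dvdnP: dv => q ->.
  by rewrite -{2}(subnK (ltn_ord j)) expnD mulnA expnS mulnA /bit mulnK ?expn_gt0 // oddM andbF.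
rewrite add0n addnC -addnS leq_add2l.
case: (w - i) => [|d]; first by rewrite !big_ord0.
rewrite !big_ord_recl /= addn0 {1}/bit div_incr // /= ev.
rewrite add1n ltnS; apply: leq_trans (leq_addl _ _); apply: leq_sum => j _.
by rewrite /bit div_incr_hi // /bump /=; lia.
Qed.

End Increment.

(** * Boundaries under a rebuild *)

Section Lower.
Variables (i M : nat).
Hypothesis dv : 2 ^ i %| M.+1.
Hypothesis od : odd (M %/ 2 ^ i).
Let M' := M.+1 - 2 ^ i.

Lemma lower_ge : 2 ^ i <= M.
Proof.
by have : 0 < M %/ 2 ^ i; [case: (_ %/ _) od|rewrite divn_gt0 ?expn_gt0].
Qed.

(** The low [i] bits of [M] are ones, so the new counter is [M] with these bits cleared; the
    boundaries from [i] up depend only on the other bits. *)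
Lemma lower_eq : M' = M %/ 2 ^ i * 2 ^ i.
Proof.
have := divnK dv; rewrite (div_incr dv) // mulSn /M' => <-.
by rewrite addKn.
Qed.

Lemma C_lower_hi j : i <= j -> C M' j = C M j.
Proof.
by move=> h; rewrite /C lower_eq -(subnKC h) expnD !divnMA mulnK ?expn_gt0.
Qed.

Lemma popc_lower w : popc w M' <= popc w M.
Proof. by rewrite lower_eq popc_clear. Qed.

End Lower.

(** * Half-ordered trees *)

Inductive tree : Type := E | T of nat & tree & tree.

Fixpoint tree_eq (t u : tree) : bool :=
  match t, u with
  | E, E => true
  | T x l r, T y l' r' => [&& x == y, tree_eq l l' & tree_eq r r']
  | _, _ => false
  end.

Lemma tree_eqP : Equality.axiom tree_eq.
Proof.
elim=> [|x l IHl r IHr] [|y l' r'] /=; try by constructor.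
apply: (iffP and3P) => [[/eqP -> /IHl -> /IHr ->] //|[-> <- <-]].
by rewrite eqxx; split=> //; [apply/IHl|apply/IHr].
Qed.

HB.instance Definition _ := hasDecEq.Build tree tree_eqP.

(** A relaxation of the rank rules of rank-pairing heaps: the two rank differences of a node are 0
    and at least 3, or 1 and at most 3. The gap 3 is what a spine node that inherits the rank of its
    right child spends on becoming a root. *)
Definition rule (a b : nat) : nat :=
  if a + 3 <= b then b else if b + 3 <= a then a else if a < b then b.+1 else a.+1.

(* The empty tree has rank 0: ranks are one more than in rank-pairing heaps. *)
Fixpoint rk (t : tree) : nat := if t is T _ l r then rule (rk l) (rk r) else 0.

Fixpoint nodes (t : tree) : seq nat :=
  if t is T x l r then x :: nodes l ++ nodes r else [::].

Fixpoint dsum (t : tree) : nat :=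
  if t is T x l r then (rk t - rk l) + (rk t - rk r) + dsum l + dsum r else 0.

Lemma exp3 a b k : k <= a + 3 -> k <= b + 3 -> 2 ^ (k %/ 3) <= 2 ^ (a %/ 3) + 2 ^ (b %/ 3).
Proof.
move=> ha hb; case: (ltnP k 3) => hk.
  by rewrite divn_small // expn0 addn_gt0 expn_gt0.
have -> : k %/ 3 = ((k - 3) %/ 3).+1 by lia.
rewrite expnS mul2n -addnn; apply: leq_add; rewrite leq_exp2l //; lia.
Qed.

(** Either the rank is inherited from a child, or both children have rank at least [rk t - 3]; hence
    sizes double every three ranks. *)
Lemma rk_size t : 2 ^ (rk t %/ 3) <= (size (nodes t)).+1.
Proof.
elim: t => [|x l IHl r IHr] //=; rewrite size_cat.
have X := @exp3 (rk l) (rk r); rewrite /rule; do ?case: ifP => ?; try lia.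
  by have := X (rk r).+1; lia.
by have := X (rk l).+1; lia.
Qed.

Lemma rk_le_size t : rk t <= size (nodes t).
Proof.
elim: t => [|x l IHl r IHr] //=; rewrite size_cat /rule.
by do ?case: ifP => _; lia.
Qed.

Lemma rule_ge a b : a <= rule a b /\ b <= rule a b.
Proof. by rewrite /rule; do ?case: ifP => ?; lia. Qed.

Lemma rule_eqr a b : rule a b = b -> a + 3 <= b.
Proof. by rewrite /rule; do ?case: ifP => ?; lia. Qed.

Lemma rule_same a : rule a a = a.+1.
Proof. by rewrite /rule; do ?case: ifP => ?; lia. Qed.

Lemma rule_monol a a' b : a' <= a -> rule a' b <= rule a b.
Proof.
by move=> ?; rewrite /rule; do ?case: ifP => ?; lia.
Qed.

Lemma rule_monor a b b' : b' <= b -> rule a b' <= rule a b.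
Proof.
by move=> ?; rewrite /rule; do ?case: ifP => ?; lia.
Qed.

(** * Half trees *)

(* A root together with its left subtree. *)
Definition htree : Type := (nat * tree)%type.

Definition hnodes (h : htree) : seq nat := h.1 :: nodes h.2.
Definition hrk (h : htree) : nat := (rk h.2).+1.
Definition fnodes (s : seq htree) : seq nat := flatten [seq hnodes h | h <- s].
Arguments fnodes : simpl never.
(** The weights match the two structural changes. A link replaces a root, worth 5, by two rank
    differences of 1, worth 4, and frees a unit. A spine node that releases a difference of 3 gets
    6, enough for a new root and one unit of work. *)
Definition pot (h : htree) : nat := 2 * dsum h.2 + 5.
Definition fpot (s : seq htree) : nat := sumn [seq pot h | h <- s].

Arguments fpot : simpl never.

Fixpoint spine (t : tree) : seq htree :=
  if t is T y l r then (y, l) :: spine r else [::].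

Lemma fnodes_cat s1 s2 : fnodes (s1 ++ s2) = fnodes s1 ++ fnodes s2.
Proof. by rewrite /fnodes map_cat flatten_cat. Qed.

Lemma fpot_cat s1 s2 : fpot (s1 ++ s2) = fpot s1 + fpot s2.
Proof. by rewrite /fpot map_cat sumn_cat. Qed.

Lemma perm_fnodes (s1 s2 : seq htree) : perm_eq s1 s2 -> perm_eq (fnodes s1) (fnodes s2).
Proof. by move=> h; apply: perm_flatten; apply: perm_map. Qed.

Lemma perm_fpot (s1 s2 : seq htree) : perm_eq s1 s2 -> fpot s1 = fpot s2.
Proof. by move=> h; rewrite /fpot; apply: perm_sumn; apply: perm_map. Qed.

Lemma fnodes_spine t : fnodes (spine t) = nodes t.
Proof. by elim: t => //= x l _ r IH; rewrite /fnodes /= -/(fnodes _) IH. Qed.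

Lemma hrk_size h : 2 ^ ((hrk h).-1 %/ 3) <= size (hnodes h).
Proof. exact: rk_size. Qed.

Lemma hrk_le_size h : hrk h <= size (hnodes h).
Proof. exact: rk_le_size. Qed.

(* A spine node either has a right child of smaller rank, which can happen at
   most [rk t] times, or a left child whose rank is smaller by 3. *)
Lemma spine_pot t : size (spine t) + fpot (spine t) <= 2 * dsum t + 6 * rk t.
Proof.
elim: t => //= x l _ r IH; rewrite /fpot /= -/(fpot _) /pot /=.
have := rule_ge (rk l) (rk r); have := @rule_eqr (rk l) (rk r); lia.
Qed.

Lemma fnodes_cons h s : fnodes (h :: s) = hnodes h ++ fnodes s.
Proof. by []. Qed.

Lemma fpot_cons h s : fpot (h :: s) = pot h + fpot s.
Proof. by []. Qed.

Lemma fpot_size s : 5 * size s <= fpot s.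
Proof. by elim: s => //= h s IH; rewrite fpot_cons /pot; lia. Qed.

(** * Contexts *)

(* [FL x r] is the context of a left child of [x] whose sibling is [r]. *)
Inductive frame : Type := FL of nat & tree | FR of nat & tree.

Definition fill (f : frame) (t : tree) : tree :=
  match f with FL x r => T x t r | FR x l => T x l t end.

Definition fnode (f : frame) : nat := match f with FL x _ | FR x _ => x end.
Definition fsib (f : frame) : tree := match f with FL _ r | FR _ r => r end.

Fixpoint plug (c : seq frame) (t : tree) : tree :=
  if c is f :: c' then plug c' (fill f t) else t.

Definition cnodes (c : seq frame) : seq nat :=
  flatten [seq fnode f :: nodes (fsib f) | f <- c].

Lemma nodes_fill f t : perm_eq (nodes (fill f t)) (nodes t ++ fnode f :: nodes (fsib f)).
Proof.
case: f => x s /=; rewrite -[x :: nodes s]cat1s perm_sym perm_catCA /= perm_cons //.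
by rewrite perm_catC.
Qed.

Lemma nodes_plug c t : perm_eq (nodes (plug c t)) (nodes t ++ cnodes c).
Proof.
elim: c t => [|f c IH] t; first by rewrite /= cats0.
apply: perm_trans (IH _) _; rewrite /cnodes /= -/(cnodes c) -cat_cons catA.
by rewrite perm_cat2r nodes_fill.
Qed.

Lemma plug_cat c1 c2 t : plug (c1 ++ c2) t = plug c2 (plug c1 t).
Proof. by elim: c1 t => //= f c IH t. Qed.

Lemma zipper x t : x \in nodes t -> exists c l r, t = plug c (T x l r).
Proof.
elim: t => [|y l IHl r IHr] //=; rewrite inE mem_cat => /or3P[/eqP ->|/IHl|/IHr].
- by exists [::], l, r.
- by case=> c [l' [r' ->]]; exists (c ++ [:: FL y r]), l', r'; rewrite plug_cat.
- by case=> c [l' [r' ->]]; exists (c ++ [:: FR y l]), l', r'; rewrite plug_cat.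
Qed.

Lemma rk_fill_mono f t t' : rk t' <= rk t -> rk (fill f t') <= rk (fill f t).
Proof. by case: f => x s /= h; [apply: rule_monol|apply: rule_monor]. Qed.

(** Number of ancestors whose rank is corrected before the upward walk of [crank] meets an unchanged
    rank or the root. *)
Fixpoint steps (c : seq frame) (t t' : tree) : nat :=
  if c is f :: c' then
    if rk (fill f t') == rk (fill f t) then 0
    else (steps c' (fill f t) (fill f t')).+1
  else 0.

Lemma dsum_fill f t : dsum (fill f t) =
  (rk (fill f t) - rk t) + (rk (fill f t) - rk (fsib f)) + dsum t + dsum (fsib f).
Proof. by case: f => x s /=; lia. Qed.

Lemma rk_fill_ge f t : rk t <= rk (fill f t) /\ rk (fsib f) <= rk (fill f t).
Proof. by case: f => x s /=; have [] := rule_ge (rk t) (rk s); have [] := rule_ge (rk s) (rk t). Qed.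

(** When the rank of an ancestor drops by [d], its two own differences shrink by [d] each and the
    one to its parent grows by [d]. The net loss, at least one per corrected ancestor, pays for the
    walk; [rk t - rk t'] is the growth at the hole itself. *)
Lemma dsum_plug c t t' : rk t' <= rk t ->
  dsum (plug c t') + dsum t + steps c t t' <= dsum (plug c t) + dsum t' + (rk t - rk t').
Proof.
elim: c t t' => [|f c IH] t t' h /=; first by lia.
have m := rk_fill_mono f h; have := IH _ _ m; rewrite !dsum_fill.
have := rk_fill_ge f t; have := rk_fill_ge f t'.
case: eqP => [e|ne]; lia.
Qed.

(** The growth at the hole is the difference between [x] and [r], and that edge disappears with the
    cut. *)
Lemma cut_dsum c x l r :
  dsum (plug c r) + dsum l + steps c (T x l r) r <= dsum (plug c (T x l r)).
Proof.
have [g1 g2] := rule_ge (rk l) (rk r).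
by have := @dsum_plug c (T x l r) r g2; rewrite /=; lia.
Qed.

(** * Heap order *)

Section Order.
Variables (disp : Order.disp_t) (K : orderType disp).
Implicit Type k : nat -> K.
Local Open Scope order_scope.

Fixpoint hord k (t : tree) : Prop :=
  if t is T x l r then [/\ {in nodes l, forall y, k x <= k y}, hord k l & hord k r]
  else True.

Definition hhord k (h : htree) : Prop := {in nodes h.2, forall y, k h.1 <= k y} /\ hord k h.2.

Lemma hord_ext k k' t : {in nodes t, k =1 k'} -> hord k t -> hord k' t.
Proof.
elim: t => //= x l IHl r IHr h [a b c]; split.
- by move=> y yl; rewrite -!h ?inE ?eqxx ?mem_cat ?yl ?orbT //; apply: a.
- by apply: IHl b => y yl; apply: h; rewrite inE mem_cat yl orbT.
- by apply: IHr c => y yl; apply: h; rewrite inE mem_cat yl !orbT.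
Qed.

Lemma hhord_ext k k' h : {in hnodes h, k =1 k'} -> hhord k h -> hhord k' h.
Proof.
move=> e [a b]; split; last by apply: hord_ext b => y yl; apply: e; rewrite inE yl orbT.
by move=> y yl; rewrite -!e ?inE ?eqxx ?yl ?orbT //; apply: a.
Qed.

Lemma hord_plugl k c t : hord k (plug c t) -> hord k t.
Proof.
elim: c t => //= f c IH t /IH; case: f => x s /=; by case.
Qed.

Lemma hord_plug k c t t' : {subset nodes t' <= nodes t} -> hord k t' ->
  hord k (plug c t) -> hord k (plug c t').
Proof.
elim: c t t' => [|f c IH] t t' s h //= hp; have hf := hord_plugl hp; apply: IH hp.
  by case: (f) => x u /= y; rewrite !inE !mem_cat => /or3P[->//|h1|h1]; rewrite ?h1 ?(s _ h1) ?orbT.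
move: hf; case: f => x u /= [a b d]; split=> // y /s; exact: a.
Qed.

Lemma spine_hord k t : hord k t -> {in spine t, forall h, hhord k h}.
Proof.
by elim: t => //= x l _ r IH [a b c] h; rewrite inE => /orP[/eqP ->|/(IH c)].
Qed.

End Order.

(** * Trees in memory *)

(* Fields: 0 left child, 1 right child (next root on a circle of roots for a
   root), 2 parent in the binary tree (0 for a root), 3 rank. *)
Section Memory.
Implicit Types (F : nat -> nat -> nat).

Fixpoint rep F (u : nat) (t : tree) (p : nat) : Prop :=
  if t is T x l r then
    [/\ p = x, 0 < x, F 2 x = u, F 3 x = rk t
      & rep F x l (F 0 x) /\ rep F x r (F 1 x)]
  else p = 0.

(** Field 1 of the root is left free: it is the link of the circle, while inside the tree the same
    field is the right child. *)
Definition hrep F (h : htree) : Prop :=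
  [/\ 0 < h.1, F 2 h.1 = 0 & rep F h.1 h.2 (F 0 h.1)].

Lemma rep_ext F F' u t p :
  (forall f x, f < 4 -> x \in nodes t -> F' f x = F f x) ->
  rep F u t p -> rep F' u t p.
Proof.
elim: t u p => //= x l IHl r IHr u p h [-> x0 e2 e3 [hl hr]].
have hx f : f < 4 -> F' f x = F f x by move=> f4; apply: h; rewrite ?inE ?eqxx.
rewrite !hx //; do ?split=> //.
  by apply: IHl hl => f y f4 yl; apply: h; rewrite // inE mem_cat yl orbT.
by apply: IHr hr => f y f4 yl; apply: h; rewrite // inE mem_cat yl !orbT.
Qed.

Lemma hrep_ext F F' h :
  (forall f x, f < 4 -> x \in hnodes h -> (f != 1) || (x != h.1) -> F' f x = F f x) ->
  h.1 \notin nodes h.2 -> hrep F h -> hrep F' h.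
Proof.
move=> e nh [h0 h2 hr]; rewrite /hrep !e // ?inE ?eqxx //; split=> //.
apply: rep_ext hr => f x f4 xn; apply: e => //; first by rewrite inE xn orbT.
by apply/orP; right; apply: contraNneq nh => <-.
Qed.

Lemma rep_rk F u t p : F 3 0 = 0 -> rep F u t p -> F 3 p = rk t.
Proof. by move=> z; case: t => [->|x l r /= [->]]. Qed.

Lemma rep_root F u t p : rep F u t p -> p != 0 -> p \in nodes t.
Proof. by case: t => [->|x l r /= [-> _ _ _ _] _]; rewrite ?inE ?eqxx. Qed.

Lemma rep_gt0 F u t p x : rep F u t p -> x \in nodes t -> 0 < x.
Proof.
elim: t u p => //= y l IHl r IHr u p [_ y0 _ _ [hl hr]].
by rewrite inE mem_cat => /or3P[/eqP ->//|/(IHl _ _ hl)|/(IHr _ _ hr)].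
Qed.

Lemma rep_up F u t p x : rep F u t p -> 0 < u -> x \in nodes t -> F 2 x != 0.
Proof.
elim: t u p => //= y l IHl r IHr u p [_ y0 h2 _ [hl hr]] u0.
by rewrite inE mem_cat => /or3P[/eqP ->|/(IHl _ _ hl)->|/(IHr _ _ hr)->//]; rewrite // h2 -lt0n.
Qed.

Lemma hrep_up F h x : hrep F h -> x \in nodes h.2 -> F 2 x != 0.
Proof. by case=> h0 h2 hr; apply: rep_up hr h0. Qed.

Definition side (f : frame) : nat := if f is FL _ _ then 0 else 1.

(* [crep F root p0 c t u q]: the context [c] lies below [root], whose left
   pointer is [p0]; its hole is the child [q] of [u], and the stored ranks are
   those obtained by plugging [t]. *)
Fixpoint crep F root p0 (c : seq frame) (t : tree) (u q : nat) : Prop :=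
  if c is f :: c' then
    [/\ 0 < fnode f, u = fnode f, F 3 u = rk (fill f t), q = F (side f) u
      & rep F u (fsib f) (F (1 - side f) u) /\ crep F root p0 c' (fill f t) (F 2 u) u]
  else u = root /\ q = p0.

Lemma rep_plug F root p0 c t :
  rep F root (plug c t) p0 <-> exists u q, crep F root p0 c t u q /\ rep F u t q.
Proof.
elim: c t => [|f c IH] t /=.
  by split=> [h|[u [q [[-> ->]]]]] //; exists root, p0.
rewrite IH; split.
  move=> [u [q [hc]]]; case: f hc => x s /= hc [eq x0 h2 h3 [hl hr]]; rewrite eq in hc.
    by exists x, (F 0 x); rewrite h2.
  by exists x, (F 1 x); rewrite h2.
move=> [u [q [[x0 -> h3 -> [hs hc]] ht]]].
exists (F 2 (fnode f)), (fnode f); split=> //.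
by case: f x0 h3 hs ht {hc} => x s /= x0 h3 hs ht.
Qed.

Lemma crep_ext F F' root p0 c t u q :
  (forall f x, f < 4 -> x \in cnodes c -> F' f x = F f x) ->
  crep F root p0 c t u q -> crep F' root p0 c t u q.
Proof.
elim: c t u q => //= f c IH t u q h [x0 -> h3 -> [hs hc]].
have hx g : g < 4 -> F' g (fnode f) = F g (fnode f).
  by move=> g4; apply: h => //; rewrite /cnodes /= inE eqxx.
have s4 : side f < 4 /\ 1 - side f < 4 by case: (f).
case: s4 => s1 s2; rewrite !hx //; do ?split=> //.
  by apply: rep_ext hs => g x g4 xs; apply: h => //; rewrite /cnodes /= inE mem_cat xs orbT.
by apply: IH hc => g x g4 xs; apply: h => //; rewrite /cnodes /= inE mem_cat -/(cnodes _) xs !orbT.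
Qed.

Lemma crep_rk F root p0 c t t' u q : rk t = rk t' ->
  crep F root p0 c t u q -> crep F root p0 c t' u q.
Proof.
elim: c t t' u q => //= f c IH t t' u q e [x0 -> h3 -> [hs hc]].
have ef : rk (fill f t) = rk (fill f t') by case: (f) => x s /=; rewrite e.
by rewrite -ef; do ?split=> //; apply: IH hc.
Qed.

Lemma crep_up F root p0 c t u q : 0 < root -> F 2 root = 0 -> crep F root p0 c t u q ->
  u \in root :: cnodes c /\ (F 2 u == 0) = nilp c.
Proof.
move=> r0 r2; case: c => [|f c] /=; first by case=> -> _; rewrite r2 inE eqxx.
case=> x0 -> _ _ [_ hc]; split; first by rewrite /cnodes /= !inE eqxx orbT.
case: c hc => [[-> _]|g c /= [y0 -> _ _ _]]; first by apply: negbTE; rewrite -lt0n.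
by apply: negbTE; rewrite -lt0n.
Qed.

Definition circ F (s : seq htree) : Prop := fcycle (F 1) [seq h.1 | h <- s].

Lemma circ_ext F F' s : {in [seq h.1 | h <- s], F' 1 =1 F 1} -> circ F s -> circ F' s.
Proof.
rewrite /circ; move: [seq h.1 | h <- s] => l e.
have st : {in l &, forall x y, (frel (F' 1)) x y = (frel (F 1)) x y}.
  by move=> x y xl yl; rewrite /= e.
by rewrite (eq_in_cycle st) ?all_predT //; apply/allP.
Qed.

Section LRep.
Variables (disp : Order.disp_t) (K : orderType disp).
Implicit Type k : nat -> K.

(* A level: a circle of half trees entered at its minimum [m]. *)
Definition lrep F k (s : seq htree) (m : nat) : Prop :=
  [/\ m = head 0 [seq h.1 | h <- s], circ F s, {in s, forall h, hrep F h},
      {in s, forall h, hhord k h} & {in [seq h.1 | h <- s], forall y, (k m <= k y)%O}].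

Lemma lrep_nil F k m : m = 0 -> lrep F k [::] m.
Proof. by move=> ->. Qed.

Lemma lrep_min F k s m : lrep F k s m -> {in fnodes s, forall y, (k m <= k y)%O}.
Proof.
case=> _ _ _ ho mi y /flatten_mapP[h hs]; rewrite inE => /orP[/eqP ->|yh].
  by apply: mi; apply: map_f.
apply: le_trans (mi h.1 (map_f _ hs)) _; by case: (ho _ hs) => a _; apply: a.
Qed.

Lemma lrep0 F k s m : lrep F k s m -> (m == 0) = nilp s.
Proof.
case: s => [|h s] [-> _ hr _ _] //=; have [h0 _ _] := hr h (mem_head _ _).
by apply: negbTE; rewrite -lt0n.
Qed.

Lemma lrep_ext F F' k k' s m :
  (forall f x, f < 4 -> x \in fnodes s -> F' f x = F f x) -> uniq (fnodes s) ->
  {in fnodes s, k =1 k'} -> lrep F k s m -> lrep F' k' s m.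
Proof.
move=> e u ek [hm hc hr ho mi].
have sub h : h \in s -> {subset hnodes h <= fnodes s}.
  by move=> hs x xh; apply/flatten_mapP; exists h.
have subr : {subset [seq h.1 | h <- s] <= fnodes s}.
  by move=> x /mapP[h hs ->]; apply: (sub h) => //; rewrite inE eqxx.
split=> //.
- by apply: circ_ext hc => x /subr xs; apply: e.
- move=> h hs; apply: hrep_ext (hr h hs) => [f x f4 /(sub _ hs) xs _|]; first exact: e.
  have [s1 [s2 es]] : exists s1 s2, s = s1 ++ h :: s2.
    by case/splitPr: hs => s1 s2; exists s1, s2.
  by move: u; rewrite es fnodes_cat fnodes_cons cat_uniq => /and3P[_ _]; rewrite cat_uniq /= => /andP[/andP[]].
- by move=> h hs; apply: hhord_ext (ho h hs) => x /(sub _ hs); apply: ek.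
move=> y ys; rewrite -!ek; [exact: mi| exact: subr|].
by apply: subr; rewrite hm; case: (s) ys => //= h s' _; rewrite inE eqxx.
Qed.

End LRep.
End Memory.

(** * The program *)

(* Registers: 0 input and output, 1 number [n] of insertions, 2 counter [M],
   3 mask of the records, 4 to 28 scratch.  The element inserted [n]-th is the
   record [n]; its fields, besides those of trees, are 4 position, 5 previous
   and 6 next present element in order of insertion (element 0 is a sentinel).
   Record [j] also holds: 7 bit length of [j], 8 dyadic valuation of [j],
   9 minimum and 10 size of level [j], 11 root of rank [j] during a
   consolidation. *)

Declare Scope hprog_scope.
Delimit Scope hprog_scope with H.
Local Open Scope hprog_scope.
Notation "c ;; d" := (HSeq c d) (at level 61, right associativity) : hprog_scope.
Notation "a +! b" := (HB BAdd a b) (at level 50, left associativity) : hprog_scope.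
Notation "a -! b" := (HB BSub a b) (at level 50, left associativity) : hprog_scope.
Notation "a *! b" := (HB BMul a b) (at level 40, left associativity) : hprog_scope.
Notation "a /! b" := (HB BDiv a b) (at level 40, left associativity) : hprog_scope.
Notation "a %! b" := (HB BMod a b) (at level 40, left associativity) : hprog_scope.
Notation "a <<! b" := (HB BShl a b) (at level 40, left associativity) : hprog_scope.
Notation "a >>! b" := (HB BShr a b) (at level 40, left associativity) : hprog_scope.
Notation "a ==! b" := (HB BEq a b) (at level 70) : hprog_scope.
Notation "a <! b" := (HB BLt a b) (at level 70) : hprog_scope.

(* Adds the circle entered at register 21 to the level in register 20. *)
Definition cmeld : hcmd :=
  HIf (HV 21)
    (HSet 22 (HF 9 (HV 20)) ;;
     HIf (HV 22)
       (HSet 23 (HF 1 (HV 22)) ;;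
        HPut 1 (HV 22) (HF 1 (HV 21)) ;;
        HPut 1 (HV 21) (HV 23) ;;
        HIf (HK (HV 22) (HV 21)) HSkip (HPut 9 (HV 20) (HV 21)))
       (HPut 9 (HV 20) (HV 21)))
    HSkip.

Definition crule : hcmd :=
  HIf (HV 9 +! HC 2 <! HV 10) (HSet 11 (HV 10))
    (HIf (HV 10 +! HC 2 <! HV 9) (HSet 11 (HV 9))
       (HIf (HV 9 <! HV 10) (HSet 11 (HV 10 +! HC 1)) (HSet 11 (HV 9 +! HC 1)))).

(** Register 7 is the current ancestor and register 8 its parent. The rank of a root is not stored
    but read off its left child, so the loop ends once register 8 is null. *)
Definition crank : hcmd :=
  HWhile (HV 8)
    (HSet 9 (HF 3 (HF 0 (HV 7))) ;;
     HSet 10 (HF 3 (HF 1 (HV 7))) ;;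
     crule ;;
     HIf (HV 11 ==! HF 3 (HV 7))
       (HSet 8 (HC 0))
       (HPut 3 (HV 7) (HV 11) ;; HSet 7 (HV 8) ;; HSet 8 (HF 2 (HV 7)))).

(* Detaches the node in register 5 from its parent, in register 7. *)
Definition ccut : hcmd :=
  HSet 8 (HF 1 (HV 5)) ;;
  HIf (HF 0 (HV 7) ==! HV 5) (HPut 0 (HV 7) (HV 8)) (HPut 1 (HV 7) (HV 8)) ;;
  HPut 2 (HV 8) (HV 7) ;;
  HPut 2 (HV 5) (HC 0) ;;
  HPut 1 (HV 5) (HV 5) ;;
  HSet 8 (HF 2 (HV 7)) ;;
  crank.

(** * Symbolic execution of programs *)

Ltac clr :=
  repeat match goal with
  | H : ?T |- _ =>
    lazymatch T with
    | is_true (leq _ _) => fail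
    | is_true (negb (@eq_op _ _ 0)) => fail
    | is_true (andb (leq _ _) (leq _ _)) => fail
    | @eq bool (leq _ _) _ => fail
    | @eq nat _ _ => fail
    | ~ @eq nat _ _ => fail
    | _ => clear H
    end
  end.
Ltac alia := clr; lia.
Ltac perml := apply/permP => ?; rewrite /= ?count_cat /= ?count_cat /= ?count_cat; clear; lia.
Ltac dfs := rewrite /=; do ?split; rewrite //=; try alia.
Ltac stp w16 :=
  lazymatch goal with
  | |- tri _ (HSeq _ _) _ _ => apply: tri_seq
  | |- tri _ (HSet _ _) _ _ => apply: (tri_set w16); [dfs|rewrite /=]
  | |- tri _ (HPut _ _ _) _ _ => apply: (tri_put w16); [dfs|dfs|dfs|done|rewrite /=]
  | |- tri _ (HKey _ _) _ _ => apply: (tri_key w16); [dfs|dfs|rewrite /=]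
  | |- tri _ HSkip _ _ => apply: tri_skip; rewrite /=
  | |- tri _ (HIf _ _ _) _ _ => apply: (tri_if w16); [dfs|rewrite /=|rewrite /=]
  | |- tri _ (HWhile _ _) _ _ => apply: (tri_while w16); [dfs|rewrite /=|rewrite /=]
  end.

Lemma nat_of_bool_neq0 (b : bool) : (nat_of_bool b != 0) = b.
Proof. by case: b. Qed.

Lemma nat_of_bool_eq0 (b : bool) : nat_of_bool b = 0 -> b = false.
Proof. by case: b. Qed.

(** * Roots of a forest, and splicing of circles *)

Lemma uniq_roots s : uniq (fnodes s) -> uniq [seq h.1 | h <- s].
Proof.
elim: s => [|h s IH] //; rewrite fnodes_cons /= mem_cat negb_or cat_uniq.
move=> /and3P[/andP[_ h1] _ /andP[_ /IH ->]]; rewrite andbT.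
apply: contra h1 => /mapP[h' hs ->]; apply/flatten_mapP; exists h' => //.
by rewrite inE eqxx.
Qed.

Lemma roots_sub s : {subset [seq h.1 | h <- s] <= fnodes s}.
Proof.
by move=> x /mapP[h hs ->]; apply/flatten_mapP; exists h; rewrite // inE eqxx.
Qed.

Lemma hnodes_sub (s : seq htree) h : h \in s -> {subset hnodes h <= fnodes s}.
Proof. by move=> hs x xh; apply/flatten_mapP; exists h. Qed.

Lemma inner_not_root s h x : uniq (fnodes s) -> h \in s -> x \in nodes h.2 ->
  x \notin [seq h.1 | h <- s].
Proof.
move=> u hs; case/splitPr: hs u => s1 s2; rewrite fnodes_cat fnodes_cons => u xh.
apply/negP; rewrite map_cat mem_cat /= inE => /or3P[/roots_sub x1|/eqP e|/roots_sub x2].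
- move: u; rewrite cat_uniq => /and3P[_ /hasPn/(_ x) hx _].
  by move: hx; rewrite mem_cat inE xh orbT x1 => /(_ isT).
- move: u; rewrite cat_uniq => /and3P[_ _]; rewrite /hnodes /= mem_cat negb_or.
  by rewrite -e xh.
- move: u; rewrite cat_uniq => /and3P[_ _]; rewrite cat_uniq => /and3P[_ /hasPn/(_ x x2)].
  by rewrite inE xh orbT.
Qed.

Lemma uniq_hnodes s h : uniq (fnodes s) -> h \in s -> uniq (hnodes h).
Proof.
move=> u hs; case/splitPr: hs u => s1 s2; rewrite fnodes_cat fnodes_cons.
by rewrite cat_uniq => /and3P[_ _]; rewrite cat_uniq => /and3P[].
Qed.

Lemma hreps_ext (F F' : nat -> nat -> nat) s : uniq (fnodes s) ->
  (forall f i, f < 4 -> f <> 1 -> F' f i = F f i) ->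
  (forall i, i \notin [seq h.1 | h <- s] -> F' 1 i = F 1 i) ->
  {in s, forall h, hrep F h} -> {in s, forall h, hrep F' h}.
Proof.
move=> u e0 e1 hr h hs; apply: hrep_ext (hr h hs).
  move=> f x f4; rewrite inE; case: (f =P 1) => [->|f1 _ _]; last exact: e0.
  by case/orP=> [/eqP ->|xh _]; rewrite ?eqxx //; apply: e1; apply: inner_not_root u hs xh.
by have := uniq_hnodes u hs; rewrite /= => /andP[].
Qed.

Lemma path_switch (f f' : nat -> nat) a b l c : f' a = f b -> {in l, f' =1 f} ->
  fpath f b (rcons l c) -> fpath f' a (rcons l c).
Proof.
move=> e el; case: l el => [|d l] el /=; rewrite e //.
case/andP=> -> /= ; elim: l d el => [|d' l IH] d el /=; rewrite el ?inE ?eqxx //.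
by case/andP=> -> /= p; apply: IH p => x xl; apply: el; rewrite inE xl orbT.
Qed.

(** Exchanging the successors of one point on each of two disjoint cycles splices them; all other
    edges survive, so only the first step of each path has to be examined again. *)
Lemma fcycle_swap (f f' : nat -> nat) a la b lb :
  uniq (a :: la ++ b :: lb) -> f' a = f b -> f' b = f a ->
  (forall x, x != a -> x != b -> f' x = f x) ->
  fcycle f (a :: la) -> fcycle f (b :: lb) -> fcycle f' (a :: lb ++ b :: la).
Proof.
rewrite /= mem_cat inE cat_uniq /= => /and3P[]; rewrite !negb_or.
move=> /and3P[na1 nab na2] ula /and3P[/andP[nb1 _] nb2 ulb] ea eb eo ca cb.
rewrite rcons_cat cat_path /=.
have -> : fpath f' a lb && ((frel f' (last a lb) b) && fpath f' b (rcons la a)) =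
   fpath f' a (rcons lb b) && fpath f' b (rcons la a).
  by rewrite (rcons_path _ a lb) andbA.
apply/andP; split.
  apply: path_switch ea _ cb => x xl; apply: eo; first by apply: contraNneq na2 => <-.
  by apply: contraNneq nb2 => <-.
apply: path_switch eb _ ca => x xl; apply: eo; first by apply: contraNneq na1 => <-.
by apply: contraNneq nb1 => <-.
Qed.

Lemma eqn_lt r k j : r < k -> k <= j -> eqn r j = false.
Proof. by move=> h1 h2; apply/eqnP => e; move: (leq_trans h1 h2); rewrite e ltnn. Qed.

Lemma eqn_neq i j : i <> j -> eqn i j = false.
Proof. by move=> h; apply/eqnP. Qed.

Lemma bounded_size m (s : seq nat) :
  uniq s -> {in s, forall x, 0 < x} -> {in s, forall x, x <= m} -> size s <= m.
Proof.
move=> u p b; rewrite -(size_iota 1 m); apply: uniq_leq_size => // x xs.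
by rewrite mem_iota add1n ltnS p // b.
Qed.

(** * Melding two circles *)

Section Procedures.
Variables (w n : nat) (disp : Order.disp_t) (K : orderType disp).
Hypothesis W : 256 * n.+1 <= 2 ^ w.

Lemma w16 : 16 < 2 ^ w.
Proof. by lia. Qed.

Implicit Types (a : ast K) (Q : nat -> ast K -> Prop).

Lemma meldP a s1 s2 g y Q :
  rg a 20 = g -> rg a 21 = y -> g <= n ->
  lrep (fd a) (ky a) s1 (fd a 9 g) -> lrep (fd a) (ky a) s2 y ->
  uniq (fnodes (s1 ++ s2)) -> {in fnodes (s1 ++ s2), forall x, x <= n} ->
  (forall t a' s, t <= 60 -> ky a' = ky a -> (forall r, r < 22 -> rg a' r = rg a r) ->
     (forall f i, f <> 1 -> f <> 9 -> fd a' f i = fd a f i) ->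
     (forall i, i \notin [seq h.1 | h <- s1 ++ s2] -> fd a' 1 i = fd a 1 i) ->
     (forall i, i <> g -> fd a' 9 i = fd a 9 i) ->
     perm_eq s (s1 ++ s2) -> lrep (fd a') (ky a) s (fd a' 9 g) -> Q t a') ->
  tri w cmeld a Q.
Proof.
move=> r20 r21 gn l1 l2 u nb HQ; subst g y; rewrite /cmeld.
have n1 : fd a 9 (rg a 20) <= n.
  case: (s1) l1 nb => [|h s] [-> _ _ _ _] nb //=.
  by apply: nb; rewrite fnodes_cons inE eqxx.
have n2 : rg a 21 <= n.
  case: (s2) l2 nb => [|h s] [-> _ _ _ _] nb //=.
  by apply: nb; rewrite fnodes_cat fnodes_cons mem_cat inE eqxx orbT.
have ur := uniq_roots u.
stp w16; last first.
  move=> y0; stp w16; apply: (HQ _ _ s1) => //.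
  by have := lrep0 l2; rewrite y0 eqxx => /esym/nilP ->; rewrite cats0.
move=> y0; case E2: s2 (lrep0 l2) => [|h2 t2]; rewrite ?(negbTE y0) // => _.
stp w16; stp w16; stp w16; last first.
  move=> m0; stp w16; have := lrep0 l1; rewrite m0 eqxx => /esym/nilP E1.
  apply: (HQ _ _ s2) => //=.
  - by move=> r hr; rewrite (eqn_lt hr) //.
  - by move=> f i _ f9; rewrite eqn_neq.
  - by move=> i ig; case: eqP.
  - by rewrite E1.
  - rewrite eqxx; apply: lrep_ext l2 => //; last by move: u; rewrite E1.
    by move=> f x f4 _ /=; rewrite eqn_neq //; lia.
move=> m0; case E1: s1 (lrep0 l1) => [|h1 t1]; rewrite ?(negbTE m0) // => _.
have em : fd a 9 (rg a 20) = h1.1 by case: l1 => ->; rewrite E1.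
have ey : rg a 21 = h2.1 by case: l2 => ->; rewrite E2.
set F' := fun f i => if eqn f 1 && (i == h2.1) then fd a 1 h1.1
   else if eqn f 1 && (i == h1.1) then fd a 1 h2.1 else fd a f i.
have nh : h1.1 != h2.1.
  by move: ur; rewrite E1 E2 /= map_cat /= mem_cat inE !negb_or => /andP[/and3P[]].
(* The list of a level has to begin at its minimum, so the spliced circle is read from either of the
   two entries, according to the comparison of their keys. *)
have sw : forall b : bool, let s := if b then h1 :: t2 ++ h2 :: t1 else h2 :: t1 ++ h1 :: t2 in
    perm_eq s (s1 ++ s2) /\ circ F' s.
  case=> /=; rewrite E1 E2; split.
  - by apply/permP => p; rewrite /= !count_cat /=; lia.
  - rewrite /circ /= map_cat /=; apply: (@fcycle_swap (fd a 1)).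
    + by move: ur; rewrite E1 E2 map_cat.
    + by rewrite /F' /= (negbTE nh) eqxx.
    + by rewrite /F' /= eqxx.
    + by move=> x x1 x2; rewrite /F' /= (negbTE x1) (negbTE x2).
    + by case: l1 => _; rewrite /circ E1.
    + by case: l2 => _; rewrite /circ E2.
  - by apply/permP => p; rewrite /= !count_cat /=; lia.
  - rewrite /circ /= map_cat /=; apply: (@fcycle_swap (fd a 1)).
    + by rewrite -cat_cons uniq_catC /=; move: ur; rewrite E1 E2 map_cat.
    + by rewrite /F' /= eqxx.
    + by rewrite /F' /= (negbTE nh) eqxx.
    + by move=> x x1 x2; rewrite /F' /= (negbTE x1) (negbTE x2).
    + by case: l2 => _; rewrite /circ E2.
    + by case: l1 => _; rewrite /circ E1.
have hr : {in s1 ++ s2, forall h, hrep F' h}.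
  apply: (@hreps_ext (fd a)) => // [f i f4 f1|i|h].
  - by rewrite /F' eqn_neq.
  - rewrite E1 E2 map_cat mem_cat /= !inE !negb_or => /andP[/andP[i1 _] /andP[i2 _]].
    by rewrite /F' /= (negbTE i1) (negbTE i2).
  - by rewrite mem_cat => /orP[]; [case: l1 => _ _ h1' _ _|case: l2 => _ _ h1' _ _]; apply: h1'.
have ho : {in s1 ++ s2, forall h, hhord (ky a) h}.
  by move=> h; rewrite mem_cat => /orP[]; [case: l1 => _ _ _ h1' _|case: l2 => _ _ _ h1' _]; apply: h1'.
have mi (b : bool) : (if b then ky a h1.1 <= ky a h2.1 else ky a h2.1 <= ky a h1.1)%O ->
    {in [seq h.1 | h <- s1 ++ s2], forall y, (ky a (if b then h1.1 else h2.1) <= ky a y)%O}.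
  move=> hb y; rewrite map_cat mem_cat => /orP[] ys.
    have : (ky a h1.1 <= ky a y)%O by rewrite -em; case: l1 => _ _ _ _; apply.
    by case: b hb => // hb; apply: le_trans.
  have : (ky a h2.1 <= ky a y)%O by rewrite -ey; case: l2 => _ _ _ _; apply.
  by case: b hb => // hb; apply: le_trans.
have lr (b : bool) F'' : (forall f i, f < 4 -> F'' f i = F' f i) ->
   F'' 9 (rg a 20) = (if b then h1.1 else h2.1) ->
   (if b then ky a h1.1 <= ky a h2.1 else ky a h2.1 <= ky a h1.1)%O ->
   let s := if b then h1 :: t2 ++ h2 :: t1 else h2 :: t1 ++ h1 :: t2 in
   lrep F'' (ky a) s (F'' 9 (rg a 20)).
  move=> eF e9 /mi {}mi s; have [ps cs] := sw b.
  have pr : {in s, forall h, h \in s1 ++ s2} by move=> h; rewrite (perm_mem ps).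
  split.
  - by rewrite e9 /s; case: (b).
  - by apply: circ_ext cs => x _; apply: eF.
  - move=> h /pr hs; have := hr h hs; apply: hrep_ext.
      by move=> f x f4 _ _; apply: eF.
    by have := uniq_hnodes u hs; rewrite /= => /andP[].
  - by move=> h /pr; apply: ho.
  - move=> y; rewrite e9 => ys; apply: mi; move: ys.
    by rewrite (perm_mem (perm_map _ ps)).
stp w16; stp w16; stp w16; stp w16; stp w16; stp w16; stp w16; rewrite ?nat_of_bool_neq0.
- rewrite em ey => le; stp w16.
  have [ps _] := sw true; apply: (HQ _ _ _ _ _ _ _ _ _ ps) => //=.
  - by move=> r hr'; rewrite !(eqn_lt hr').
  - by move=> f i f1 _; rewrite !eqn_neq.
  - move=> i; rewrite E1 E2 map_cat mem_cat /= !inE !negb_or => /andP[/andP[i1 _] /andP[i2 _]].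
    by rewrite (negbTE i1) (negbTE i2).
  - by match goal with |- lrep ?G _ _ _ => exact: (lr true G (fun _ _ _ => erefl) em le) end.
- move/nat_of_bool_eq0; rewrite em ey => le; stp w16.
  have [ps _] := sw false; apply: (HQ _ _ _ _ _ _ _ _ _ ps) => //=.
  - by move=> r hr'; rewrite !(eqn_lt hr').
  - by move=> f i f1 f9; rewrite !eqn_neq.
  - move=> i; rewrite E1 E2 map_cat mem_cat /= !inE !negb_or => /andP[/andP[i1 _] /andP[i2 _]].
    by rewrite (negbTE i1) (negbTE i2).
  - by move=> i ig; case: eqP.
  - match goal with |- lrep ?G _ _ _ => apply: (lr false G) end.
    + by move=> f i f4; rewrite /F' (@eqn_neq f 9) //; lia.
    + by rewrite /= eqxx ey.
    + by move/negbT: le; rewrite -ltNge => /ltW.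
Qed.

End Procedures.

(** * Restoring ranks after a cut *)

Section Procedures.
Variables (w n : nat) (disp : Order.disp_t) (K : orderType disp).
Hypothesis W : 256 * n.+1 <= 2 ^ w.
Let w16 := w16 W.
Implicit Types (a : ast K) (Q : nat -> ast K -> Prop).

Lemma ruleP a Q :
  rg a 9 <= n -> rg a 10 <= n ->
  (forall t, t <= 50 -> Q t (setr a 11 (rule (rg a 9) (rg a 10)))) -> tri w crule a Q.
Proof.
move=> b1 b2 HQ; rewrite /crule /rule.
have HQ' t v : t <= 50 -> v = rule (rg a 9) (rg a 10) -> Q t (setr a 11 v).
  by move=> ht ->; apply: HQ.
stp w16; rewrite ?nat_of_bool_neq0.
  by move=> h; stp w16; apply: HQ' => //; rewrite /rule; case: ifP => //; alia.
move/nat_of_bool_eq0 => h1; stp w16; rewrite ?nat_of_bool_neq0.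
  by move=> h; stp w16; apply: HQ' => //; rewrite /rule; do ?case: ifP; alia.
move/nat_of_bool_eq0 => h2; stp w16; rewrite ?nat_of_bool_neq0.
  by move=> h; stp w16; apply: HQ' => //; rewrite /rule; do ?case: ifP; alia.
by move/nat_of_bool_eq0 => h3; stp w16; apply: HQ' => //; rewrite /rule; do ?case: ifP; alia.
Qed.

(* The loop restores the stored ranks after the subtree [t] of the hole has been
   replaced with [t']. *)
Lemma rankP root p0 c t t' a Q q :
  rg a 8 = fd a 2 (rg a 7) -> fd a 3 0 = 0 -> 0 < root -> fd a 2 root = 0 -> root <= n ->
  crep (fd a) root p0 c t (rg a 7) q -> rep (fd a) (rg a 7) t' q -> rk t' <= rk t ->
  uniq (root :: nodes t' ++ cnodes c) -> {in nodes t' ++ cnodes c, forall x, x <= n} ->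
  (forall tm a', tm <= 200 * (steps c t t').+2 -> ky a' = ky a ->
     (forall r, r < 7 -> rg a' r = rg a r) ->
     (forall f i, f <> 3 \/ i \notin cnodes c -> fd a' f i = fd a f i) ->
     rep (fd a') root (plug c t') p0 -> Q tm a') ->
  tri w crank a Q.
Proof.
move=> r8 z0 rt0 rt2 rtn.
elim: c t t' a Q q r8 z0 rt2 => [|f c IH] t t' a Q q r8 z0 rt2 hc ht le un nb HQ.
  case: hc => eu eq; rewrite /crank; stp w16; first by rewrite r8 eu rt2.
  by move=> _; apply: HQ => //; rewrite -eq -eu.
case: (hc) => x0 eu h3 eq [hs hc'].
set u := rg a 7 in eu hc hc' ht hs h3 eq r8.
have un0 : fd a 2 u != 0 by have [_ ->] := crep_up rt0 rt2 hc.
(* The hole may be on either side; [tl] and [tr] name the children of [u] after the replacement, so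
   that the rest treats both sides alike. *)
have [tl [tr [ef hl hr pn]]] : exists tl tr, [/\ fill f t' = T u tl tr, rep (fd a) u tl (fd a 0 u),
    rep (fd a) u tr (fd a 1 u) & perm_eq (nodes tl ++ nodes tr) (nodes t' ++ nodes (fsib f))].
  rewrite eq in ht.
  move: eu ht hs; case: (f) => x s /= -> ht hs; first by exists t', s.
  by exists s, t'; split=> //; rewrite perm_catC.
have pc : perm_eq (nodes t' ++ cnodes (f :: c)) (u :: nodes tl ++ nodes tr ++ cnodes c).
  rewrite eu; apply/permP => p; have /permP/(_ p) := pn.
  by rewrite /cnodes /= !count_cat /= !count_cat; lia.
have un1 : uniq [:: root, u & nodes tl ++ nodes tr ++ cnodes c].
  by move: un; rewrite /= (perm_mem pc) (perm_uniq pc).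
have nb1 : {in u :: nodes tl ++ nodes tr ++ cnodes c, forall x, x <= n}.
  by move=> x; rewrite -(perm_mem pc); apply: nb.
have nbu : u <= n by apply: nb1; rewrite inE eqxx.
have ult : uniq (nodes tl ++ nodes tr).
  by move: un1 => /= /and3P[_ _]; rewrite catA cat_uniq => /andP[].
have ptr s p : rep (fd a) u s p -> uniq (nodes s) -> {subset nodes s <= nodes tl ++ nodes tr} ->
    p <= n /\ fd a 3 p <= n.
  move=> hp us sb; have sn : {in nodes s, forall x, x <= n}.
    by move=> x /sb xs; apply: nb1; rewrite inE catA mem_cat xs orbT.
  split; first by case: (p =P 0) => [->//|/eqP p0']; apply: sn; apply: rep_root hp p0'.
  rewrite (rep_rk z0 hp); apply: leq_trans (rk_le_size _) _.
  by apply: bounded_size us _ sn => x; apply: rep_gt0 hp.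
have [nl nkl] : fd a 0 u <= n /\ fd a 3 (fd a 0 u) <= n.
  apply: ptr hl _ _; first by move: ult; rewrite cat_uniq => /and3P[].
  by move=> x xs; rewrite mem_cat xs.
have [nr nkr] : fd a 1 u <= n /\ fd a 3 (fd a 1 u) <= n.
  apply: ptr hr _ _; first by move: ult; rewrite cat_uniq => /and3P[].
  by move=> x xs; rewrite mem_cat xs orbT.
have nut : u \notin nodes tl ++ nodes tr ++ cnodes c by move: un1 => /= /and3P[].
have nur : root != u by move: un1; rewrite /= inE negb_or => /and3P[/andP[]].
have hc2 := crep_up rt0 rt2 hc'; have n2 : fd a 2 u <= n.
  case: hc2 => + _; rewrite inE => /orP[/eqP ->//|h].
  by apply: nb1; rewrite inE !mem_cat h !orbT.
have er : rule (fd a 3 (fd a 0 u)) (fd a 3 (fd a 1 u)) = rk (fill f t').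
  by rewrite ef /= (rep_rk z0 hl) (rep_rk z0 hr).
rewrite /crank; unfold u in *; clear u.
stp w16; last by move=> e; rewrite -r8 e in un0.
move=> _; stp w16; stp w16; stp w16; stp w16; stp w16; apply: ruleP => //= t1 ht1.
stp w16; rewrite er h3 ?nat_of_bool_neq0.
  move=> /eqP e; stp w16; stp w16 => // _; apply: HQ => //=.
  - by rewrite e eqxx; alia.
  - by move=> r hr7; rewrite !(eqn_lt hr7).
  - apply/rep_plug; exists (fd a 2 (rg a 7)), (rg a 7); split; first exact: crep_rk hc'.
    have x0' : 0 < rg a 7 by rewrite eu.
    by rewrite ef; split=> //; rewrite h3 -e ef.
move=> /nat_of_bool_eq0/eqP ne; stp w16; stp w16; stp w16; stp w16; stp w16.
have u0 : rg a 7 <> 0 by move=> e0; rewrite -eu e0 in x0.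
apply: (IH (fill f t) (fill f t')) => //=.
- by case: eqP => // e0; case: u0.
- rewrite r8; apply: crep_ext hc' => g x g4 xc; case: eqP => [e|]; rewrite ?andbF //.
  by move: nut; rewrite -e !mem_cat xc !orbT.
- have x0' : 0 < rg a 7 by rewrite eu.
  rewrite r8 ef; split=> //=; first by rewrite eqxx.
  split; [apply: rep_ext hl|apply: rep_ext hr] => g x g4 xc; rewrite /=; case: (x =P rg a 7) => [e|]; rewrite ?andbF //.
    by move: nut; rewrite -e !mem_cat xc.
  by move: nut; rewrite -e !mem_cat xc orbT.
- exact: rk_fill_mono.
- by rewrite ef /= -catA.
- by move=> x; rewrite ef /= -catA; apply: nb1.
- move=> tm a' htm hk hreg hf hrp; apply: HQ => //.
  + by move: htm; rewrite /= (negbTE (introN eqP ne)); alia.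
  + by move=> r hr7; rewrite (hreg r hr7) /= !(eqn_lt hr7).
  + move=> g i hg; rewrite hf /=; last by case: hg => [|h]; [left|right; apply: contra h; rewrite /cnodes /= inE mem_cat => ->; rewrite !orbT].
    case: (g =P 3) hg => [-> [//|]|g3 _]; last by rewrite eqn_neq.
    by rewrite /cnodes /= inE negb_or -eu => /andP[/negbTE ->].
Qed.

End Procedures.

(** * Cutting a subtree *)

Section Procedures.
Variables (w n : nat) (disp : Order.disp_t) (K : orderType disp).
Hypothesis W : 256 * n.+1 <= 2 ^ w.
Let w16 := w16 W.
Implicit Types (a : ast K) (Q : nat -> ast K -> Prop).

(** Hanging a subtree below another node touches only the parent field of its root; for the empty
    tree [p] is null and there is no such field. *)
Lemma rep_reroot F F' u u' t p : uniq (nodes t) ->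
  (forall f i, f < 4 -> i \in nodes t -> f <> 2 \/ i <> p -> F' f i = F f i) ->
  (p != 0 -> F' 2 p = u') -> rep F u t p -> rep F' u' t p.
Proof.
case: t => //= x l r /andP[nx ulr] e e2 [px x0 h2 h3 [hl hr]]; subst p.
have ef f : f < 4 -> f <> 2 -> F' f x = F f x.
  by move=> f4 f2; apply: e; rewrite ?inE ?eqxx //; left.
rewrite -h3 (ef 3) // (ef 0) // (ef 1) // e2; last by rewrite -lt0n.
have nxy y : y \in nodes l ++ nodes r -> y <> x by move=> yy E; rewrite -E yy in nx.
split=> //; split; [apply: rep_ext hl|apply: rep_ext hr] => f i f4 il; apply: e => //.
- by rewrite inE mem_cat il orbT.
- by right; apply: nxy; rewrite mem_cat il.
- by rewrite inE mem_cat il !orbT.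
- by right; apply: nxy; rewrite mem_cat il orbT.
Qed.

Lemma cat_neq (s1 s2 : seq nat) x y : uniq (s1 ++ s2) -> x \in s1 -> y \in s2 -> x != y.
Proof.
rewrite cat_uniq => /and3P[_ /hasPn h _] x1 y2.
by apply: contraTneq x1 => ->; apply: h.
Qed.

Lemma crep_gt0 F root p0 c t u q i : crep F root p0 c t u q -> i \in cnodes c -> 0 < i.
Proof.
elim: c t u q => //= f c IH t u q [x0 eu _ _ [hs hc]].
rewrite /cnodes /= inE mem_cat => /or3P[/eqP ->//||]; last exact: IH hc.
exact: rep_gt0 hs.
Qed.

(** The right subtree of [x] takes the place of [x], which leaves with its left subtree as a half
    tree of its own. The exception for field 2 of record 0 comes from an empty right subtree: the
    program then writes a parent into the null record. *)
Lemma cutP x ro l0 a Q :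
  rg a 5 = x -> rg a 7 = fd a 2 x -> fd a 3 0 = 0 ->
  hrep (fd a) (ro, l0) -> x \in nodes l0 ->
  uniq (hnodes (ro, l0)) -> {in hnodes (ro, l0), forall y, y <= n} ->
  (forall tm a' c l r, l0 = plug c (T x l r) ->
     tm <= 200 * steps c (T x l r) r + 600 -> ky a' = ky a ->
     (forall i, i < 7 -> rg a' i = rg a i) ->
     (forall f i, 3 < f -> fd a' f i = fd a f i) ->
     (forall f i, i \notin nodes l0 -> f <> 0 \/ i <> ro -> f <> 2 \/ i <> 0 ->
        fd a' f i = fd a f i) ->
     hrep (fd a') (ro, plug c r) -> hrep (fd a') (x, l) -> fd a' 1 x = x -> Q tm a') ->
  tri w ccut a Q.
Proof.
move=> r5 r7 z0 [/= ro0 ro2 hr] xl0 un nb HQ.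
have [c [l [r e0]]] := zipper xl0; move: HQ => /(_ _ _ c l r e0) HQ.
move: hr; rewrite e0 => /rep_plug[u [q [hc [eq x0 h2 h3 [hl hrr]]]]].
have pe : perm_eq (nodes l0) (x :: nodes l ++ nodes r ++ cnodes c).
  by rewrite e0; apply: perm_trans (nodes_plug _ _) _; rewrite /= -catA.
have un1 : uniq [:: ro, x & nodes l ++ nodes r ++ cnodes c].
  by move: un; rewrite /= (perm_mem pe) (perm_uniq pe).
have nb1 : {in [:: ro, x & nodes l ++ nodes r ++ cnodes c], forall y, y <= n}.
  by move=> y; rewrite inE -(perm_mem pe) => h; apply: nb; rewrite inE.
have [uro _] := crep_up ro0 ro2 hc.
have nx : x <= n by apply: nb1; rewrite !inE eqxx orbT.
have nu : u <= n by apply: nb1; move: uro; rewrite !inE !mem_cat => /orP[->//|->]; rewrite !orbT.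
set y := fd a 1 x in hrr.
have yr : y != 0 -> y \in nodes r by apply: rep_root hrr.
have ny : y <= n.
  by case: (y =P 0) => [->//|/eqP/yr h]; apply: nb1; rewrite !inE !mem_cat h !orbT.
have un2 : uniq ((ro :: cnodes c) ++ (x :: nodes l ++ nodes r)).
  rewrite -(perm_uniq (s1 := [:: ro, x & nodes l ++ nodes r ++ cnodes c])) //.
  by perml.
have un3 : uniq (x :: nodes l ++ nodes r) by move: un2; rewrite cat_uniq => /and3P[].
have xin : x \in x :: nodes l ++ nodes r by rewrite inE eqxx.
have nxu : (u == x) = false by apply/negbTE/(cat_neq un2).
have yin : y != 0 -> y \in nodes l ++ nodes r by move/yr; rewrite mem_cat orbC => ->.
have u0 : u != 0.
  by rewrite -lt0n; case: (c) hc => [[->]|f c' [h -> _ _ _]].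
have nyu : (u == y) = false.
  apply/negbTE; have [->//|/yin h] := eqVneq y 0; apply: (cat_neq un2) => //.
  by rewrite inE h orbT.
have nyx : (x == y) = false.
  apply/negbTE; have [->|/yin h] := eqVneq y 0; first by rewrite -lt0n.
  by apply: contraTneq h => <-; case/andP: un3.
(* The side on which [x] hangs. With an empty context its parent is the root of the half tree, whose
   only subtree is the left one. *)
pose sd := if c is FR _ _ :: _ then 1 else 0.
have hsd : fd a sd u = x.
  by rewrite /sd -eq; case: (c) hc => [[-> ->]//|[] z s c' [_ _ _ -> _]].
(* If [x] hangs on the right, the left pointer of its parent leads into the context or is null;
   comparing that pointer with [x] therefore detects the side. *)
have sib : forall z s c', c = FR z s :: c' ->
    (fd a 0 u \in cnodes c) || (fd a 0 u == 0).
  move=> z s c' ec; move: hc; rewrite ec => -[_ _ _ _ [/= hs _]].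
  case: eqP => [_|/eqP /(rep_root hs) h]; first by rewrite orbT.
  by rewrite /cnodes /= inE mem_cat h orbT.
have nl : fd a 0 u <= n.
  move: hsd sib; rewrite /sd; case ec: (c) => [|[z s|z s] c']; try by move=> ->.
  move=> _ /(_ _ _ _ erefl); rewrite -ec => /orP[h|/eqP ->//].
  by apply: nb1; rewrite !inE !mem_cat h !orbT.
have test : (fd a 0 u == x) = (sd == 0).
  move: hsd sib; rewrite /sd; case ec: (c) => [|[z s|z s] c']; try by move=> ->; rewrite eqxx.
  move=> _ /(_ _ _ _ erefl); rewrite -ec => /orP[h|/eqP ->]; last by rewrite eq_sym; apply: negbTE; rewrite -lt0n.
  by apply/negbTE/(cat_neq un2) => //; rewrite inE h orbT.
have sd1 : sd = 0 \/ sd = 1 by rewrite /sd; case: (c) => [|[z s|z s] c']; auto.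
have r7' : rg a 7 = u by rewrite r7 h2.
rewrite /ccut; stp w16; stp w16.
rewrite r5 -/y; stp w16.
have step : tri w (HIf (HF 0 (HV 7) ==! HV 5) (HPut 0 (HV 7) (HV 8)) (HPut 1 (HV 7) (HV 8)))
    (setr a 8 y) (fun t a' => t <= 60 /\ a' = setf (setr a 8 y) sd u y).
  have r7n : rg a 7 <= n by rewrite r7'.
  have r7l : fd a 0 (rg a 7) <= n by rewrite r7'.
  stp w16; rewrite r7' r5 test ?nat_of_bool_neq0.
    move=> /eqP e; stp w16; rewrite r7' e; split=> //; alia.
  move=> /nat_of_bool_eq0/eqP e; stp w16; rewrite r7'; split; first by alia.
  by case: sd1 => -> // in e *.
apply: tri_conseq step => t1 _ [ht1 ->].
have r7n : rg a 7 <= n by rewrite r7'.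
have r5n : rg a 5 <= n by rewrite r5.
stp w16; stp w16; stp w16; stp w16; stp w16; stp w16; stp w16; stp w16.
rewrite !r5 !r7' nxu nyu; set v := (v in setr _ 8 v); set a1 := (setr _ 8 v).
have vE : v = fd a 2 u by rewrite /v; case: sd1 => ->.
have F2 f i : i <> x -> (f <> 2 \/ i <> y) -> (f <> sd \/ i <> u) -> fd a1 f i = fd a f i.
  move=> /eqP/negbTE ix h1 h2'; rewrite /= ix !andbF.
  case: (f =P 2) h1 h2' => [->|f2] h1 h2'; last rewrite (eqn_neq f2) /=.
    case: (i =P y) h1 => [->|_ _] /=; first by case.
    by case: sd1 => -> /=.
  case: (f =P sd) h2' => [->|fs]; last by rewrite eqn_neq.
  by case: (i =P u) => [->|]; rewrite ?andbF // => -[].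
have yu0 : y <> 0 -> fd a1 2 y = u by move=> _; rewrite /= eq_sym nyx eqxx.
have hroot : u = ro -> c = [::].
  case: (c) hc un1 => // f c' [_ -> _ _ _]; rewrite /cnodes /= => /andP[+ _] e.
  by rewrite -e inE !mem_cat inE eqxx !orbT.
have roin : ro \in ro :: cnodes c by rewrite inE eqxx.
have rox : ro <> x by apply/eqP/(cat_neq un2).
have roy : ro <> y.
  have [e|/yin h] := eqVneq y 0; first by rewrite e => e'; rewrite e' in ro0.
  by apply/eqP; apply: (cat_neq un2) => //; rewrite inE h orbT.
have ufc : u \in cnodes c \/ u = ro by move: uro; rewrite inE => /orP[/eqP|]; auto.
have F1l i f : i \in nodes l -> fd a1 f i = fd a f i.
  move=> il; have ix : i <> x.
    by move=> e; move: un3; rewrite -e /= mem_cat il.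
  apply: F2 => //; right; last first.
    by apply/eqP; rewrite eq_sym; apply: (cat_neq un2) => //; rewrite inE mem_cat il orbT.
  move=> e; have y0 : y != 0 by rewrite -e -lt0n; apply: rep_gt0 hl il.
  by move: un3; rewrite /= => /andP[_ /cat_neq/(_ il (yr y0))]; rewrite e eqxx.
have F1c i f : i \in cnodes c -> f <> sd \/ i <> u -> fd a1 f i = fd a f i.
  move=> ic h; have ic' : i \in ro :: cnodes c by rewrite inE ic orbT.
  have i0 : i != 0.
    by have := crep_gt0 hc ic; rewrite lt0n.
  apply: F2 => //; first by apply/eqP/(cat_neq un2).
  right; have [e|/yin h'] := eqVneq y 0; first by rewrite e; apply/eqP.
  by apply/eqP; apply: (cat_neq un2) => //; rewrite inE h' orbT.
apply: (@rankP w n disp K W ro (fd a1 0 ro) c (T x l r) r a1 _ y) => //.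
- by rewrite [LHS]/= vE [rg _ _]/= r7' F2 //; [apply/eqP; rewrite nxu| right; apply/eqP; rewrite nyu|left; case: sd1 => ->].
- by rewrite F2 //; [move=> e; rewrite -e in x0|left|left; case: sd1 => ->].
- by rewrite F2 //; [right|left; case: sd1 => ->].
- by apply: nb; rewrite inE eqxx.
- have uo : u <> x /\ u <> y by split; apply/eqP; rewrite ?nxu ?nyu.
  have sdu : fd a1 sd u = y by case: sd1 => e; rewrite /a1 e /= ?nxu ?eqxx.
  rewrite [rg _ _]/= r7'; case ec: (c) hc hsd => [|fr c'].
    case=> e _ _; split=> //; rewrite -{1}sdu -e; congr (fd a1 _ _).
    by rewrite /sd ec.
  case=> x0' eu h3' eq' [hs hc'] _.
  have esd : side fr = sd by rewrite /sd ec; case: (fr).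
  have ucc : uniq (fnode fr :: nodes (fsib fr) ++ cnodes c').
    by move: un2; rewrite cat_uniq => /and3P[/andP[_ +] _ _]; rewrite ec.
  have uno i : i \in nodes (fsib fr) ++ cnodes c' -> i \in cnodes c /\ i <> u.
    move=> ii; split; first by rewrite ec /cnodes /= inE ii orbT.
    by move=> e; move: ucc; rewrite /= -eu -e ii.
  have uro' : ro <> u by move=> e; have := hroot (esym e); rewrite ec.
  split=> //.
  - by rewrite F2 //; [case: uo|left|left; case: sd1 => ->].
  - by rewrite esd sdu.
  split.
    rewrite esd F2; [|by case: uo|by left; case: sd1 => ->|by left; case: sd1 => ->].
    rewrite -esd; apply: rep_ext hs => g i g4 ii.
    have [i1 i2] : i \in cnodes c /\ i <> u by apply: uno; rewrite mem_cat ii.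
    by apply: F1c => //; right.
  rewrite (F2 2); [|by case: uo|by right; case: uo|by left; case: sd1 => ->].
  rewrite (F2 0 ro) //; [|by left|by right].
  apply: crep_ext hc' => g i g4 ii.
  have [i1 i2] : i \in cnodes c /\ i <> u by apply: uno; rewrite mem_cat ii orbT.
  by apply: F1c => //; right.
- rewrite [rg _ _]/= r7'; apply: rep_reroot hrr.
  + by move: un3; rewrite /= cat_uniq => /andP[_ /and3P[]].
  + move=> g i g4 ir h; have ixr : i \in x :: nodes l ++ nodes r by rewrite inE mem_cat ir !orbT.
    apply: F2 => //; last by right; apply/eqP; rewrite eq_sym; apply: (cat_neq un2).
    by move=> e; move: un3; rewrite -e /= mem_cat ir orbT.
  + by move/eqP/yu0.
- by have [_] := rule_ge (rk l) (rk r).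
- suff : uniq ((x :: nodes l) ++ (ro :: nodes r ++ cnodes c)) by rewrite cat_uniq => /and3P[].
  rewrite -(perm_uniq (s1 := [:: ro, x & nodes l ++ nodes r ++ cnodes c])) //.
  by perml.
- by move=> z; rewrite mem_cat => h; apply: nb1; rewrite !inE !mem_cat; case/orP: h => ->; rewrite !orbT.
have sd2 : sd < 2 by case: sd1 => ->.
have nlc i : i \in nodes l -> i \notin cnodes c.
  move=> il; apply/negP => ic; have := @cat_neq _ _ i i un2.
  by rewrite !inE mem_cat il ic !orbT eqxx => /(_ isT isT).
move=> tm a' htm hk hreg hf hrp; apply: HQ => //.
- clear - htm ht1; lia.
- by move=> i i7; rewrite (hreg i i7) /= !(eqn_lt i7).
- move=> g i g3; rewrite hf; last by left=> e; rewrite e in g3.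
  by rewrite /= !eqn_neq // => e; move: g3; rewrite e //; case: sd1 => ->.
- move=> g i il h1 h2'; have : i \notin x :: nodes l ++ nodes r ++ cnodes c by rewrite -(perm_mem pe).
  rewrite inE !mem_cat !negb_or => /and4P[ix i_l i_r ic].
  rewrite hf; last by right.
  apply: F2; first exact/eqP.
    case: h2' => h2'; first by left.
    right=> e; have /yr : y != 0 by rewrite -e; apply/eqP.
    by rewrite -e (negbTE i_r).
  case: ufc => [uc|e]; first by right=> e; rewrite e uc in ic.
  have sd0 : sd = 0 by rewrite /sd (hroot e).
  by rewrite sd0 e.
- split=> //=; last by rewrite (hf 0) //; left.
  by rewrite (hf 2) ?F2 //; [right|left; case: sd1 => ->|left].
- split=> //=; first by rewrite (hf 2) //=; [rewrite eqxx|left].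
  have -> : fd a' 0 x = fd a 0 x.
    rewrite (hf 0) //; last by left.
    by rewrite /= [x == u]eq_sym nxu !andbF.
  apply: rep_ext hl => g i g4 il; rewrite hf; first exact: F1l.
  by right; apply: nlc.
by rewrite hf /= ?eqxx //; left.
Qed.

End Procedures.

(** * Links of half trees of equal rank *)

Definition clink2 : hcmd :=
  HPut 1 (HV 10) (HF 0 (HV 7)) ;;
  HPut 2 (HF 0 (HV 7)) (HV 10) ;;
  HPut 0 (HV 7) (HV 10) ;;
  HPut 2 (HV 10) (HV 7) ;;
  HPut 3 (HV 10) (HV 9) ;;
  HSet 9 (HV 9 +! HC 1).

Definition cswap : hcmd :=
  HIf (HK (HV 7) (HV 10)) HSkip (HSet 11 (HV 7) ;; HSet 7 (HV 10) ;; HSet 10 (HV 11)).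

(** Slot [r] of field 11 holds a pending half tree of rank [r]. An occupied slot is emptied and its
    tree linked, which raises the rank by one, like a carry in a binary addition. *)
Definition clinks : hcmd :=
  HWhile (HF 11 (HV 9))
    (HSet 10 (HF 11 (HV 9)) ;; HPut 11 (HV 9) (HC 0) ;; cswap ;; clink2).

(** Register 5 holds the extracted root: meeting it again closes the circle, and the traversal jumps
    to its left child, whose spine is linked by the same field 1. The successor is saved in register
    8 because linking overwrites that field. Register 6 is the highest rank used. *)
Definition cstep : hcmd :=
  HSet 8 (HF 1 (HV 7)) ;;
  HIf (HV 8 ==! HV 5) (HSet 8 (HF 0 (HV 5))) HSkip ;;
  HPut 2 (HV 7) (HC 0) ;;
  HSet 9 (HF 3 (HF 0 (HV 7)) +! HC 1) ;;
  clinks ;;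
  HPut 11 (HV 9) (HV 7) ;;
  HIf (HV 6 <! HV 9) (HSet 6 (HV 9)) HSkip ;;
  HSet 7 (HV 8).

(* Links, rank by rank, the half trees found from register 7 on. *)
Definition cconsol : hcmd := HWhile (HV 7) cstep.

(** Each slot becomes a circle with one root before it is melded. For an empty slot register 21 is
    null: the write goes to record 0 and [cmeld] does nothing. *)
Definition ccollect : hcmd :=
  HWhile (HV 9 <! HV 6)
    (HSet 9 (HV 9 +! HC 1) ;;
     HSet 21 (HF 11 (HV 9)) ;;
     HPut 11 (HV 9) (HC 0) ;;
     HPut 1 (HV 21) (HV 21) ;;
     cmeld).

Section Procedures.
Variables (w n : nat) (disp : Order.disp_t) (K : orderType disp).
Hypothesis W : 256 * n.+1 <= 2 ^ w.
Let w16 := w16 W.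
Implicit Types (a : ast K) (Q : nat -> ast K -> Prop).

Lemma linkP hy hz a Q :
  rg a 7 = hy.1 -> rg a 10 = hz.1 -> rg a 9 = hrk hy -> hrk hz = hrk hy ->
  hrep (fd a) hy -> hrep (fd a) hz -> uniq (hnodes hy ++ hnodes hz) ->
  {in hnodes hy ++ hnodes hz, forall x, x <= n} -> rg a 9 <= n ->
  (forall t a', t <= 100 -> ky a' = ky a -> rg a' 9 = (rg a 9).+1 ->
     (forall r, r <> 9 -> rg a' r = rg a r) ->
     (forall f i, 3 < f -> fd a' f i = fd a f i) ->
     (forall f i, i \notin hnodes hy ++ hnodes hz -> f <> 2 \/ i <> 0 -> fd a' f i = fd a f i) ->
     fd a' 3 0 = fd a 3 0 ->
     hrep (fd a') (hy.1, T hz.1 hz.2 hy.2) -> Q t a') ->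
  tri w clink2 a Q.
Proof.
case: hy hz => [y ly] [z lz] /= r7 r10 r9 erk [/= y0 y2 hy] [/= z0 z2 hz] un nb rn HQ.
have un' : uniq ((y :: nodes ly) ++ (z :: nodes lz)) := un.
set p := fd a 0 y in hy.
have pl : p != 0 -> p \in nodes ly by apply: rep_root hy.
have nyz : (y == z) = false by apply/negbTE/(cat_neq un'); rewrite inE eqxx.
have nzp : (z == p) = false.
  apply/negbTE; have [->|/pl h] := eqVneq p 0; first by rewrite -lt0n.
  by rewrite eq_sym; apply: (cat_neq un'); rewrite inE ?h ?orbT ?eqxx.
have nyp : (y == p) = false.
  apply/negbTE; have [->|/pl h] := eqVneq p 0; first by rewrite -lt0n.
  by move: un => /= /andP[+ _]; rewrite mem_cat negb_or => /andP[+ _]; apply: contraNneq => ->.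
have ny : y <= n by apply: nb; rewrite inE eqxx.
have nz : z <= n by apply: nb; rewrite inE mem_cat inE eqxx !orbT.
have np : p <= n by have [->//|/pl h] := eqVneq p 0; apply: nb; rewrite inE mem_cat h orbT.
have r7n : rg a 7 <= n by rewrite r7.
have r10n : rg a 10 <= n by rewrite r10.
have r7p : fd a 0 (rg a 7) <= n by rewrite r7.
rewrite /clink2; do 11 stp w16; set a1 := setr _ 9 _.
have F1 f i : f <> 1 \/ i <> z -> f <> 2 \/ i <> p -> f <> 0 \/ i <> y -> f <> 2 \/ i <> z ->
    f <> 3 \/ i <> z -> fd a1 f i = fd a f i.
  rewrite /= r7 r10 -/p => h1 h2 h3 h4 h5.
  have X g j : f <> g \/ i <> j -> eqn f g && (i == j) = false.
    by case=> [/eqn_neq -> //|/eqP/negbTE ->]; rewrite andbF.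
  by rewrite !X.
have inl i : i \in nodes ly -> i <> y /\ i <> z.
  move=> il; split; first by move=> e; move: un; rewrite -e mem_cat il.
  by apply/eqP; apply: (cat_neq un'); rewrite inE ?il ?orbT ?eqxx.
have inz i : i \in nodes lz -> [/\ i <> y, i <> z & i <> p].
  move=> il; have iz : i \in z :: nodes lz by rewrite inE il orbT.
  split.
  - by apply/eqP; rewrite eq_sym; apply: (cat_neq un') => //; rewrite inE eqxx.
  - by move=> e; move: un' ; rewrite cat_uniq => /and3P[_ _ /= /andP[]]; rewrite -e il.
  - move=> e; have p0 : p != 0 by rewrite -e -lt0n; apply: rep_gt0 hz il.
    have : p != i by apply: (cat_neq un') => //; rewrite inE pl // orbT.
    by rewrite e eqxx.
have zp : z <> p by move/eqP; rewrite nzp.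
have yp : y <> p by move/eqP; rewrite nyp.
have zy : z <> y by move/eqP; rewrite eq_sym nyz.
apply: HQ => //.
- by rewrite /= addn1.
- by move=> r /eqn_neq e; rewrite /= e.
- by move=> g i g3; apply: F1; left=> e; rewrite e in g3.
- move=> g i; rewrite inE mem_cat inE !negb_or => /and4P[/eqP iy il /eqP iz _] h.
  apply: F1; try by right.
  case: h => h; [by left|right=> e; rewrite e in il h].
  by move/negP: il; apply; apply: pl; apply/eqP.
- by apply: F1; try (by left); right=> e; [rewrite -e in z0].
- have e2y : fd a1 2 y = 0 by rewrite /= r7 r10 -/p nyz nyp.
  have e0 : fd a1 0 y = z by rewrite /= r7 eqxx.
  have e2z : fd a1 2 z = y by rewrite /= r10 eqxx.
  have e1z : fd a1 1 z = p by rewrite /= r10 eqxx r7.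
  have e3z : fd a1 3 z = rk (T z lz ly).
    by rewrite /= r10 eqxx r9; move: erk; rewrite /hrk /= => -[->]; rewrite rule_same.
  split=> //; rewrite [_.2]/= [_.1]/= e0; split=> //; rewrite e1z; split.
    have -> : fd a1 0 z = fd a 0 z by apply: F1; auto.
    by apply: rep_ext hz => g i g4 /inz[i1 i2 i3]; apply: F1; auto.
  have ul : uniq (nodes ly) by move: un => /andP[_]; rewrite cat_uniq => /andP[].
  apply: (@rep_reroot (fd a) _ y z ly p ul) => //.
    by move=> g i g4 /inl[i1 i2] h; apply: F1; auto.
  by move=> p0; rewrite /= r7 r10 -/p [p == z]eq_sym nzp eqxx.
Qed.

(** The last clause turns a nonzero slot into a partner of that rank, which is what the loop test of
    [clinks] relies on. *)
Definition slots (F : nat -> nat -> nat) (S : seq htree) : Prop :=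
  [/\ {in S, forall h, F 11 (hrk h) = h.1}, uniq [seq hrk h | h <- S]
    & forall r, 0 < r <= n -> F 11 r <> 0 -> r \in [seq hrk h | h <- S]].

Lemma hrk_bound h : uniq (hnodes h) -> {in hnodes h, forall x, 0 < x <= n} -> hrk h <= n.
Proof.
move=> u b; apply: leq_trans (hrk_le_size h) _.
by apply: bounded_size => // x /b/andP[].
Qed.

Lemma hrep_gt0 F h x : hrep F h -> x \in hnodes h -> 0 < x.
Proof. by case=> h0 _ hr; rewrite inE => /orP[/eqP ->//|/(rep_gt0 hr)]. Qed.

Lemma link_hord (k : nat -> K) hy hz : (k hy.1 <= k hz.1)%O -> hhord k hy -> hhord k hz ->
  hhord k (hy.1, T hz.1 hz.2 hy.2).
Proof.
move=> le [a1 b1] [a2 b2]; split=> // x /=; rewrite inE mem_cat.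
case/or3P=> [/eqP ->//|/a2 h|/a1 //]; exact: le_trans le h.
Qed.

Lemma slots_perm F S S' : perm_eq S S' -> slots F S -> slots F S'.
Proof.
move=> p [a b c]; split.
- by move=> h; rewrite -(perm_mem p); apply: a.
- by rewrite -(perm_uniq (perm_map hrk p)).
- by move=> r r0 /(c r r0); rewrite (perm_mem (perm_map hrk p)).
Qed.

(** Two new differences of 1 cost 4 and the root that disappears gives back 5. *)
Lemma pot_link hy hz : hrk hy = hrk hz ->
  pot (hy.1, T hz.1 hz.2 hy.2) + 1 = pot hy + pot hz /\
  hrk (hy.1, T hz.1 hz.2 hy.2) = (hrk hy).+1.
Proof.
rewrite /hrk /pot /= => -[->]; rewrite rule_same; split=> //; clear; lia.
Qed.

(** Each link consumes one half tree of [S] and one unit of [fpot], so time and potential are both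
    stated through the change of [size S]. As [S'] is part of [S], the recorded maximal rank stays
    valid for it. *)
Lemma linksP S h a Q :
  rg a 7 = h.1 -> rg a 9 = hrk h -> slots (fd a) S ->
  {in h :: S, forall h', hrep (fd a) h'} -> {in h :: S, forall h', hhord (ky a) h'} ->
  uniq (fnodes (h :: S)) -> {in fnodes (h :: S), forall x, x <= n} ->
  (forall t a' h' S', perm_eq (fnodes (h' :: S')) (fnodes (h :: S)) -> size S' <= size S -> {subset S' <= S} ->
     fpot (h' :: S') + size S = fpot (h :: S) + size S' ->
     t + 300 * size S' <= 300 * size S + 100 ->
     rg a' 7 = h'.1 -> rg a' 9 = hrk h' -> (forall r, r < 7 \/ r = 8 -> rg a' r = rg a r) ->
     ky a' = ky a -> slots (fd a') S' -> fd a' 11 (hrk h') = 0 ->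
     {in h' :: S', forall h', hrep (fd a') h'} -> {in h' :: S', forall h', hhord (ky a) h'} ->
     (forall f i, 3 < f -> f <> 11 -> fd a' f i = fd a f i) ->
     (forall f i, f <> 11 -> i \notin fnodes (h :: S) -> f <> 2 \/ i <> 0 -> fd a' f i = fd a f i) ->
     fd a' 3 0 = fd a 3 0 -> Q t a') ->
  tri w clinks a Q.
Proof.
have [m] := ubnP (size S); elim: m S h a Q => // m IH S h a Q sm r7 r9 sl hr ho un nb HQ.
have uh : uniq (hnodes h) by apply: uniq_hnodes un _; rewrite inE eqxx.
have kn : hrk h <= n.
  have hh : hrep (fd a) h by apply: hr; rewrite inE eqxx.
  by apply: hrk_bound uh _ => x xh; rewrite (hrep_gt0 hh xh) nb // fnodes_cons mem_cat xh.
have r9n : rg a 9 <= n by rewrite r9.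
rewrite /clinks; stp w16; last first.
  by rewrite r9 => e; apply: (HQ _ _ h S) => //; alia.
rewrite r9 => s0; have kin : hrk h \in [seq hrk h | h <- S].
  by case: sl => _ _; apply; [rewrite kn|apply/eqP].
case/mapP: kin => z zS ez; have [S1 pS] : exists S1 : seq htree, perm_eq S (z :: S1).
  by exists (rem z S); apply: perm_to_rem.
have s10 : fd a 11 (hrk h) = z.1 by rewrite ez; case: sl => ->.
have zn : z.1 <= n.
  by apply: nb; rewrite fnodes_cons mem_cat (hnodes_sub zS) ?orbT // inE eqxx.
stp w16; stp w16; stp w16; stp w16; rewrite r9 s10; stp w16.
set a1 := setf _ 11 _ _.
have sw : tri w cswap a1 (fun t a' => t <= 30 /\ exists hy hz, [/\ perm_eq [:: hy; hz] [:: h; z],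
    (ky a hy.1 <= ky a hz.1)%O, rg a' 7 = hy.1 /\ rg a' 10 = hz.1,
    (forall r, r < 7 \/ r = 8 \/ r = 9 -> rg a' r = rg a1 r) & fd a' = fd a1 /\ ky a' = ky a1]).
  rewrite /cswap; stp w16; rewrite r7.
    by rewrite nat_of_bool_neq0 => le; stp w16; split=> //; exists h, z.
  move/nat_of_bool_eq0/negbT; rewrite -ltNge => lt.
  stp w16; stp w16; stp w16; stp w16; stp w16; split=> //; exists z, h; split=> //.
  - by perml.
  - exact: ltW.
  - by move=> r hr'; rewrite /= !eqn_neq //; clear - hr'; lia.
apply: tri_conseq sw => t1 a2 [ht1 [hy [hz [p2 le [r7' r10'] rg2 [fd2 ky2]]]]].
have pS2 : perm_eq (h :: S) [:: hy, hz & S1].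
  apply: (@perm_trans _ [:: h, z & S1]); first by rewrite perm_cons.
  by rewrite -[[:: h, z & S1]]/([:: h; z] ++ S1) -[[:: hy, hz & S1]]/([:: hy; hz] ++ S1) perm_cat2r perm_sym.
have mem2 h' : h' \in [:: hy, hz & S1] -> h' \in h :: S by rewrite (perm_mem pS2).
have hyz : hrk hy = hrk h /\ hrk hz = hrk h.
  have X : {in [:: h; z], forall h', hrk h' = hrk h}.
    by move=> h'; rewrite !inE => /orP[/eqP ->//|/eqP ->].
  by split; apply: X; rewrite -(perm_mem p2) !inE eqxx ?orbT.
have un2 : uniq (fnodes [:: hy, hz & S1]) by rewrite -(perm_uniq (perm_fnodes pS2)).
have nb2 : {in fnodes [:: hy, hz & S1], forall x, x <= n}.
  by move=> x; rewrite -(perm_mem (perm_fnodes pS2)); apply: nb.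
have un3 : uniq ((hnodes hy ++ hnodes hz) ++ fnodes S1) by move: un2; rewrite !fnodes_cons catA.
have a2f g i : g <> 11 -> fd a2 g i = fd a g i by move=> g11; rewrite fd2 /= eqn_neq.
have ext h' : h' \in [:: hy, hz & S1] -> hrep (fd a2) h'.
  move=> hin; apply: hrep_ext (hr _ (mem2 _ hin)) => [g x g4 _ _|].
    by apply: a2f => e; rewrite e in g4.
  by have := uniq_hnodes un2 hin; rewrite /= => /andP[].
have sl1 : slots (fd a2) S1.
  have [s1 s2 s3] := slots_perm pS sl; rewrite fd2.
  move: s2 => /= /andP[s2 s2']; split=> //.
    move=> h' h1; rewrite /=; case: eqP => [e|_]; last by apply: s1; rewrite inE h1 orbT.
    by move: s2; rewrite -ez -e map_f.
  move=> r rn /=; case: eqP => // ne /(s3 r rn); rewrite inE => /orP[/eqP e|//].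
  by case: ne; rewrite ez.
have [pl rkl] := pot_link (etrans hyz.1 (esym hyz.2)).
have fpS : fpot (h :: S) = pot hy + pot hz + fpot S1.
  by rewrite (perm_fpot pS2) !fpot_cons addnA.
have szS : size S = (size S1).+1 by exact: perm_size pS.
apply: (@linkP hy hz) => //; rewrite ?r7' ?r10' ?rg2 /=; try by auto.
- by rewrite r9; case: hyz.
- by case: hyz => -> ->.
- by apply: ext; rewrite inE eqxx.
- by apply: ext; rewrite !inE eqxx orbT.
- by move: un3; rewrite cat_uniq => /and3P[].
- by move=> x xh; apply: nb2; rewrite !fnodes_cons catA mem_cat xh.
move=> t2 a3 ht2 ky3 r93 rg3 fd3 fd3' z3 hr3.
set h1 := (hy.1, T hz.1 hz.2 hy.2) in pl rkl hr3.
have pn : perm_eq (fnodes (h1 :: S1)) (fnodes (h :: S)).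
  apply: perm_trans (_ : perm_eq _ (fnodes [:: hy, hz & S1])) _; last by rewrite perm_sym perm_fnodes.
  by rewrite !fnodes_cons /hnodes /=; perml.
have rg3' r : r < 7 \/ r = 8 -> rg a3 r = rg a r.
  move=> hr'; rewrite rg3; last by case: hr' => [hr'|->//] e; rewrite e in hr'.
  rewrite rg2; last by case: hr' => [hr'|->]; auto.
  by rewrite /= eqn_neq // => e; case: hr' => [hr'|hr']; rewrite e in hr'.
have k1 : ky a3 = ky a by rewrite ky3 ky2.
apply: (IH S1 h1).
- by move: sm; rewrite szS ltnS.
- by rewrite rg3 // r7'.
- by rewrite r93 rkl r9; case: hyz => ->.
- case: sl1 => s1 s2 s3; split=> //.
    by move=> h' h1'; rewrite fd3 // s1.
  by move=> r rn; rewrite fd3 //; apply: s3.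
- move=> h'; rewrite inE => /orP[/eqP -> //|hin].
  have hin2 : h' \in [:: hy, hz & S1] by rewrite !inE hin !orbT.
  apply: hrep_ext (ext _ hin2) => [g x g4 xh _|]; last first.
    by have := uniq_hnodes un2 hin2; rewrite /= => /andP[].
  have xS : x \in fnodes S1 by apply: hnodes_sub xh.
  apply: fd3'; last by right=> e; have := hrep_gt0 (ext _ hin2) xh; rewrite e.
  by apply/negP => xy; have := cat_neq un3 xy xS; rewrite eqxx.
- move=> h'; rewrite k1 inE => /orP[/eqP -> |hin]; last by apply: ho; apply: mem2; rewrite !inE hin !orbT.
  by apply: link_hord => //; apply: ho; apply: mem2; rewrite !inE eqxx ?orbT.
- by rewrite (perm_uniq pn).
- by move=> x; rewrite (perm_mem pn); apply: nb.
move=> t3 a4 h' S' p4 sz4 sb4 fp4 ht4 r74 r94 rg4 ky4 sl4 s04 hr4 ho4 f4 f4' z4.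
apply: (HQ _ _ h' S').
- exact: perm_trans pn.
- by rewrite szS; apply: leq_trans sz4 _.
- by move=> h2 /sb4 h2S; rewrite (perm_mem pS) inE h2S orbT.
- rewrite fpS szS; move: fp4 pl; rewrite [fpot (h1 :: S1)]fpot_cons.
  by move=> e1 e2; rewrite addnS e1 -e2 addn1 !addSn.
- by move: ht4; rewrite szS; alia.
- by [].
- by [].
- by move=> r hr'; rewrite rg4 // rg3'.
- by rewrite ky4.
- by [].
- by [].
- by [].
- by rewrite -k1.
- by move=> g i g3 g11; rewrite f4 // fd3 // a2f.
- move=> g i g11 iS h0; rewrite f4' //; last by rewrite (perm_mem pn).
  rewrite fd3' // ?a2f //; apply: contra iS => ih.
  by rewrite (perm_mem (perm_fnodes pS2)) !fnodes_cons catA mem_cat ih.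
- by rewrite z4 z3 a2f.
Qed.

End Procedures.

(** * The consolidation loop *)

Section Procedures.
Variables (w n : nat) (disp : Order.disp_t) (K : orderType disp).
Hypothesis W : 256 * n.+1 <= 2 ^ w.
Let w16 := w16 W.
Implicit Types (a : ast K) (Q : nat -> ast K -> Prop).

(** The half trees still to be visited, in the order of the traversal: field 1 is followed, and
    arriving at [x] means continuing at its left child. *)
Fixpoint chain (F : nat -> nat -> nat) (x p : nat) (todo : seq htree) : Prop :=
  if todo is h :: t then p = h.1 /\ chain F x (if F 1 h.1 == x then F 0 x else F 1 h.1) t
  else p = 0.

Lemma chain_ext F F' x p todo : F' 0 x = F 0 x ->
  {in [seq h.1 | h <- todo], F' 1 =1 F 1} -> chain F x p todo -> chain F' x p todo.
Proof.
move=> e0; elim: todo p => //= h t IH p e [-> c].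
by rewrite e ?inE ?eqxx // e0; split=> //; apply: IH c => y yt; apply: e; rewrite inE yt orbT.
Qed.

(** Nothing is said about the parent field of the root: the nodes of the dismantled spine still
    carry their former parents until they are visited. *)
Definition prerep F (h : htree) : Prop := 0 < h.1 /\ rep F h.1 h.2 (F 0 h.1).

Lemma prerep_ext F F' (h : htree) :
  (forall f x, f < 4 -> x \in nodes h.2 -> F' f x = F f x) -> F' 0 h.1 = F 0 h.1 ->
  prerep F h -> prerep F' h.
Proof. by move=> e e0 [h0 hr]; split=> //; rewrite e0; apply: rep_ext hr. Qed.

Lemma prerep_gt0 F h x : prerep F h -> x \in hnodes h -> 0 < x.
Proof. by case=> h0 hr; rewrite inE => /orP[/eqP ->//|/(rep_gt0 hr)]. Qed.

Lemma slots_add F F' S h : slots n F S -> F 11 (hrk h) = 0 -> h.1 <> 0 ->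
  F' 11 (hrk h) = h.1 -> (forall r, r <> hrk h -> F' 11 r = F 11 r) ->
  {in S, forall h', h'.1 <> 0} -> slots n F' (h :: S).
Proof.
move=> [a b c] z0 h0 e1 e2 nz.
have nh : {in S, forall h', hrk h' <> hrk h}.
  by move=> h' hS e; apply: (nz h' hS); rewrite -a // e.
split.
- move=> h'; rewrite inE => /orP[/eqP -> //|hS]; rewrite e2 ?a //; exact: nh.
- rewrite /= b andbT; apply/negP => /mapP[h' hS e]; exact: (nh h' hS).
- move=> r rn; rewrite /= inE; case: (r =P hrk h) => //= ne; rewrite e2 //; exact: c.
Qed.

(** The equation for [fpot] counts the links, one unit each; the time is 800 steps per visited half
    tree, less 300 for each one that remains pending. [B] is any bound on the ranks that the number
    of nodes allows, and will limit the slots to be collected. *)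
Lemma consolP todo S a Q B :
  chain (fd a) (rg a 5) (rg a 7) todo -> slots n (fd a) S -> fd a 3 0 = 0 ->
  {in S, forall h', hrep (fd a) h'} -> {in todo, forall h', prerep (fd a) h'} ->
  {in todo ++ S, forall h', hhord (ky a) h'} ->
  uniq (rg a 5 :: fnodes (todo ++ S)) -> {in rg a 5 :: fnodes (todo ++ S), forall x, x <= n} ->
  fd a 0 (rg a 5) <= n -> rg a 6 <= n ->
  {in S, forall h, hrk h <= rg a 6} -> rg a 6 <= B ->
  (forall k, 2 ^ (k.-1 %/ 3) <= size (fnodes (todo ++ S)) -> k <= B) ->
  (forall t a' S', perm_eq (fnodes S') (fnodes (todo ++ S)) ->
     size S' <= size todo + size S ->
     fpot S' + (size todo + size S) = fpot (todo ++ S) + size S' ->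
     t + 300 * size S' <= 800 * size todo + 300 * size S + 100 ->
     rg a' 6 <= n -> rg a' 6 <= B -> {in S', forall h, hrk h <= rg a' 6} ->
     (forall r, r < 6 -> rg a' r = rg a r) -> ky a' = ky a -> slots n (fd a') S' ->
     {in S', forall h', hrep (fd a') h'} -> {in S', forall h', hhord (ky a) h'} ->
     (forall f i, 3 < f -> f <> 11 -> fd a' f i = fd a f i) ->
     (forall f i, f <> 11 -> i \notin fnodes (todo ++ S) -> f <> 2 \/ i <> 0 -> fd a' f i = fd a f i) ->
     fd a' 3 0 = 0 -> Q t a') ->
  tri w cconsol a Q.
Proof.
elim: todo S a Q => [|h todo IH] S a Q ch sl z0 hrS prT ho un nb nl nr6 r6S r6B HB HQ.
  rewrite /cconsol; stp w16; first by rewrite ch.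
  by move=> _; apply: (HQ _ _ S) => //=; alia.
case: ch => r7 ch; have [h0 hrh] : prerep (fd a) h by apply: prT; rewrite inE eqxx.
have unT : uniq (fnodes ((h :: todo) ++ S)) by case/andP: un.
have nbT : {in fnodes ((h :: todo) ++ S), forall x, x <= n} by move=> x xh; apply: nb; rewrite inE xh orbT.
have uh : uniq (hnodes h) by apply: uniq_hnodes unT _; rewrite inE eqxx.
have nh : {in hnodes h, forall x, x <= n}.
  by move=> x xh; apply: nbT; rewrite fnodes_cons mem_cat xh.
have h1n : h.1 <= n by apply: nh; rewrite inE eqxx.
have r7n : rg a 7 <= n by rewrite r7.
have r5n : rg a 5 <= n by apply: nb; rewrite inE eqxx.
have ptr F' (t : tree) p : rep F' h.1 t p -> {subset nodes t <= nodes h.2} -> p <= n.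
  move=> hp sb; have [->//|/(rep_root hp)/sb pi] := eqVneq p 0.
  by apply: nh; rewrite inE pi orbT.
have l1n : fd a 0 (rg a 7) <= n by rewrite r7; apply: ptr hrh _.
have kn : hrk h <= n.
  apply: hrk_bound uh _ => x xh; rewrite nh // andbT.
  by apply: (prerep_gt0 (F := fd a)) xh.
have ek : fd a 3 (fd a 0 (rg a 7)) = rk h.2 by rewrite r7 (rep_rk z0 hrh).
have ekn : fd a 3 (fd a 0 (rg a 7)) < n by rewrite ek.
rewrite /cconsol; stp w16; last by rewrite r7 => e; rewrite e in h0.
move=> _; rewrite {1}/cstep; stp w16; stp w16; stp w16.
set nx := if fd a 1 h.1 == rg a 5 then fd a 0 (rg a 5) else fd a 1 h.1.
have sx : tri w (HIf (HV 8 ==! HV 5) (HSet 8 (HF 0 (HV 5))) HSkip) (setr a 8 (fd a 1 (rg a 7)))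
   (fun t a' => [/\ t <= 30, fd a' = fd a, ky a' = ky a, rg a' 8 = nx & forall r, r <> 8 -> rg a' r = rg a r]).
  rewrite /nx r7; stp w16; rewrite ?nat_of_bool_neq0.
    by move=> e; stp w16; rewrite e; split=> // r r8; rewrite /= !eqn_neq.
  by move/nat_of_bool_eq0 => e; stp w16; rewrite e; split=> // r r8; rewrite /= !eqn_neq.
apply: tri_conseq sx => t1 a1 [ht1 fd1 ky1 r81 rg1].
have [r71 r51 r61] : [/\ rg a1 7 = rg a 7, rg a1 5 = rg a 5 & rg a1 6 = rg a 6] by rewrite !rg1.
rewrite -fd1 -r71 in l1n ekn ek; rewrite -r71 in r7n.
stp w16; stp w16; stp w16; stp w16; stp w16; set a3 := setr _ 9 _.
have fd3 g i : g <> 2 \/ i <> h.1 -> fd a3 g i = fd a g i.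
  rewrite /= r71 r7 fd1; case=> [/eqn_neq -> //|/eqP/negbTE ->]; by rewrite andbF.
have unP : perm_eq (fnodes ((h :: todo) ++ S)) (fnodes todo ++ fnodes (h :: S)).
  by rewrite fnodes_cat !fnodes_cons; perml.
have un4 : uniq (fnodes todo ++ fnodes (h :: S)) by rewrite -(perm_uniq unP).
have un5 : uniq (fnodes (h :: S)) by move: un4; rewrite cat_uniq => /and3P[].
have nb5 : {in fnodes (h :: S), forall x, x <= n}.
  by move=> x xh; apply: nbT; rewrite (perm_mem unP) mem_cat xh orbT.
have hS h' : h' \in S -> h.1 \notin hnodes h'.
  move=> hS; move: un5; rewrite fnodes_cons cat_uniq => /and3P[_ /hasPn X _].
  by apply/negP => /(hnodes_sub hS)/X; rewrite inE eqxx.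
have nh1 : h.1 \notin nodes h.2 by move: uh => /andP[].
have x5 : rg a 5 \notin fnodes (h :: S).
  by move: un => /andP[+ _]; rewrite (perm_mem unP) mem_cat negb_or => /andP[].
apply: (@linksP w n disp K W S h) => //.
- by rewrite /= r71 r7.
- by rewrite /= ek addn1.
- case: sl => s1 s2 s3; split=> //.
    by move=> h' hin; rewrite fd3 ?s1 //; left.
  by move=> r rn; rewrite fd3; [apply: s3|left].
- move=> h'; rewrite inE => /orP[/eqP ->|hin].
    split=> //; first by rewrite /= r71 r7 eqxx.
    rewrite fd3; last by left.
    apply: rep_ext hrh => g x g4 xh; apply: fd3; right=> e.
    by rewrite -e xh in nh1.
  apply: hrep_ext (hrS _ hin) => [g x g4 xh _|].
    by apply: fd3; right=> e; move: (hS _ hin); rewrite -e xh.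
  suff : uniq (hnodes h') by case/andP.
  by apply: uniq_hnodes un5 _; rewrite inE hin orbT.
- move=> h' hin; rewrite /= ky1; apply: ho; move: hin; rewrite !inE mem_cat.
  by case/orP=> ->; rewrite ?orbT.
move=> t2 a4 h' S' p4 sz4 sb4 fp4 ht4 r74 r94 rg4 ky4 sl4 s04 hr4 ho4 f4 f4' z4.
have k4 : ky a4 = ky a by rewrite ky4.
have hin' : h' \in h' :: S' by rewrite inE eqxx.
have u4 : uniq (fnodes (h' :: S')) by rewrite (perm_uniq p4).
have nb4 : {in fnodes (h' :: S'), forall x, x <= n} by move=> x; rewrite (perm_mem p4); apply: nb5.
have k'n : hrk h' <= n.
  apply: hrk_bound; first exact: uniq_hnodes u4 hin'.
  by move=> x xh; rewrite (hrep_gt0 (hr4 _ hin') xh) nb4 // fnodes_cons mem_cat xh.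
have k'B : hrk h' <= B.
  apply: HB; apply: leq_trans (hrk_size h') _; rewrite (perm_size unP) size_cat.
  rewrite -(perm_size p4) fnodes_cons size_cat.
  exact: leq_trans (leq_addr _ _) (leq_addl _ _).
have r94n : rg a4 9 <= n by rewrite r94.
stp w16; stp w16; stp w16.
set a5 := setf _ 11 _ _.
have sm : tri w (HIf (HV 6 <! HV 9) (HSet 6 (HV 9)) HSkip) a5 (fun t a' => [/\ t <= 20,
   fd a' = fd a5, ky a' = ky a, rg a' 6 = maxn (rg a 6) (hrk h') & forall r, r <> 6 -> rg a' r = rg a4 r]).
  have r64 : rg a4 6 = rg a 6 by rewrite rg4 /= ?r61 //; left.
  stp w16; rewrite r64 r94 ?nat_of_bool_neq0.
    move=> lt; stp w16; split; [by []|by rewrite /= r94|by rewrite /= k4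
      |by rewrite /= r94 (maxn_idPr (ltnW lt))|by move=> r r6; rewrite /= eqn_neq].
  by move/nat_of_bool_eq0/negbT; rewrite -leqNgt => le; stp w16;
   split; [by []|by rewrite /= r94|by rewrite /= k4|by rewrite /= r64 (maxn_idPl le)|by []].
apply: tri_conseq sm => t3 a6 [ht3 fd6 ky6 r66 rg6].
stp w16; rewrite -/cconsol; set a7 := setr _ 7 _.
have rg7 r : r < 6 -> rg a7 r = rg a r.
  move=> hr; rewrite /= (eqn_lt hr) // rg6; last by move=> e; rewrite e in hr.
  rewrite rg4 /=; last by left; apply: leq_trans hr _.
  by rewrite (eqn_lt hr) // rg1 // => e; rewrite e in hr.
have f7 g i : g <> 11 -> i \notin fnodes (h :: S) -> g <> 2 \/ i <> 0 -> fd a7 g i = fd a g i.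
  move=> g11 ih h2; rewrite /= fd6 /= eqn_neq // f4' // fd3 //; right=> e.
  by rewrite e fnodes_cons inE eqxx in ih.
have todo_out h'' x : h'' \in todo -> x \in hnodes h'' -> x \notin fnodes (h :: S).
  move=> hin xh; apply/negP => xS; have := cat_neq un4 (hnodes_sub hin xh) xS.
  by rewrite eqxx.
have pT : perm_eq (fnodes (todo ++ h' :: S')) (fnodes ((h :: todo) ++ S)).
  apply: perm_trans (_ : perm_eq _ (fnodes todo ++ fnodes (h :: S))) _; last by rewrite perm_sym.
  by rewrite fnodes_cat perm_cat2l.
have r75 : rg a7 5 = rg a 5 by apply: rg7.
have x0 x : x \in fnodes (h' :: S') -> 0 < x.
  by case/flatten_mapP=> h'' hin xh; apply: hrep_gt0 (hr4 _ hin) xh.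
apply: (IH (h' :: S')).
- rewrite r75 [rg _ 7]/= rg6 // rg4; last by right.
  rewrite /= r81; apply: chain_ext ch; first by apply: f7 => //; left.
  move=> x /mapP[h'' hin ->]; apply: f7 => //; last by left.
  by apply: todo_out hin _; rewrite inE eqxx.
- apply: slots_add sl4 s04 _ _ _ _.
  + by apply/eqP; rewrite -lt0n x0 // fnodes_cons inE eqxx.
  + by rewrite /= fd6 /= r94 eqxx.
  + by move=> r /eqP/negbTE e; rewrite /= fd6 /= r94 e.
  + by move=> h'' hin; apply/eqP; rewrite -lt0n x0 // fnodes_cons mem_cat (hnodes_sub hin) ?orbT // inE eqxx.
- by rewrite /= fd6 /= z4 fd3 //; left.
- move=> h'' hin; apply: hrep_ext (hr4 _ hin) => [g x g4 _ _|].
    by rewrite /= fd6 /= eqn_neq // => e; rewrite e in g4.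
  by case/andP: (uniq_hnodes u4 hin).
- move=> h'' hin; have hin2 : h'' \in h :: todo by rewrite inE hin orbT.
  have pr := prT _ hin2; apply: prerep_ext (pr) => [g x g4 xh|].
    have xh' : x \in hnodes h'' by rewrite inE xh orbT.
    apply: f7; [by move=> e; rewrite e in g4|exact: todo_out hin _|].
    by right=> e; have := prerep_gt0 pr xh'; rewrite e.
  by apply: f7 => //; [apply: todo_out hin _; rewrite inE eqxx|left].
- move=> h''; rewrite [ky _]/= ky6 mem_cat => /orP[hin|hin].
    by apply: ho; rewrite mem_cat inE hin orbT.
  by have := ho4 _ hin; rewrite /= ky1.
- by rewrite r75 /= (perm_mem pT) (perm_uniq pT).
- by move=> x; rewrite r75 inE (perm_mem pT) => hx; apply: nb; rewrite inE.
- by rewrite r75 f7 //; left.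
- by rewrite /= r66 geq_max nr6.
- move=> h''; rewrite /= r66 inE leq_max => /orP[/eqP ->|hin]; first by rewrite leqnn orbT.
  by apply/orP; left; apply: r6S; apply: sb4.
- by rewrite /= r66 geq_max r6B.
- by move=> k; rewrite (perm_size pT); apply: HB.
move=> t4 a8 S'' p8 sz8 fp8 ht8 r6n8 r6B8 r6S8 rg8 ky8 sl8 hr8 ho8 f8 f8' z8.
apply: (HQ _ _ S'') => //.
- exact: perm_trans pT.
- by move: sz8 sz4 => /=; clear; lia.
- move: fp8 fp4; rewrite !fpot_cat !fpot_cons /=; clear; lia.
- move: ht8 ht4 ht1 ht3 => /=; clear; lia.
- by move=> r hr; rewrite rg8 // rg7.
- by rewrite ky8 /= ky6.
- by move: ho8; rewrite /= ky6.
- move=> g i g3 g11; rewrite f8 // /= fd6 /= eqn_neq // f4 // fd3 //; left=> e.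
  by rewrite e in g3.
- move=> g i g11 ih h2; rewrite f8' //; last by rewrite (perm_mem pT).
  by apply: f7 => //; move: ih; rewrite (perm_mem unP) mem_cat negb_or => /andP[].
Qed.

End Procedures.

(** * Collecting the linked half trees into one circle *)

Section Procedures.
Variables (w n : nat) (disp : Order.disp_t) (K : orderType disp).
Hypothesis W : 256 * n.+1 <= 2 ^ w.
Let w16 := w16 W.
Implicit Types (a : ast K) (Q : nat -> ast K -> Prop).

Lemma collectP s S a Q g :
  rg a 20 = g -> g <= n -> rg a 6 <= n -> rg a 9 <= rg a 6 -> slots n (fd a) S ->
  {in S, forall h, rg a 9 < hrk h <= rg a 6} -> {in S, forall h, hrep (fd a) h} ->
  {in S, forall h, hhord (ky a) h} -> lrep (fd a) (ky a) s (fd a 9 g) ->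
  uniq (fnodes (s ++ S)) -> {in fnodes (s ++ S), forall x, 0 < x <= n} ->
  (forall t a' s', t + 200 * rg a 9 <= 200 * rg a 6 + 20 ->
     perm_eq s' (s ++ S) -> lrep (fd a') (ky a) s' (fd a' 9 g) -> ky a' = ky a ->
     (forall r, r < 9 -> rg a' r = rg a r) ->
     (forall r, 0 < r <= n -> fd a' 11 r = 0) ->
     (forall f i, f <> 1 -> f <> 9 -> f <> 11 -> fd a' f i = fd a f i) ->
     (forall i, i \notin fnodes (s ++ S) -> i <> 0 -> fd a' 1 i = fd a 1 i) ->
     (forall i, i <> g -> fd a' 9 i = fd a 9 i) -> Q t a') ->
  tri w ccollect a Q.
Proof.
move=> r20 gn r6n.
have [m] := ubnP (rg a 6 - rg a 9); elim: m s S a Q r20 r6n => // m IH s S a Q r20 r6n hm le sl rkS hrS hoS ls un nb HQ.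
rewrite /ccollect; stp w16; rewrite ?nat_of_bool_neq0; last first.
  move/nat_of_bool_eq0/negbT; rewrite -leqNgt => ge.
  have S0 : S = [::].
    case: (S) rkS => // h S' /(_ h); rewrite inE eqxx => /(_ isT) /andP[a1 a2].
    by have := leq_trans a2 ge; rewrite leqNgt a1.
  apply: (HQ _ _ s) => //; rewrite ?S0 ?cats0 //; first by move: le; clear; lia.
  move=> r rn; apply/eqP/negP => /negP/eqP; case: sl => _ _ X /(X r rn).
  by rewrite S0.
move=> lt; have r9n : (rg a 9).+1 <= n by apply: leq_trans lt r6n.
set r := (rg a 9).+1; set y := fd a 11 r.
have y0S : {in S, forall h, h.1 <> 0}.
  by move=> h hS; apply/eqP; rewrite -lt0n; case: (hrS h hS).
(* The half tree of rank [r] is taken as a list [s2] of length at most one, so that an empty slot is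
   the meld with an empty circle. *)
have [s2 [S1 [pS y2 sz hs2]]] : exists s2 S1 : seq htree, [/\ perm_eq S (s2 ++ S1),
    y = head 0 [seq h.1 | h <- s2], size s2 <= 1
    & {in s2, forall h, hrk h = r} /\ {in S1, forall h, hrk h <> r}].
  case: (y =P 0) => [y0|yn0].
    exists [::], S; split=> //; split=> // h hS e; apply: (y0S h hS).
    by case: sl => <- // _ _; rewrite e.
  have : r \in [seq hrk h | h <- S] by case: sl => _ _; apply => //; rewrite r9n.
  case/mapP=> h hS er; exists [:: h], (rem h S); split=> //.
  - exact: perm_to_rem.
  - by rewrite /y er; case: sl => ->.
  - split; first by move=> h'; rewrite inE => /eqP ->.
    move=> h' h'S e; case: sl => _ u _; move: u.
    rewrite (perm_uniq (perm_map hrk (perm_to_rem hS))) /= => /andP[/negP X _].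
    by apply: X; rewrite -er -e map_f.
have memS h : h \in s2 ++ S1 -> h \in S by rewrite (perm_mem pS).
have pT : perm_eq (s ++ S) ((s ++ s2) ++ S1) by rewrite -catA perm_cat2l.
have unT : uniq (fnodes ((s ++ s2) ++ S1)) by rewrite -(perm_uniq (perm_fnodes pT)).
have nbT : {in fnodes ((s ++ s2) ++ S1), forall x, 0 < x <= n}.
  by move=> x; rewrite -(perm_mem (perm_fnodes pT)); apply: nb.
have un1 : uniq (fnodes (s ++ s2)) by move: unT; rewrite fnodes_cat cat_uniq => /and3P[].
have yn : y <= n.
  rewrite y2; case: (s2) nbT => //= h s2' nbT.
  by have /andP[] := nbT h.1 (ltac:(by rewrite fnodes_cat mem_cat fnodes_cat mem_cat fnodes_cons inE eqxx !orbT)).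
have r9s : rg a 9 + 1 = r by rewrite addn1.
have yn' : fd a 11 (rg a 9 + 1) <= n by rewrite r9s.
do 8 stp w16; rewrite r9s -/y; set a2 := setf _ 1 _ _.
have f2 g' i : g' <> 1 \/ i <> y -> g' <> 11 \/ i <> r -> fd a2 g' i = fd a g' i.
  have X (p q i1 j1 : nat) : p <> q \/ i1 <> j1 -> eqn p q && (i1 == j1) = false.
    by case=> [/eqn_neq -> //|/eqP/negbTE ->]; rewrite andbF.
  by move=> /X h1 /X h2; rewrite /= h1 h2.
have yS x : x \in fnodes s -> x <> y.
  move=> xs; rewrite y2; case: (s2) un1 => [_|h s2' un1] /=.
    have /nb/andP[x0 _] : x \in fnodes (s ++ S) by rewrite fnodes_cat mem_cat xs.
    by move=> e; rewrite e in x0.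
  by apply/eqP; apply: (@cat_neq (fnodes s) (fnodes (h :: s2'))); rewrite -?fnodes_cat // fnodes_cons inE eqxx.
have nb1 : {in fnodes (s ++ s2), forall x, x <= n}.
  by move=> x xs; have /andP[] : 0 < x <= n by apply: nbT; rewrite fnodes_cat mem_cat xs.
have l1 : lrep (fd a2) (ky a) s (fd a2 9 g).
  rewrite f2; [|by left|by left]; apply: lrep_ext ls => // [g' x g4 xs|].
    by apply: f2; [right; apply: yS|left=> e; rewrite e in g4].
  by move: un; rewrite fnodes_cat cat_uniq => /and3P[].
have l2 : lrep (fd a2) (ky a) s2 y.
  case: (s2) y2 sz memS un1 => [|h [|//]] /= y2 _ memS un1; first by rewrite y2; exact: lrep_nil.
  have hS : h \in S by apply: memS; rewrite inE eqxx.
  split=> //.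
  - by rewrite /circ /= y2 !eqxx.
  - move=> h'; rewrite inE => /eqP ->; apply: hrep_ext (hrS _ hS) => [g' x g4 xh /orP hx|].
      apply: f2; last by left=> e; rewrite e in g4.
      by rewrite y2; case: hx => /eqP; auto.
    have : uniq (hnodes h) by apply: (@uniq_hnodes (s ++ [:: h])) => //; rewrite mem_cat !inE eqxx orbT.
    by case/andP.
  - by move=> h'; rewrite inE => /eqP ->; apply: hoS.
  - by move=> z; rewrite inE => /eqP ->; rewrite y2.
apply: (@meldP w n disp K W a2 s s2 g y) => //.
move=> t1 a3 s3 ht1 ky3 rg3 f3 f31 f39 p3 l3.
have pT3 : perm_eq (s ++ S) (s3 ++ S1).
  by apply: perm_trans pT _; rewrite perm_cat2r perm_sym.
have sl1 : slots n (fd a) (s2 ++ S1) := slots_perm pS sl.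
have f11 i : fd a3 11 i = if i == r then 0 else fd a 11 i.
  by rewrite f3 //= .
have S1nb x : x \in fnodes S1 -> x \in fnodes S by move=> xs; rewrite (perm_mem (perm_fnodes pS)) fnodes_cat mem_cat xs orbT.
have rootsub : {subset [seq h.1 | h <- s ++ s2] <= fnodes (s ++ s2)} by apply: roots_sub.
have S1out x : x \in fnodes S1 -> x \notin fnodes (s ++ s2).
  move=> xs; apply/negP => x2; have := @cat_neq (fnodes (s ++ s2)) (fnodes S1) x x.
  by rewrite -fnodes_cat eqxx => /(_ unT x2 xs).
have yS1 x : x \in fnodes S1 -> x <> y.
  move=> xs e; case: (s2) y2 (S1out x xs) => [|h t2] /= y2' so; last first.
    by move: so; rewrite e y2' fnodes_cat fnodes_cons mem_cat inE eqxx orbT.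
  have /nb/andP[+ _] : x \in fnodes (s ++ S) by rewrite fnodes_cat mem_cat (S1nb x xs) orbT.
  by rewrite e y2'.
have r93 : rg a3 9 = r by rewrite rg3 //= r9s.
apply: (IH s3 S1).
- by rewrite rg3.
- by rewrite rg3.
- by rewrite r93 rg3 //= /r; move: hm lt; clear; lia.
- by rewrite r93 rg3.
- case: sl1 => s1 s22 s33; split.
  + move=> h hS1; rewrite f11; case: eqP => [e|_]; last by apply: s1; rewrite mem_cat hS1 orbT.
    by case: hs2 => _ /(_ h hS1).
  + by move: s22; rewrite map_cat cat_uniq => /and3P[].
  + move=> r' rn; rewrite f11; case: eqP => // ne /(s33 r' rn).
    rewrite map_cat mem_cat => /orP[/mapP[h hin e]|//].
    by case: ne; rewrite e; case: hs2 => /(_ h hin).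
- move=> h hS1; rewrite r93 rg3 //=; have /rkS/andP[h1 ->] : h \in S by apply: memS; rewrite mem_cat hS1 orbT.
  rewrite andbT; case: hs2 => _ /(_ h hS1); move: h1; rewrite /r; clear; lia.
- move=> h hS1; have hS : h \in S by apply: memS; rewrite mem_cat hS1 orbT.
  apply: hrep_ext (hrS _ hS) => [g' x g4 xh _|]; last first.
    have : uniq (hnodes h) by apply: (@uniq_hnodes (s ++ S)) => //; rewrite mem_cat hS orbT.
    by case/andP.
  have xS1 : x \in fnodes S1 by apply: hnodes_sub xh.
  have -> : fd a3 g' x = fd a2 g' x.
    case: (g' =P 1) => [->|g1]; last by apply: f3 => // e; rewrite e in g4.
    by apply: f31; apply: contra (S1out x xS1) => /rootsub.
  by apply: f2; [right; apply: yS1|left=> e; rewrite e in g4].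
- by move=> h hS1; rewrite ky3; apply: hoS; apply: memS; rewrite mem_cat hS1 orbT.
- by rewrite ky3.
- by rewrite -(perm_uniq (perm_fnodes pT3)).
- by move=> x; rewrite -(perm_mem (perm_fnodes pT3)); apply: nb.
move=> t2 a4 s4 ht2 p4 l4 ky4 rg4 f411 f4 f41 f49.
apply: (HQ _ _ s4) => //.
- move: ht2; rewrite r93 rg3 //= /r; move: ht1; clear; lia.
- by rewrite perm_sym; apply: perm_trans pT3 _; rewrite perm_sym.
- by move: l4; rewrite ky3.
- by rewrite ky4 ky3.
- move=> r' hr; rewrite rg4 // rg3 /=; last by apply: leq_trans hr _.
  by rewrite !(eqn_lt hr).
- by move=> g' i g1 g9 g11; rewrite f4 // f3 // f2 //; left.
- move=> i ni i0; rewrite f41 //; last by rewrite -(perm_mem (perm_fnodes pT3)).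
  rewrite f31 ?f2 //; last first.
    by apply: contra ni => /rootsub h; rewrite (perm_mem (perm_fnodes pT)) fnodes_cat mem_cat h.
    by left.
  right=> e; move: ni; rewrite e (perm_mem (perm_fnodes pT)) y2.
  case: (s2) y2 => [y0|h s2' _ /=]; first by rewrite e y0 in i0.
  by rewrite !fnodes_cat fnodes_cons !mem_cat inE eqxx !orbT.
- by move=> i ig; rewrite f49 // f39 // f2 //; left.
Qed.

End Procedures.

(** * Minima of the levels *)

(* Register 26 receives the minimum of the levels above the one in register 24. *)
Definition ccur : hcmd :=
  HSet 25 (HV 3 >>! (HV 24 +! HC 1)) ;;
  HIf (HV 25) (HSet 26 (HF 9 (HV 24 +! HC 1 +! HF 8 (HV 25)))) (HSet 26 (HC 0)).

(* Register 26 is null or holds a larger key than register [r]. *)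
Definition cless (r : nat) : hexp := (HV 26 ==! HC 0) +! (HK (HV 26) (HV r) ==! HC 0).

(** The bits above the level in register 24 are kept, and those from it down are recomputed from the
    top, while register 26 carries the minimum of the levels already passed. *)
Definition crefresh : hcmd :=
  ccur ;;
  HSet 3 (HV 25 <<! (HV 24 +! HC 1)) ;;
  HSet 27 (HV 24 +! HC 1) ;;
  HWhile (HV 27)
    (HSet 27 (HV 27 -! HC 1) ;;
     HSet 28 (HF 9 (HV 27)) ;;
     HIf ((HC 0 <! HV 28) *! cless 28)
       (HSet 3 (HV 3 +! (HC 1 <<! HV 27)) ;; HSet 26 (HV 28))
       HSkip).

(* Updates the records after a decrease of the minimum of the level in
   register 24. *)
Definition clower : hcmd :=
  HSet 27 (HF 9 (HV 24)) ;;
  ccur ;;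
  HIf (cless 27)
    (HIf ((HV 3 >>! HV 24) %! HC 2) HSkip (HSet 3 (HV 3 +! (HC 1 <<! HV 24))) ;;
     HSet 28 (HV 3 %! (HC 1 <<! HV 24)) ;;
     HWhile (HV 28)
       (HSet 25 (HF 7 (HV 28) -! HC 1) ;;
        HIf (HK (HV 27) (HF 9 (HV 25)))
          (HSet 3 (HV 3 -! (HC 1 <<! HV 25)) ;; HSet 28 (HV 28 -! (HC 1 <<! HV 25)))
          (HSet 28 (HC 0))))
    HSkip.

Section Procedures.
Variables (w n : nat) (disp : Order.disp_t) (K : orderType disp).
Hypothesis W : 256 * n.+1 <= 2 ^ w.
Let w16 := w16 W.
Implicit Types (a : ast K) (Q : nat -> ast K -> Prop).

(** * Records among the minima of the levels *)

Section Records.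
Variables (mu : nat -> nat) (k : nat -> K) (N : nat).
Hypothesis muN : forall j, N <= j -> mu j = 0.

(** A null [mu j] stands for an empty level. The inequality is strict, so among equal minima the
    highest level is the record. *)
Definition isrec (j : nat) : Prop :=
  mu j <> 0 /\ forall j', j < j' -> mu j' <> 0 -> (k (mu j) < k (mu j'))%O.

Definition sufmin (j c : nat) : Prop :=
  (c = 0 /\ forall j', j <= j' -> mu j' = 0) \/
  [/\ c <> 0, exists2 j', j <= j' & mu j' = c & forall j', j <= j' -> mu j' <> 0 -> (k c <= k (mu j'))%O].

Lemma isrec_sufmin j c : sufmin j.+1 c ->
  (isrec j <-> mu j <> 0 /\ (c = 0 \/ (k (mu j) < k c)%O)).
Proof.
case=> [[c0 z]|[c0 [j1 j1j mc] m]]; split.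
- by case=> h _; split=> //; left.
- by case=> h _; split=> // j' jj' nz; case: nz; apply: z.
- by case=> h1 h2; split=> //; right; rewrite -mc; apply: h2 => //; rewrite mc.
- case=> h1 [//|h2]; split=> // j' jj' nz; apply: lt_le_trans h2 _; exact: m.
Qed.

Lemma sufmin_rec j c : sufmin j.+1 c -> isrec j -> sufmin j (mu j).
Proof.
move=> sm [h1 h2]; right; split=> //; first by exists j.
by move=> j'; rewrite leq_eqVlt => /orP[/eqP <- //|jj' nz]; apply: ltW; apply: h2.
Qed.

Lemma sufmin_nrec j c : sufmin j.+1 c -> ~ isrec j -> sufmin j c.
Proof.
move=> sm nr; have nr2 : ~ (mu j <> 0 /\ (c = 0 \/ (k (mu j) < k c)%O)).
  by move/(isrec_sufmin sm).
case: sm => [[c0 z]|[c0 [j1 j1j mc] m]]; [left|right].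
  split=> // j'; rewrite leq_eqVlt => /orP[/eqP <-|/z //].
  by apply/eqP/negP => /negP/eqP h; apply: nr2; auto.
split=> //; first by exists j1 => //; apply: ltnW.
move=> j'; rewrite leq_eqVlt => /orP[/eqP <- nz|jj' nz]; last exact: m.
by rewrite leNgt; apply/negP => lt; apply: nr2; auto.
Qed.

(** The lowest record from [g] on is the minimum of these levels, so a shift of the mask and a
    dyadic valuation, read from a table, give a suffix minimum in constant time. The induction
    descends from [N], beyond which all levels are empty. *)
Lemma sufmin_bits R g : (forall j, g <= j -> bit j R <-> isrec j) ->
  sufmin g (if R %/ 2 ^ g == 0 then 0 else mu (g + logn 2 (R %/ 2 ^ g))).
Proof.
have [m] := ubnP (N - g); elim: m g => // m IH g hm hR; case: (leqP N g) => Ng.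
  have -> : R %/ 2 ^ g = 0.
    apply: bitsP => j; rewrite bit_div; apply/negP => /hR[]; first exact: leq_addr.
    by rewrite muN // (leq_trans Ng) // leq_addr.
  by rewrite eqxx; left; split=> // j' gj; apply: muN; apply: leq_trans gj.
have sm := IH g.+1 (ltac:(move: hm Ng; clear; lia)) (fun j gj => hR j (ltnW gj)).
rewrite expnSr divnMA in sm; move: sm; have := hR g (leqnn g); rewrite /bit.
set s := R %/ 2 ^ g => hg sm; case b: (odd s).
  have s0 : (s == 0) = false by case: (s) b.
  have -> : logn 2 s = 0 by rewrite lognE dvdn2 b andbF.
  by rewrite s0 addn0; apply: sufmin_rec sm _; apply/hg.
have nr : ~ isrec g by move/hg; rewrite b.
have es : s = 2 * (s %/ 2) by move: (s) b; clear; lia.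
move: (sufmin_nrec sm nr); have -> : (s == 0) = (s %/ 2 == 0).
  by move: (s) es; clear; lia.
case: eqP => // /eqP q0; have -> : logn 2 s = (logn 2 (s %/ 2)).+1.
  by rewrite {1}es lognM // lt0n.
by rewrite addSnnS.
Qed.

Lemma rec_cover R j : (forall j, bit j R <-> isrec j) -> mu j <> 0 ->
  exists2 j', bit j' R & (k (mu j') <= k (mu j))%O.
Proof.
move=> hR mj; have := @sufmin_bits R j (fun j' _ => hR j').
case=> [[_ z]|[c0 [j1 j1j mc] m]]; first by case: mj; apply: z.
move: c0 mc m; case: eqP => // /eqP s0 c0 mc m.
exists (j + logn 2 (R %/ 2 ^ j)); last exact: m.
by rewrite -bit_div; apply: bit_logn; rewrite lt0n.
Qed.

(** Every nonempty level is dominated by a record, and the keys of the records increase with the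
    level, so the lowest bit of the mask wins. *)
Lemma rec_min R j : (forall j, bit j R <-> isrec j) -> mu j <> 0 ->
  [/\ 0 < R, isrec (logn 2 R) & (k (mu (logn 2 R)) <= k (mu j))%O].
Proof.
move=> hR mj; have [j' bj le] := rec_cover hR mj.
have R0 : 0 < R by rewrite lt0n; apply: contraTneq bj => ->; rewrite /bit div0n.
have br := bit_logn R0; have ir : isrec (logn 2 R) by apply/hR.
split=> //; apply: le_trans le; have [lt|ge] := ltnP (logn 2 R) j'.
  by apply: ltW; case: ir => _; apply=> //; case/hR: bj.
suff -> : j' = logn 2 R by [].
by apply/eqP; move: ge; rewrite leq_eqVlt => /orP[//|/bit_lt_logn]; rewrite bj.
Qed.

Lemma rec_bound R : (forall j, bit j R -> isrec j) -> R < 2 ^ N.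
Proof.
move=> hR; apply: bits_ltn => j Nj; apply/negP => /hR[]; by rewrite muN.
Qed.

End Records.

(** * Programs that maintain the mask *)

Variables (mu : nat -> nat) (N : nat).
Hypothesis muN : forall j, N <= j -> mu j = 0.
(** Keeps the mask, smaller than [2 ^ N], among the indices of records, so that the tables in fields
    7 and 8 can be read at it. *)
Hypothesis N2 : 2 ^ N <= n.+1.
Hypothesis mun : forall j, mu j <= n.

Lemma Nn : N <= n.
Proof. by rewrite -ltnS; apply: leq_trans N2; apply: ltn_expl. Qed.

Lemma mu_lt j : mu j <> 0 -> j < N.
Proof. by move=> h; rewrite ltnNge; apply/negP => /muN. Qed.

Lemma curP g a Q : rg a 24 = g -> g <= n ->
  (forall j, j <= n -> fd a 9 j = mu j) ->
  (forall s, 0 < s <= n -> fd a 8 s = logn 2 s) ->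
  (forall j, g < j -> bit j (rg a 3) <-> isrec mu (ky a) j) ->
  (forall t c, t <= 60 -> sufmin mu (ky a) g.+1 c -> c <= n ->
     Q t (setr (setr a 25 (rg a 3 %/ 2 ^ g.+1)) 26 c)) ->
  tri w ccur a Q.
Proof.
move=> r24 gn hmu tab hR HQ; have sm := sufmin_bits muN hR.
set s := rg a 3 %/ 2 ^ g.+1 in sm HQ *.
have sN : s < 2 ^ N.
  apply: bits_ltn => j Nj; rewrite bit_div; apply/negP => /hR[].
    by rewrite addSn ltnS leq_addr.
  by rewrite muN // (leq_trans Nj) // leq_addl.
have sn : s <= n by rewrite -ltnS; apply: leq_trans sN N2.
rewrite /ccur; stp w16; stp w16; rewrite r24 addn1 -/s; stp w16; last first.
  move=> s0; stp w16; apply: HQ => //; by move: sm; rewrite s0 eqxx.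
move=> s0; have ls : g.+1 + logn 2 s < N.
  apply: mu_lt; have [] : isrec mu (ky a) (g.+1 + logn 2 s); last by [].
  apply/hR; first by rewrite addSn ltnS leq_addr.
  by rewrite -bit_div; apply: bit_logn; rewrite lt0n.
have lsn : g.+1 + logn 2 s <= n by apply: leq_trans (ltnW ls) Nn.
have t8 : fd a 8 s = logn 2 s by apply: tab; rewrite lt0n s0.
have lsn2 : rg a 24 + 1 + fd a 8 s <= n by rewrite r24 addn1 t8.
stp w16; rewrite r24 (addn1 g) t8 hmu //; apply: HQ => //.
by move: sm; rewrite (negbTE s0).
Qed.

Lemma clessE a r : ev a (cless r) != 0 <-> rg a 26 = 0 \/ (ky a (rg a r) < ky a (rg a 26))%O.
Proof.
rewrite /= ltNge; case: (rg a 26 =P 0) => [e|ne] /=; first by split=> // _; left.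
rewrite add0n; case: (_ <= _)%O => /=; split=> //; [by case|by right].
Qed.

Lemma cless0E a : ev a ((HC 0 <! HV 28) *! cless 28) != 0 <->
  rg a 28 <> 0 /\ (rg a 26 = 0 \/ (ky a (rg a 28) < ky a (rg a 26))%O).
Proof.
rewrite -clessE -[ev a (_ *! _)]/((0 < rg a 28) * ev a (cless 28)) muln_eq0 negb_or.
rewrite nat_of_bool_neq0 lt0n; split=> [/andP[/eqP h1 h2]//|[/eqP h1 h2]].
by rewrite h1.
Qed.

Lemma refreshP g a Q : rg a 24 = g -> g <= n ->
  (forall j, j <= n -> fd a 9 j = mu j) ->
  (forall s, 0 < s <= n -> fd a 8 s = logn 2 s) ->
  (forall j, g < j -> bit j (rg a 3) <-> isrec mu (ky a) j) ->
  (forall t a', t <= 100 * g.+2 -> fd a' = fd a -> ky a' = ky a ->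
     (forall r, r < 24 -> r <> 3 -> rg a' r = rg a r) ->
     popc w (rg a' 3) <= popc w (rg a 3) + g.+1 ->
     (forall j, bit j (rg a' 3) <-> isrec mu (ky a) j) -> Q t a') ->
  tri w crefresh a Q.
Proof.
move=> r24 gn hmu tab hR HQ; rewrite /crefresh; stp w16.
apply: (curP r24) => // t c ht sm cn.
have hR1 : rg a 3 %/ 2 ^ g.+1 * 2 ^ g.+1 <= rg a 3 by apply: leq_divM.
set R1 := rg a 3 %/ 2 ^ g.+1 * 2 ^ g.+1.
have R1b j : bit j R1 <-> g < j /\ isrec mu (ky a) j.
  rewrite /R1 bit_clear; split; first by case/andP=> gj /(hR _ gj).
  by case=> gj ir; rewrite gj /=; apply/(hR _ gj).
have R1n : R1 <= n.
  rewrite -ltnS; apply: leq_trans N2; apply: (rec_bound muN (k := ky a)) => j.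
  by case/R1b.
have r24n : rg a 24 <= n by rewrite r24.
stp w16; stp w16; first by rewrite /= r24 addn1 -/R1; move: R1n; alia.
rewrite r24 addn1 -/R1; stp w16; stp w16; rewrite r24 addn1.
set a1 := setr _ 27 _.
suff loop : forall j a2 Q', fd a2 = fd a -> ky a2 = ky a -> rg a2 27 = j -> j <= g.+1 ->
   sufmin mu (ky a) j (rg a2 26) -> rg a2 26 <= n ->
   (forall j', bit j' (rg a2 3) <-> j <= j' /\ isrec mu (ky a) j') ->
   (forall t a', t <= 80 * j + 10 -> fd a' = fd a -> ky a' = ky a ->
      (forall r, r < 24 -> r <> 3 -> rg a' r = rg a2 r) ->
      popc w (rg a' 3) <= popc w (rg a2 3) + j ->
      (forall j, bit j (rg a' 3) <-> isrec mu (ky a) j) -> Q' t a') ->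
   tri w (HWhile (HV 27) (HSet 27 (HV 27 -! HC 1) ;; HSet 28 (HF 9 (HV 27)) ;;
      HIf ((HC 0 <! HV 28) *! cless 28)
       (HSet 3 (HV 3 +! (HC 1 <<! HV 27)) ;; HSet 26 (HV 28)) HSkip)) a2 Q'.
  apply: (loop g.+1) => // t2 a' ht2 fd2 ky2 rg2 pc2 hR2; apply: HQ => //.
  - by move: ht ht2; clear; lia.
  - by move=> r r24' r3; rewrite rg2 //= (eqn_neq r3) !(eqn_lt r24').
  - by apply: leq_trans pc2 _; rewrite leq_add2r popc_clear.
elim=> [|j IH] a2 Q' fd2 ky2 r27 jg sm2 r26n hR2 HQ2.
  stp w16; first by rewrite r27.
  move=> _; apply: HQ2 => //; first by rewrite addn0.
  by move=> j; rewrite hR2; split=> [[]|].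
have jn : j <= n by apply: leq_trans gn.
have r27n : rg a2 27 - 1 <= n by rewrite r27 subn1.
have r27n' : rg a2 27 <= n.+1 by rewrite r27.
have R2n : rg a2 3 <= n.
  rewrite -ltnS; apply: leq_trans N2; apply: (rec_bound muN (k := ky a)) => j'.
  by case/hR2.
stp w16; last by rewrite r27.
move=> _; stp w16; stp w16.
rewrite r27 subn1 [j.+1.-1]/=; stp w16; stp w16; rewrite fd2 hmu //.
have mjn : mu j <= n := mun j.
have R2j : ~~ bit j (rg a2 3) by apply/negP => /hR2[]; rewrite ltnn.
have jw : j < N -> 2 ^ j.+1 <= n.+1.
  by move=> jN; apply: leq_trans N2; rewrite leq_exp2l.
apply: (tri_if w16); first by dfs.
- move/cless0E => /= c1; have ir : isrec mu (ky a) j.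
    by apply/(isrec_sufmin sm2); rewrite -ky2; case: c1.
  have jN : j < N by apply: mu_lt; case: c1.
  have e2 := jw jN; rewrite expnS in e2.
  have jw2 : j < w.
    rewrite -(ltn_exp2l _ _ (isT : 1 < 2)); move: W e2; have := expn_gt0 2 j; clear; lia.
  stp w16; stp w16; try by rewrite mul1n; move: e2 R2n; alia.
  stp w16; rewrite mul1n; apply: IH => //=.
  + exact: ltnW.
  + exact: sufmin_rec sm2 ir.
  + move=> j'; rewrite bit_add //; case: (j' =P j) => [->|ne] /=; first by split.
    rewrite hR2; split=> -[h1 h2]; split=> //; first exact: ltnW.
    by rewrite ltn_neqAle h1 andbT; apply/eqP => e; rewrite e in ne.
  + move=> t3 a' ht3 fd3 ky3 rg3 pc3 hR3; apply: HQ2 => //.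
    * by move: ht3; clear; lia.
    * by move=> r r24' r3; rewrite rg3 //= (eqn_neq r3) !(eqn_lt r24').
    * by move: pc3; rewrite popc_add //; clear; lia.
- move=> c0; have nir : ~ isrec mu (ky a) j.
    move/(isrec_sufmin sm2) => c1; suff : ev (setr (setr a2 27 j) 28 (mu j)) ((HC 0 <! HV 28) *! cless 28) != 0.
      by rewrite c0.
    by apply/cless0E; rewrite /= ky2.
  stp w16; apply: IH => //=.
  + exact: ltnW.
  + exact: sufmin_nrec sm2 nir.
  + move=> j'; rewrite hR2; split=> -[h1 h2]; split=> //; first exact: ltnW.
    by rewrite ltn_neqAle h1 andbT; apply/eqP => e; apply: nir; rewrite e.
  + move=> t3 a' ht3 fd3 ky3 rg3 pc3 hR3; apply: HQ2 => //.
    * by move: ht3; clear; lia.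
    * by move=> r r24' r3; rewrite rg3 //= !(eqn_lt r24').
    * by move: pc3; clear; lia.
Qed.

(** The hypotheses describe a mask that was exact before the minimum of level [g] decreased: higher
    levels are unaffected, and a lower record survives when its key is below the new minimum. Keys
    of records increase with the level, so the survivors are the lowest ones; clearing from the top
    stops at the first survivor, and each cleared bit pays for its own step. *)
Lemma lowerP g a Q : rg a 24 = g -> g <= n ->
  (forall j, j <= n -> fd a 9 j = mu j) ->
  (forall s, 0 < s <= n -> fd a 8 s = logn 2 s) ->
  (forall s, 0 < s <= n -> fd a 7 s = (trunc_log 2 s).+1) ->
  mu g <> 0 -> (forall j, bit j (rg a 3) -> mu j <> 0) ->
  (forall j, g < j -> bit j (rg a 3) <-> isrec mu (ky a) j) ->
  (bit g (rg a 3) -> isrec mu (ky a) g) ->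
  (forall j, j < g -> isrec mu (ky a) j <-> bit j (rg a 3) /\ (ky a (mu j) < ky a (mu g))%O) ->
  (forall j j', j < j' -> j < g -> j' <> g -> bit j (rg a 3) -> mu j' <> 0 -> (ky a (mu j) < ky a (mu j'))%O) ->
  (forall t a', t + 100 * popc w (rg a' 3) <= 100 * popc w (rg a 3) + 400 ->
     fd a' = fd a -> ky a' = ky a ->
     (forall r, r < 24 -> r <> 3 -> rg a' r = rg a r) ->
     (forall j, bit j (rg a' 3) <-> isrec mu (ky a) j) -> Q t a') ->
  tri w clower a Q.
Proof.
move=> r24 gn hmu t8 t7 mg nz hi hg lo ch HQ.
have gN : g < N by apply: mu_lt.
have r24n : rg a 24 <= n by rewrite r24.
have Rn : rg a 3 <= n.
  by rewrite -ltnS; apply: leq_trans N2; apply: bits_ltn => j Nj; apply/negP => /nz; rewrite muN.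
have pN p : p < N -> 2 ^ p <= n /\ p < w.
  move=> pN; have e2 : 2 ^ p.+1 <= n.+1 by apply: leq_trans N2; rewrite leq_exp2l.
  rewrite expnS in e2; have := expn_gt0 2 p => e0; split; first by move: e0 e2; clear; lia.
  by rewrite -(ltn_exp2l _ _ (isT : 1 < 2)); move: W e0 e2; clear; lia.
have [g2n gw] := pN g gN.
rewrite /clower; stp w16; stp w16; rewrite r24 hmu //; stp w16.
apply: (@curP g) => // t c ht sm cn /=.
apply: (tri_if w16); first by dfs.
  move/clessE => /= c1; have ir : isrec mu (ky a) g by apply/(isrec_sufmin sm).
  set a1 := setr _ 26 c; stp w16.
  pose R1 := if bit g (rg a 3) then rg a 3 else rg a 3 + 2 ^ g.
  have R1b j : bit j R1 = (j == g) || bit j (rg a 3).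
    rewrite /R1; case: ifP => b; last by rewrite bit_add ?b.
    by case: eqP => [->|].
  have R1p : popc w R1 <= (popc w (rg a 3)).+1.
    by rewrite /R1; case: ifP => b; [|rewrite popc_add ?b].
  have R1n : R1 <= n + n.
    by rewrite /R1; case: ifP => _; [apply: leq_trans Rn (leq_addr _ _)|apply: leq_add].
  have st : tri w (HIf ((HV 3 >>! HV 24) %! HC 2) HSkip (HSet 3 (HV 3 +! (HC 1 <<! HV 24)))) a1
    (fun t a' => [/\ t <= 30, fd a' = fd a, ky a' = ky a, rg a' 3 = R1 & forall r, r <> 3 -> rg a' r = rg a1 r]).
    have eb : (rg a 3 %/ 2 ^ rg a 24) %% 2 = bit g (rg a 3) by rewrite r24 modn2.
    stp w16; rewrite eb /R1.
      by rewrite nat_of_bool_neq0 => b; stp w16; rewrite b.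
    move/nat_of_bool_eq0 => b; stp w16; try by rewrite r24 mul1n; alia.
    by rewrite b r24 mul1n; split=> // r r3; rewrite /= eqn_neq.
  apply: tri_conseq st => t1 a2 [ht1 fd2 ky2 r32 rg2].
  have r242 : rg a2 24 = g by rewrite rg2.
  stp w16; stp w16; try by rewrite r242 mul1n; alia.
  rewrite r242 mul1n r32; set a3 := setr _ 28 _.
  suff loop : forall T a4 Q', fd a4 = fd a -> ky a4 = ky a -> rg a4 27 = mu g -> rg a4 28 = T -> T < 2 ^ g ->
     rg a4 3 <= n + n ->
     (forall j, j < g -> bit j (rg a4 3) = bit j T) ->
     (forall j, bit j (rg a4 3) -> bit j R1) ->
     (forall j, g <= j -> bit j (rg a4 3) <-> isrec mu (ky a) j) ->
     (forall j, j < g -> isrec mu (ky a) j <-> bit j (rg a4 3) /\ (ky a (mu j) < ky a (mu g))%O) ->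
     (forall t a', t + 100 * popc w (rg a' 3) <= 100 * popc w (rg a4 3) + 100 ->
        fd a' = fd a -> ky a' = ky a -> (forall r, r < 24 -> r <> 3 -> rg a' r = rg a4 r) ->
        (forall j, bit j (rg a' 3) <-> isrec mu (ky a) j) -> Q' t a') ->
     tri w (HWhile (HV 28)
       (HSet 25 (HF 7 (HV 28) -! HC 1) ;;
        HIf (HK (HV 27) (HF 9 (HV 25)))
          (HSet 3 (HV 3 -! (HC 1 <<! HV 25)) ;; HSet 28 (HV 28 -! (HC 1 <<! HV 25)))
          (HSet 28 (HC 0)))) a4 Q'.
    apply: (loop (R1 %% 2 ^ g)); rewrite ?/a3 /= ?fd2 ?ky2 ?r32 //.
    - by rewrite rg2.
    - by rewrite ltn_pmod ?expn_gt0.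
    - by move=> j jg; rewrite bit_mod jg.
    - move=> j; rewrite leq_eqVlt R1b => /orP[/eqP <-|gj]; first by rewrite eqxx.
      by rewrite -hi //; case: eqP => // e; rewrite e ltnn in gj.
    - move=> j jg; rewrite lo // R1b; case: eqP => // e; by rewrite e ltnn in jg.
    - move=> t2 a' ht2 fd' ky' rg' hb; apply: HQ => //.
        by move: ht ht1 ht2 R1p; clear; lia.
      by move=> r r24' r3; rewrite rg' //= !(eqn_lt r24') // rg2 //= !(eqn_lt r24').
  move=> T; have [m] := ubnP T; elim: m T => // m IH T Tm a4 Q' fd4 ky4 r27 r28 Tg R4n bT b1 hi4 lo4 HQ4.
  have Tn : T <= n by apply: ltnW; apply: leq_trans Tg g2n.
  stp w16; rewrite ?r28; last first.
    move=> T0; apply: HQ4 => //; first by clear; lia.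
    move=> j; case: (ltnP j g) => jg; last exact: hi4.
    by rewrite lo4 // bT // T0 /bit div0n; split=> // -[].
  move=> T0; have T0' : 0 < T by rewrite lt0n.
  set p := trunc_log 2 T.
  have bp : bit p T by apply: bit_trunc_log.
  have pg : p < g by rewrite -(ltn_exp2l _ _ (isT : 1 < 2)); apply: leq_ltn_trans Tg; apply: bit_le.
  have bp4 : bit p (rg a4 3) by rewrite bT.
  have [p2n pw] := pN p (ltn_trans pg gN).
  have pn : p <= n by apply: leq_trans (ltnW pg) gn.
  have e7 : fd a4 7 (rg a4 28) = p.+1 by rewrite r28 fd4 t7 // T0'.
  have r28n : rg a4 28 <= n by rewrite r28.
  have mp : mu p <> 0.
    by apply: nz; move: (b1 p bp4); rewrite R1b; case: eqP => // e; rewrite e ltnn in pg.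
  stp w16; stp w16; try by rewrite e7; alia.
  rewrite e7 subn1 [p.+1.-1]/=; stp w16.
    rewrite nat_of_bool_neq0 r27 fd4 ky4 hmu // => le.
    have pR : 2 ^ p <= rg a4 3 by apply: bit_le.
    have pT : 2 ^ p <= T by apply: bit_le.
    stp w16; stp w16; try by rewrite /= mul1n; alia.
    stp w16; try by rewrite /= mul1n r28; alia.
    rewrite !mul1n; apply: (IH (T - 2 ^ p)) => //=.
    - by move: Tm pT; have := expn_gt0 2 p; clear; lia.
    - by rewrite r28.
    - exact: leq_ltn_trans (leq_subr _ _) Tg.
    - exact: leq_trans (leq_subr _ _) R4n.
    - by move=> j jg; rewrite !bit_sub // bT.
    - by move=> j; rewrite bit_sub // => /andP[_ /b1].
    - move=> j gj; rewrite bit_sub //; case: eqP => [e|_] /=; last exact: hi4.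
      by rewrite e leqNgt pg in gj.
    - move=> j jg; rewrite bit_sub // lo4 //; case: eqP => [->|_] //=.
      by split=> // -[_]; rewrite ltNge le.
    - move=> t2 a' ht2 fd' ky' rg' hb; apply: HQ4 => //.
        by move: ht2; have := popc_sub pw bp4; clear; lia.
      by move=> r r24' r3; rewrite rg' //= (eqn_neq r3) !(eqn_lt r24').
  move/nat_of_bool_eq0/negbT; rewrite r27 fd4 ky4 hmu // -ltNge => lt.
  stp w16; stp w16 => // _; apply: HQ4 => //=.
  - by clear; lia.
  - by move=> r r24' r3; rewrite !(eqn_lt r24').
  - move=> j; case: (ltnP j g) => jg; last exact: hi4.
    rewrite lo4 //; split=> [bj|[]//]; split=> //.
    case: (ltngtP j p) => [jp|pj|->//]; last by move: bj; rewrite bT // bit_gt_trunc_log.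
    apply: lt_trans lt; apply: ch => //; first by move=> e; rewrite e ltnn in pg.
    by move: (b1 j bj); rewrite R1b; case: eqP => // e; rewrite e ltnn in jg.
(* Level [g] is no record: a higher level has a minimum [c] whose key is not larger. The lower
   records were already below [c], hence below the minimum of [g], and the mask is still exact. *)
move=> c0; have nc : ~ (c = 0 \/ (ky a (mu g) < ky a c)%O).
  set a1 := setr _ 26 c in c0; move=> c1; suff : ev a1 (cless 27) != 0 by rewrite c0.
  by apply/clessE.
have nir : ~ isrec mu (ky a) g by move/(isrec_sufmin sm) => -[].
stp w16; apply: HQ => //=.
- by move: ht; clear; lia.
- by move=> r r24' r3; rewrite !(eqn_lt r24').
move=> j; case: (ltngtP j g) => [jg|gj|->]; [|exact: hi|by split=> // /hg].
rewrite lo //; split=> [bj|[]//]; split=> //.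
case: sm => [[c00 _]|[c1 [j1 j1g mc] _]]; first by case: nc; left.
apply: lt_le_trans (_ : (ky a (mu j) < ky a c)%O) _.
  by rewrite -mc; apply: ch => //; [apply: ltn_trans jg j1g|move=> e; rewrite e ltnn in j1g|rewrite mc].
by rewrite leNgt; apply/negP => lt; apply: nc; right.
Qed.

End Procedures.

(** * Structure of the queue *)

Section Structure.
Variables (disp : Order.disp_t) (K : orderType disp).
Implicit Types (F : nat -> nat -> nat) (k : nat -> K) (lv : nat -> seq htree) (P : seq nat).

Definition mu lv (j : nat) : nat := head 0 [seq h.1 | h <- lv j].

(* The elements of [P], most recent first, are doubly linked through 0. *)
Definition dll F P : Prop :=
  fcycle (F 5) (0 :: P) /\ {in 0 :: P, forall x, F 6 (F 5 x) = x}.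

(** Positions increase with recency and alone determine the level. The bound on [M] keeps positions
    and masks among the indices of records. [srk0] lets a null child be read as a tree of rank 0,
    and [sslot] leaves the slots empty for the next consolidation. *)
Record str (n M : nat) P F k lv : Prop := Str {
  sM : 0 < M <= n.+1;
  sP : sorted gtn P;
  sPn : {in P, forall x, 0 < x <= n};
  sdll : dll F P;
  spos : {in P &, forall x y, x < y -> F 4 x < F 4 y};
  slev : forall j x, x \in fnodes (lv j) -> x \in P /\ inlev M (F 4 x) j;
  scov : forall x, x \in P -> exists j, x \in fnodes (lv j);
  suniq : forall j, uniq (fnodes (lv j));
  slrep : forall j, j <= n -> lrep F k (lv j) (F 9 j);
  scnt : forall j, j <= n -> F 10 j = size (fnodes (lv j));
  sbl : forall s, 0 < s <= n -> F 7 s = (trunc_log 2 s).+1;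
  slsb : forall s, 0 < s <= n -> F 8 s = logn 2 s;
  stab0 : F 7 0 = 0 /\ F 8 0 = 0;
  sslot : forall r, 0 < r <= n -> F 11 r = 0;
  srk0 : F 3 0 = 0
}.

(** * Counting elements by position and level *)

Section Facts.
Variables (n M : nat) (P : seq nat) (F : nat -> nat -> nat) (k : nat -> K) (lv : nat -> seq htree).
Hypothesis S : str n M P F k lv.

Lemma str_uniqP : uniq P.
Proof. apply: sorted_uniq (sP S) => [x y z|x]; rewrite /= ?ltnn //; lia. Qed.

Definition top := trunc_log 2 M.

Lemma top_le : 2 ^ top <= n.+1.
Proof.
case/andP: (sM S) => M0 Mn; apply: leq_trans Mn; exact: trunc_logP.
Qed.

Lemma lv_top j : top <= j -> lv j = [::].
Proof.
move=> tj; case E: (lv j) => [|h s] //.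
have : h.1 \in fnodes (lv j) by rewrite E fnodes_cons inE eqxx.
case/(slev S) => _ /inlev_gt; rewrite leqNgt => /negP[].
apply: leq_trans (@trunc_log_ltn 2 M isT) _; by rewrite leq_exp2l.
Qed.

Lemma mu_top j : top <= j -> mu lv j = 0.
Proof. by move=> h; rewrite /mu lv_top. Qed.

Lemma top_n : top <= n.
Proof. by rewrite -ltnS; apply: leq_trans top_le; apply: ltn_expl. Qed.

Lemma node_top j x : x \in fnodes (lv j) -> j < top.
Proof. by move=> xj; rewrite ltnNge; apply/negP => /lv_top e; rewrite e in xj. Qed.

Lemma node_n j x : x \in fnodes (lv j) -> 0 < x <= n.
Proof. by case/(slev S) => /(sPn S). Qed.

Lemma node_le j x : x \in fnodes (lv j) -> j <= n.
Proof. by move/node_top => h; apply: leq_trans (ltnW h) top_n. Qed.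

Lemma node_disj i j x : x \in fnodes (lv i) -> x \in fnodes (lv j) -> i = j.
Proof. by case/(slev S) => _ a /(slev S)[_ b]; apply: inlev_uniq a b. Qed.

Lemma mu_n j : mu lv j <= n.
Proof.
rewrite /mu; case E: (lv j) => [|h s] //=.
have : h.1 \in fnodes (lv j) by rewrite E fnodes_cons inE eqxx.
by case/node_n/andP.
Qed.

Lemma mu_mn j : j <= n -> F 9 j = mu lv j.
Proof. by case/(slrep S) => ->. Qed.

Lemma mu_node j : mu lv j <> 0 -> mu lv j \in fnodes (lv j).
Proof. by rewrite /mu; case: (lv j) => //= h s _; rewrite fnodes_cons inE eqxx. Qed.

Lemma mu_nil j : mu lv j = 0 -> lv j = [::].
Proof.
rewrite /mu; case E: (lv j) => [|h s] //= h0.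
have : h.1 \in fnodes (lv j) by rewrite E fnodes_cons inE eqxx.
by case/node_n/andP; rewrite h0.
Qed.

(** Positions are distinct, and those of a level form an interval whose length is bounded by
    [CS]. *)
Lemma lev_size j : size (fnodes (lv j)) <= 2 ^ j.+1.
Proof.
have [le1 le2] := andP (CS M j).
have inj : {in fnodes (lv j) &, injective (F 4)}.
  move=> x y /(slev S)[xP _] /(slev S)[yP _] e; case: (ltngtP x y) => // h.
    by have := spos S xP yP h; rewrite e ltnn.
  by have := spos S yP xP h; rewrite e ltnn.
have u : uniq [seq F 4 x | x <- fnodes (lv j)] by rewrite map_inj_in_uniq ?(suniq S).
rewrite -(size_map (F 4)); apply: leq_trans (_ : _ <= size (iota (C M j.+1) (2 ^ j.+1))) _; last first.
  by rewrite size_iota.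
apply: uniq_leq_size => // p /mapP[x /(slev S)[_ /andP[a b]] ->].
by rewrite mem_iota a /=; apply: leq_trans b le2.
Qed.

Lemma lev_perm j : perm_eq [seq y <- P | inlev M (F 4 y) j] (fnodes (lv j)).
Proof.
apply: uniq_perm; [exact: filter_uniq str_uniqP|exact: (suniq S j)|] => x.
rewrite mem_filter; apply/andP/idP => [[a xP]|/(slev S)[]//].
have [i xi] := scov S xP; have [_ b] := slev S xi.
by rewrite (inlev_uniq a b).
Qed.

Lemma pos_lt x : x \in P -> F 4 x < M.-1.
Proof.
case/(scov S) => j /(slev S)[_ /andP[_ h]]; apply: leq_trans h _.
by rewrite -C0; apply: C_anti.
Qed.

(** The levels below [i] occupy exactly the positions from [C M i] on; adding the stored sizes of
    levels thus counts recent elements, one addition per level. *)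
Lemma cnt_low i : \sum_(j < i) size (fnodes (lv j)) = count (fun y => C M i <= F 4 y) P.
Proof.
elim: i => [|i IH].
  rewrite big_ord0; apply/esym/eqP; rewrite -leqn0 leqNgt -has_count -all_predC.
  by apply/allP => x /pos_lt h /=; rewrite C0 -ltnNge.
rewrite big_ord_recr /= IH -(perm_size (lev_perm i)) size_filter.
have [le1 le2] := andP (CS M i).
rewrite -count_predUI -[RHS]addn0; congr (_ + _).
  by apply: eq_count => y /=; rewrite /inlev; move: le1; clear; lia.
apply/eqP; rewrite -leqn0 leqNgt -has_count -all_predC.
by apply/allP => y _ /=; rewrite /inlev; clear; lia.
Qed.

(** Positions are distinct and below [M.-1]; the number of free positions in [phi] is therefore an
    exact difference. *)
Lemma size_P : size P <= M.-1.
Proof.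
have inj : {in P &, injective (F 4)}.
  move=> x y xP yP e; case: (ltngtP x y) => // h.
    by have := spos S xP yP h; rewrite e ltnn.
  by have := spos S yP xP h; rewrite e ltnn.
rewrite -(size_map (F 4)) -(size_iota 0 M.-1); apply: uniq_leq_size.
  by rewrite map_inj_in_uniq // str_uniqP.
by move=> p /mapP[x xP ->]; rewrite mem_iota /= add0n pos_lt.
Qed.

Lemma other_level F' k' g j : j <> g -> j <= n ->
  (forall f i, f < 4 -> i \notin fnodes (lv g) -> i <> 0 -> F' f i = F f i) ->
  (F' 9 j = F 9 j) -> {in P, forall x, x \notin fnodes (lv g) -> k' x = k x} ->
  lrep F' k' (lv j) (F' 9 j).
Proof.
move=> jg jn eF e9 ek; rewrite e9; apply: lrep_ext (slrep S jn).
- move=> f x f4 xj; apply: eF => //.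
    by apply/negP => xg; apply: jg; apply: node_disj xj xg.
  by have /andP[x0 _] := node_n xj; move=> e; rewrite e in x0.
- exact: suniq S j.
- move=> x xj; rewrite ek //; first by case: (slev S xj).
  by apply/negP => xg; apply: jg; apply: node_disj xj xg.
Qed.

End Facts.

(* The unit is a machine step; [M.-1 - size P] positions are free. *)
Definition phi (w M R : nat) P lv : nat :=
  1000 * (\sum_(j < w) fpot (lv j)) + 100 * popc w R + 400 * popc w M
  + 100 * 100 * (M.-1 - size P).

Definition updl lv (g : nat) (s : seq htree) : nat -> seq htree :=
  fun j => if j == g then s else lv j.

Lemma sum_updl (w g : nat) lv s : g < w ->
  \sum_(j < w) fpot (updl lv g s j) + fpot (lv g) = \sum_(j < w) fpot (lv j) + fpot s.
Proof.
move=> gw; rewrite (bigD1 (Ordinal gw)) //= [in RHS](bigD1 (Ordinal gw)) //=.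
rewrite {1}/updl eqxx; rewrite (eq_bigr (fun j : 'I_w => fpot (lv j))); first by clear; lia.
by move=> j; rewrite -val_eqE /= /updl => /negbTE ->.
Qed.

Lemma fcycle_rem (f f' : nat -> nat) s1 x s2 z :
  uniq (z :: s1 ++ x :: s2) -> fcycle f (z :: s1 ++ x :: s2) ->
  f' (last z s1) = f x -> (forall y, y <> last z s1 -> f' y = f y) ->
  fcycle f' (z :: s1 ++ s2).
Proof.
move=> u0; have u : uniq ((z :: s1) ++ x :: s2) := u0.
rewrite /= !rcons_cat /= !cat_path /= => /and3P[p1 /eqP e p2] e1 e2.
have ul : last z s1 \notin x :: s2.
  have : last z s1 \in z :: s1 by exact: mem_last.
  move: u; rewrite cat_uniq => /and3P[_ /hasPn X _] h.
  by apply/negP => /X; rewrite h.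
apply/andP; split.
  have X y : y \in belast z s1 -> f' y = f y.
    move=> yb; apply: e2 => ey.
    have : uniq (z :: s1) by move: u; rewrite cat_uniq => /andP[].
    by rewrite lastI rcons_uniq -ey yb.
  elim: s1 z p1 X {u0 u e e1 e2 ul p2} => //= y s IH z /andP[/eqP e p] X.
  rewrite X ?inE ?eqxx // e eqxx; apply: IH p _ => y' yb; apply: X; by rewrite inE yb orbT.
have X : {in s2, f' =1 f} by move=> y ys; apply: e2 => ey; move: ul; rewrite -ey inE ys orbT.
apply: path_switch X _; last exact: p2.
by rewrite e1.
Qed.

Lemma isrec_ext (m : nat -> nat) k k' j :
  (forall j, m j <> 0 -> k' (m j) = k (m j)) -> isrec m k' j <-> isrec m k j.
Proof.
move=> e; split=> -[h1 h2]; split=> // j' jj' nz; have := h2 j' jj' nz; by rewrite !e.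
Qed.

Lemma isrec_hi (m m' : nat -> nat) k j :
  (forall j', j <= j' -> m' j' = m j') -> isrec m' k j <-> isrec m k j.
Proof.
move=> e; rewrite /isrec e //; split=> -[h1 h2]; split=> // j' jj' nz.
  by have := h2 j' jj'; rewrite e ?(ltnW jj') // => /(_ nz).
by rewrite e ?(ltnW jj') //; apply: h2 => //; rewrite -e // ltnW.
Qed.

Lemma spine_chain F x t p u : rep F u t p -> x \notin nodes t -> 0 < x -> chain F x p (spine t).
Proof.
elim: t p u => //= y l _ r IH p u [-> y0 _ _ [hl hr]]; rewrite inE mem_cat !negb_or => /and3P[xy xl xr] x0.
split=> //; have := IH _ _ hr xr x0; case: eqP => // e.
have [e0|/(rep_root hr)] := eqVneq (F 1 y) 0; first by rewrite -e e0 in x0.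
by rewrite e (negbTE xr).
Qed.

(** The jump at [x] turns the circle opened at [x], followed by [rest], into one linear
    traversal. *)
Lemma circ_chain F x la y rest : fpath (F 1) y (rcons [seq h.1 | h <- la] x) ->
  x \notin [seq h.1 | h <- la] -> chain F x (F 0 x) rest ->
  chain F x (if F 1 y == x then F 0 x else F 1 y) (la ++ rest).
Proof.
elim: la y => [|h la IH] y /=; first by rewrite andbT => ->.
case/andP=> /eqP -> p; rewrite inE negb_or => /andP[/negbTE ne ni] c.
by rewrite eq_sym ne; split=> //; apply: IH.
Qed.

Lemma spine_prerep F t p u : rep F u t p -> {in spine t, forall h, prerep F h}.
Proof.
elim: t p u => //= y l _ r IH p u [_ y0 _ _ [hl hr]] h.
by rewrite inE => /orP[/eqP -> //|]; apply: IH hr h.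
Qed.

End Structure.

(** * Extraction *)

Definition cunlink : hcmd :=
  HPut 6 (HF 5 (HV 5)) (HF 6 (HV 5)) ;;
  HPut 5 (HF 6 (HV 5)) (HF 5 (HV 5)).

Definition cnext : hcmd := HIf (HV 7 ==! HV 5) (HSet 7 (HF 0 (HV 5))) HSkip.

Definition cextract : hcmd :=
  HSet 4 (HF 8 (HV 3)) ;;
  HSet 5 (HF 9 (HV 4)) ;;
  cunlink ;;
  HPut 10 (HV 4) (HF 10 (HV 4) -! HC 1) ;;
  HSet 6 (HC 0) ;;
  HSet 7 (HF 1 (HV 5)) ;;
  cnext ;;
  cconsol ;;
  HPut 9 (HV 4) (HC 0) ;;
  HSet 20 (HV 4) ;;
  HSet 9 (HC 0) ;;
  ccollect ;;
  HSet 24 (HV 4) ;;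
  crefresh ;;
  HSet 0 (HV 5) ;;
  HKey (HC 0) (HV 5).

Section Procedures.
Variables (w n : nat) (disp : Order.disp_t) (K : orderType disp).
Hypothesis W : 256 * n.+1 <= 2 ^ w.
Let w16 := w16 W.
Implicit Types (a : ast K) (Q : nat -> ast K -> Prop).

(** Cell 0 of the key array is the channel to the client, and record 0 is no element. *)
Lemma str_key M P F (k k' : nat -> K) lv : (forall y, y <> 0 -> k' y = k y) ->
  str n M P F k lv -> str n M P F k' lv.
Proof.
move=> e S; case: (S) => *; split=> // j jn; apply: lrep_ext (slrep S jn) => //.
by move=> x /(node_n S)/andP[x0 _]; rewrite e // => e0; rewrite e0 in x0.
Qed.

Lemma unlinkP a x o nw Q : rg a 5 = x -> fd a 5 x = o -> fd a 6 x = nw ->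
  x <= n -> o <= n -> nw <= n ->
  (forall t, t <= 40 -> Q t (setf (setf a 6 o nw) 5 nw o)) -> tri w cunlink a Q.
Proof.
move=> r5 eo en xn on nn HQ; rewrite /cunlink; apply: tri_seq.
have e6 : (if x == o then nw else fd a 6 x) = nw by case: ifP.
apply: (tri_put w16); rewrite /= ?r5 ?eo ?en; try by do ?split => //; alia.
by apply: (tri_put w16); rewrite /= ?r5 ?e6 ?eo ?en; try (by do ?split => //; alia); apply: HQ.
Qed.

Lemma nextP a x Q : rg a 5 = x -> x <= n ->
  (forall t a', t <= 30 -> fd a' = fd a -> ky a' = ky a ->
     rg a' 7 = (if rg a 7 == x then fd a 0 x else rg a 7) ->
     (forall r, r <> 7 -> rg a' r = rg a r) -> Q t a') -> tri w cnext a Q.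
Proof.
move=> r5 xn HQ; rewrite /cnext; stp w16; rewrite ?nat_of_bool_neq0 r5.
  by move=> e; stp w16; apply: HQ => //=; [rewrite e r5|move=> r r7; rewrite (eqn_neq r7)].
by move/nat_of_bool_eq0 => e; stp w16; apply: HQ => //=; rewrite e.
Qed.

Lemma extractP a P lv Q :
  str n (rg a 2) P (fd a) (ky a) lv ->
  (forall j, bit j (rg a 3) <-> isrec (mu lv) (ky a) j) -> P <> [::] ->
  (forall t a' lv' x g, x \in fnodes (lv g) -> x \in P -> {in P, forall y, (ky a x <= ky a y)%O} ->
     str n (rg a 2) (rem x P) (fd a') (ky a') lv' ->
     (forall j, bit j (rg a' 3) <-> isrec (mu lv') (ky a') j) ->
     rg a' 1 = rg a 1 -> rg a' 2 = rg a 2 -> rg a' 0 = x -> ky a' 0 = ky a x ->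
     (forall y, y <> 0 -> ky a' y = ky a y) ->
     (forall j y, y \in fnodes (lv' j) -> y \in fnodes (lv j)) ->
     t + phi w (rg a 2) (rg a' 3) (rem x P) lv' <= phi w (rg a 2) (rg a 3) P lv + 1000 * 100 * g.+1 ->
     Q t a') ->
  tri w cextract a Q.
Proof.
move=> S hR P0 HQ.
have [x0 x0P] : exists x, x \in P by case: (P) P0 => // x ? _; exists x; rewrite inE eqxx.
have [j0 x0j] := scov S x0P.
have m0 : mu lv j0 <> 0 by move/(mu_nil S) => e; rewrite e in x0j.
have [R0 ir _] := rec_min (mu_top S) hR m0.
set g := logn 2 (rg a 3) in ir; have mg : mu lv g <> 0 by case: ir.
have gt : g < top (rg a 2) by apply: (node_top S) (mu_node mg).
have gn : g <= n by apply: leq_trans (ltnW gt) (top_n S).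
have Rn : rg a 3 <= n.
  rewrite -ltnS; apply: leq_trans (top_le S); apply: (rec_bound (mu_top S) (k := ky a)) => j.
  by move/hR.
case Eg: (lv g) => [|[x l] la]; first by case: mg; rewrite /mu Eg.
have ex : mu lv g = x by rewrite /mu Eg.
have xg : x \in fnodes (lv g) by rewrite -ex; apply: mu_node.
have [xP xlev] := slev S xg.
have /andP[xp xn] := sPn S xP.
have [hm hc hrs hos hmin] := slrep S gn.
have xmin : {in P, forall y, (ky a x <= ky a y)%O}.
  move=> y yP; have [j yj] := scov S yP; have jn := node_le S yj.
  have mj : mu lv j <> 0 by move/(mu_nil S) => e; rewrite e in yj.
  have [_ _ le] := rec_min (mu_top S) hR mj; apply: le_trans (_ : (ky a (mu lv j) <= _)%O).
    by rewrite -ex.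
  by rewrite -(mu_mn S jn); apply: lrep_min (slrep S jn) _ _.
have e8 : fd a 8 (rg a 3) = g by rewrite (slsb S) // R0.
have e9 : fd a 9 g = x by rewrite (mu_mn S gn).
have [s1 [s2 eP]] : exists s1 s2, P = s1 ++ x :: s2 by case/splitPr: xP => s1 s2; exists s1, s2.
have uP := str_uniqP S.
have eR : rem x P = s1 ++ s2.
  rewrite eP rem_filter -?eP // eP filter_cat /= eqxx /=.
  move: uP; rewrite eP cat_uniq /= => /and4P[_ /norP[x1 _] x2 _].
  by congr (_ ++ _); apply/all_filterP/allP => y ys /=; apply: contraNneq (_ : x \notin _) => [<-|]; eauto.
have uz : uniq (0 :: s1 ++ x :: s2).
  by rewrite -eP /= uP andbT; apply/negP => /(sPn S).
have [cyc inv] := sdll S; rewrite eP in cyc inv.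
set o := fd a 5 x; set nw := fd a 6 x.
have nwE : nw = last 0 s1 /\ fd a 5 (last 0 s1) = x.
  have e5 : fd a 5 (last 0 s1) = x.
    by move: cyc; rewrite /= rcons_cat cat_path /= => /and3P[_ /eqP].
  split=> //; rewrite /nw -{1}e5; apply: inv; rewrite -cat_cons mem_cat.
  by rewrite mem_last.
have nwin : nw \in 0 :: s1 ++ s2.
  by case: nwE => -> _; rewrite -cat_cons mem_cat mem_last.
have oin : o \in 0 :: s1 ++ s2.
  have : fpath (fd a 5) x (rcons s2 0).
    by move: cyc; rewrite /= rcons_cat cat_path /= => /and3P[].
  rewrite /o; case: (s2) => [|y s] /= /andP[/eqP -> _]; rewrite !inE ?eqxx //.
  by rewrite mem_cat inE eqxx !orbT.
have zP y : y \in 0 :: s1 ++ s2 -> y <= n.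
  rewrite inE mem_cat => /or3P[/eqP ->//|yi|yi].
    by have /(sPn S)/andP[] : y \in P by rewrite eP mem_cat yi.
  by have /(sPn S)/andP[] : y \in P by rewrite eP mem_cat inE yi !orbT.
have on := zP o oin; have nwn := zP nw nwin.
have xnin : x \notin 0 :: s1 ++ s2.
  by rewrite -eR inE negb_or -lt0n xp mem_rem_uniq // inE eqxx.
have nwx : nw <> x by move=> e; rewrite -e nwin in xnin.
have ox : o <> x by move=> e; rewrite -e oin in xnin.
have cn : fd a 10 g = size (fnodes (lv g)) := scnt S gn.
have c0 : 0 < fd a 10 g by rewrite cn Eg fnodes_cons.
have cgn : fd a 10 g <= n.
  rewrite cn; apply: bounded_size (suniq S g) _ _ => y /(node_n S)/andP[] //.
have r8n : fd a 8 (rg a 3) <= n by rewrite e8.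
have hx : hrep (fd a) (x, l) by apply: hrs; rewrite Eg inE eqxx.
have [_ _ hxl] := hx; simpl in hxl.
have ug := suniq S g; rewrite Eg fnodes_cons in ug.
have gP y : y \in fnodes (lv g) -> 0 < y <= n by apply: (node_n S).
have lx : fd a 0 x <= n.
  have [->//|/(rep_root hxl) h] := eqVneq (fd a 0 x) 0.
  by have /gP/andP[] : fd a 0 x \in fnodes (lv g) by rewrite Eg fnodes_cons mem_cat inE h orbT.
have xin : x \in 0 :: s1 ++ x :: s2 by rewrite inE mem_cat inE eqxx !orbT.
rewrite /cextract; stp w16; stp w16; stp w16; stp w16; rewrite e8 e9.
stp w16; apply: (@unlinkP _ x o nw) => //= tu htu.
stp w16; stp w16; stp w16; stp w16; stp w16; stp w16; stp w16.
set a1 := setr _ 7 _; set p0 := if fd a 1 x == x then fd a 0 x else fd a 1 x.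
apply: (@nextP _ x) => //= t1 a2 ht1 fd2 ky2 r72 rg2.
have fd4 f i : f < 5 -> fd a2 f i = fd a f i.
  by move=> hf; rewrite fd2 !(eqn_lt hf).
have [r52 r62 r42] : [/\ rg a2 5 = x, rg a2 6 = 0 & rg a2 4 = g] by rewrite !rg2.
have cl : fpath (fd a 1) x (rcons [seq h.1 | h <- la] x) by move: hc; rewrite /circ Eg.
have lP : perm_eq (fnodes (lv g)) (x :: fnodes (la ++ spine l)).
  by rewrite Eg fnodes_cons fnodes_cat fnodes_spine /hnodes; perml.
have ul : uniq (x :: fnodes (la ++ spine l)) by rewrite -(perm_uniq lP) (suniq S).
have nl y : y \in x :: fnodes (la ++ spine l) -> 0 < y <= n by rewrite -(perm_mem lP); apply: gP.
have xla : x \notin [seq h.1 | h <- la].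
  move: ul => /= /andP[]; rewrite fnodes_cat mem_cat negb_or => /andP[h _] _.
  by apply: contra h => /roots_sub.
have xl : x \notin nodes l.
  by move: ul => /= /andP[]; rewrite fnodes_cat fnodes_spine mem_cat negb_or => /andP[_ h] _.
have ch : chain (fd a) x p0 (la ++ spine l) by apply: circ_chain cl xla _; apply: spine_chain hxl xl xp.
have sz : (size (fnodes (la ++ spine l))).+1 <= 2 ^ g.+1.
  by apply: leq_trans (lev_size S g); rewrite (perm_size lP).
(* Fewer than [2 ^ g.+1] nodes remain in the level, so by [hrk_size] no rank exceeds [3 * g + 3];
   the constant is generous. *)
set B := 3 * g + 6.
have sB k : 2 ^ (k.-1 %/ 3) <= size (fnodes (la ++ spine l)) -> k <= B.
  move=> h; have : 2 ^ (k.-1 %/ 3) < 2 ^ g.+1 by apply: leq_ltn_trans h sz.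
  by rewrite ltn_exp2l // /B; clear; lia.
stp w16; apply: (@consolP w n _ K W (la ++ spine l) [::] a2 _ B); rewrite ?cats0 ?r52 ?r62 ?r72 //.
- by apply: chain_ext ch => [|y _]; rewrite fd4.
- by split=> // r rn; rewrite fd2 /= (sslot S).
- by rewrite fd4 // (srk0 S).
- move=> h; rewrite mem_cat => /orP[hla|hsp].
    have [h0 _ hh] : hrep (fd a) h by apply: hrs; rewrite Eg inE hla orbT.
    by apply: (@prerep_ext (fd a)) => // [f y f4 _|]; rewrite fd4 // ltnW.
  by apply: (@prerep_ext (fd a)) (spine_prerep hxl hsp) => // [f y f4 _|]; rewrite fd4 // ltnW.
- rewrite ky2 => h; rewrite mem_cat => /orP[hla|hsp].
    by apply: hos; rewrite Eg inE hla orbT.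
  have [_ hol] : hhord (ky a) (x, l) by apply: hos; rewrite Eg inE eqxx.
  exact: spine_hord hol _ hsp.
- by move=> y /nl/andP[].
- by rewrite fd4.
move=> t2 a3 S' pS' sS' fS' tS' r6n r6B rkS' rg3 ky3 sl3 hr3 ho3 fdh3 fdo3 z3.
have [r43 r53] : rg a3 4 = g /\ rg a3 5 = x by rewrite !rg3.
do 6!(stp w16).
rewrite r43; set a4 := setr _ 9 _.
have n0 : 0 \notin fnodes S'.
  by apply/negP; rewrite (perm_mem pS') => h; have := nl 0; rewrite inE h orbT => /(_ isT).
have uS' : uniq (fnodes S') by rewrite (perm_uniq pS'); case/andP: ul.
have fd34 f i : f <> 9 -> fd a4 f i = fd a3 f i by move=> f9; rewrite /= (eqn_neq f9).
have lS' : {in S', forall h, hrep (fd a4) h}.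
  move=> h hS; apply: hrep_ext (hr3 h hS) => [f y f4 _ _|].
    by rewrite fd34 // => e; rewrite e in f4.
  by have := uniq_hnodes uS' hS => /andP[].
stp w16; apply: (@collectP w n _ K W [::] S' a4 _ g) => //=.
- by rewrite ky3.
- by rewrite eqxx.
- by move=> y; rewrite (perm_mem pS') => h; apply: nl; rewrite inE h orbT.
move=> t3 a5 s' tS ps' l5 ky5 rg5 sl5 fd5 fd15 fd95.
have [r45 r55] : rg a5 4 = g /\ rg a5 5 = x by rewrite !rg5.
stp w16; stp w16; rewrite r45.
pose lv' := updl lv g s'.
have ps : perm_eq (fnodes s') (fnodes (la ++ spine l)) by apply: perm_trans (perm_fnodes ps') pS'.
have ps2 : perm_eq (fnodes (lv g)) (x :: fnodes s') by apply: perm_trans lP _; rewrite perm_cons perm_sym.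
have us' : uniq (fnodes s') by rewrite (perm_uniq ps); case/andP: ul.
have ug' : uniq (x :: fnodes s') by rewrite -(perm_uniq ps2) (suniq S).
have memg y : (y \in fnodes s') = (y != x) && (y \in fnodes (lv g)).
  rewrite (perm_mem ps2) inE; case: eqP => //= ->.
  by case/andP: ug' => /negbTE.
have sublv j y : y \in fnodes (lv' j) -> y \in fnodes (lv j).
  by rewrite /lv' /updl; case: eqP => [->|//]; rewrite memg => /andP[].
have gw : g < w.
  rewrite -(ltn_exp2l _ _ (isT : 1 < 2)); apply: leq_ltn_trans (_ : 2 ^ top (rg a 2) < _).
    by rewrite leq_exp2l // ltnW.
  by have := top_le S; move: W; clear; lia.
have fdk f i : f <> 1 -> f <> 9 -> f <> 11 -> 3 < f -> fd a5 f i = fd a1 f i.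
  by move=> f1 f9 f11 f3; rewrite fd5 //= (eqn_neq f9) fdh3 // fd2.
have fdo f i : f < 4 -> i \notin fnodes (lv g) -> i <> 0 -> fd a5 f i = fd a f i.
  move=> f4 ig i0; have ni : i \notin fnodes (la ++ spine l).
    by apply: contra ig; rewrite (perm_mem lP) inE orbC => ->.
  have f4' : f < 5 by apply: leq_trans f4 _.
  case: (f =P 1) => f1.
    rewrite f1 fd15 //= ?(perm_mem pS') // fdo3 //; [exact: fd4|by left].
  have [f9 f11] : f <> 9 /\ f <> 11 by split=> e; rewrite e in f4.
  by rewrite fd5 //= (eqn_neq f9) fdo3 //; [exact: fd4|right].
have S5 : str n (rg a 2) (rem x P) (fd a5) (ky a) lv'.
  split.
  - exact: sM S.
  - by apply: (subseq_sorted _ (rem_subseq x P) (sP S)) => y1 y2 y3 /=; clear; lia.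
  - by move=> y /mem_rem/(sPn S).
  - rewrite eR; split.
      apply: (fcycle_rem uz cyc) => [|y yn].
        by rewrite fdk //= /a1 /=; case: nwE => -> _; rewrite eqxx.
      by rewrite fdk //=; case: nwE => -> _; case: eqP.
    have u0 : uniq (0 :: s1 ++ s2).
      by rewrite -eR /= rem_uniq // andbT; apply/negP => /mem_rem/(sPn S).
    have ss y : y \in 0 :: s1 ++ s2 -> y \in 0 :: s1 ++ x :: s2.
      by rewrite !inE !mem_cat inE => /or3P[->|->|->]; rewrite ?orbT.
    move=> y yi; rewrite !fdk //=; case: (y =P nw) => [->|yn]; rewrite ?eqxx //.
    case: eqP => [e|_]; last by apply: inv; apply: ss.
    have := inv y (ss y yi); rewrite e; have := inv x xin; rewrite -/o => -> e2.
    by rewrite e2 yi in xnin.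
  - by move=> y1 y2 /mem_rem p1 /mem_rem p2 /(spos S p1 p2); rewrite !fdk.
  - move=> j y yj; have [yP yl] := slev S (sublv j y yj); split; last by rewrite fdk.
    rewrite mem_rem_uniq // inE yP andbT; move: yj; rewrite /lv' /updl; case: eqP => [ej|nj].
      by rewrite memg => /andP[].
    by move=> yj; apply/eqP => e; apply: nj; rewrite e in yj; apply: (node_disj S) yj xg.
  - move=> y; rewrite mem_rem_uniq // inE => /andP[yx /(scov S)[j yj]]; exists j.
    by rewrite /lv' /updl; case: eqP => // e; rewrite memg yx -e.
  - by move=> j; rewrite /lv' /updl; case: eqP => // _; apply: suniq S j.
  - move=> j jn; rewrite /lv' /updl; case: (j =P g) => [->|jg]; first by rewrite -ky2 -ky3.
    apply: (other_level S jg jn) => //; rewrite fd95 //= (introF eqP jg) fdh3 // fd2 /=.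
    by rewrite ?andbF.
  - move=> j jn; rewrite fdk //= /lv' /updl; case: eqP => [ej|_]; last by rewrite (scnt S).
    by rewrite cn (perm_size ps2) /= subn1.
  - by move=> s sn; rewrite fdk // -(sbl S).
  - by move=> s sn; rewrite fdk // -(slsb S).
  - by rewrite !fdk //; apply: stab0 S.
  - by [].
  - by rewrite fd5 //= z3.
have e3 : rg a5 3 = rg a 3 by rewrite rg5 //= rg3 // rg2.
have muhi j : g < j -> mu lv' j = mu lv j.
  by move=> gj; rewrite /mu /lv' /updl; case: eqP => // e; rewrite e ltnn in gj.
stp w16; apply: (@refreshP w n _ K W (mu lv') (top (rg a 2)) (mu_top S5) (top_le S5) (mu_n S5) g) => //=.
- exact: mu_mn S5.
- exact: slsb S5.
- move=> j gj; rewrite e3 ky5 /= ky3 ky2.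
  by rewrite (isrec_hi (m := mu lv)) // => j' jj'; apply: muhi; apply: leq_trans gj jj'.
move=> t4 a6 ht4 fd6 ky6 rg6; rewrite e3 => pc6 hR6.
have [r06 r56] : rg a6 0 = rg a5 0 /\ rg a6 5 = x by rewrite !rg6.
have kE : ky a6 = ky a by rewrite ky6 ky5 /= ky3 ky2.
do 3!(stp w16); rewrite r56; set a7 := setk _ 0 _.
have k7 y : y <> 0 -> ky a7 y = ky a y by move=> y0; rewrite /= kE; case: eqP.
apply: (HQ _ a7 lv' x g) => //=.
- by rewrite fd6; apply: str_key S5.
- move=> j; rewrite (hR6 j) ky5 /= ky3 ky2.
  by apply: iff_sym; apply: isrec_ext => i i0; apply: k7.
- by rewrite rg6 // rg5 //= rg3 // rg2.
- by rewrite rg6 // rg5 //= rg3 // rg2.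
- by rewrite kE.
(* The balance, in units of 1000 steps: every visited half tree that is linked away frees a unit,
   which covers its visit. What is left is [6 * rk l] for the spine, at most [B] remaining half
   trees of distinct ranks, and the collection and the refresh, all linear in [g]. *)
have := sum_updl lv s' gw; rewrite -/lv' (perm_fpot ps') Eg fpot_cons /pot /=.
have := spine_pot l; have := fpot_size la; have := size_P S.
have : rk l <= 3 * g + 5.
  have := rk_size l; have : (size (nodes l)).+1 <= 2 ^ g.+1.
    by apply: leq_trans sz; rewrite ltnS fnodes_cat size_cat fnodes_spine leq_addl.
  move=> h1 h2; have := leq_trans h2 h1; rewrite leq_exp2l //; clear; lia.
have : size S' <= B.
  have [_ b2 _] := sl3; rewrite -(size_map hrk); apply: bounded_size b2 _ _ => r /mapP[h hS ->] //.
  by apply: leq_trans r6B; apply: rkS'.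
have : 0 < size P by rewrite eP size_cat /= addnS.
rewrite /phi (size_rem xP); move: fS' tS' tS r6B pc6 ht4 htu ht1.
rewrite fpot_cat !size_cat /= !muln0 /B; clear.
set q1 := \sum_(j < w) _; set q2 := \sum_(j < w) _.
move: (popc w (rg a6 3)) (popc w (rg a 3)) (popc w (rg a 2)) (fpot S') (fpot la) (fpot (spine l)) => *.
lia.
Qed.

End Procedures.

(** * Decrease of a key *)

Definition clevel : hcmd :=
  HSet 6 (HF 7 (HV 2 -! HC 1 -! HF 4 (HV 5)) -! HC 1) ;;
  HIf (HF 4 (HV 5) +! (HC 1 <<! HV 6) <! ((HV 2 >>! HV 6) <<! HV 6))
    (HSet 4 (HV 6)) (HSet 4 (HV 6 -! HC 1)).

Definition clift : hcmd :=
  HSet 7 (HF 2 (HV 5)) ;;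
  HIf (HV 7)
    (ccut ;; HSet 20 (HV 4) ;; HSet 21 (HV 5) ;; cmeld)
    (HIf (HK (HF 9 (HV 4)) (HV 5)) HSkip (HPut 9 (HV 4) (HV 5))).

Definition cdecrease : hcmd :=
  HSet 5 (HV 0) ;;
  HKey (HV 5) (HC 0) ;;
  clevel ;;
  clift ;;
  HSet 24 (HV 4) ;;
  clower.

Section Procedures.
Variables (w n : nat) (disp : Order.disp_t) (K : orderType disp).
Hypothesis W : 256 * n.+1 <= 2 ^ w.
Let w16 := w16 W.
Implicit Types (a : ast K) (Q : nat -> ast K -> Prop).

Lemma levelP M a x j Q : rg a 2 = M -> rg a 5 = x -> 0 < M <= n.+1 -> x <= n ->
  inlev M (fd a 4 x) j -> (forall s, 0 < s <= n -> fd a 7 s = (trunc_log 2 s).+1) ->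
  (forall t a', t <= 60 -> fd a' = fd a -> ky a' = ky a -> rg a' 4 = j ->
     (forall r, r <> 4 -> r <> 6 -> rg a' r = rg a r) -> Q t a') ->
  tri w clevel a Q.
Proof.
move=> r2 r5 Mn xn il tab HQ; have [] := find_level il; set m := trunc_log 2 _ => d0 d1 ej.
have pM : fd a 4 x < M.-1 by move: d0; clear; lia.
have e7 : fd a 7 (M - 1 - fd a 4 x) = m.+1 by rewrite subn1 tab //; move: d0 Mn; clear; lia.
have tr : M %/ 2 ^ m * 2 ^ m <= M by apply: leq_divM.
rewrite /clevel; apply: tri_seq; apply: (tri_set w16).
  by rewrite /= r2 r5 e7; do ?split=> //; alia.
rewrite /= r2 r5 e7 subn1 /=.
apply: (tri_if w16); rewrite /= r5 r2 ?nat_of_bool_neq0.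
- by do ?split=> //; alia.
- rewrite mul1n => h; stp w16; apply: HQ => //=; first by rewrite ej h.
  by move=> r r4 r6; rewrite (eqn_neq r4) (eqn_neq r6).
rewrite mul1n => /nat_of_bool_eq0 h; have m0 : 0 < m.
  rewrite lt0n; apply: contraFN h => /eqP ->; rewrite expn0 divn1 muln1.
  by move: pM; clear; lia.
stp w16; rewrite subn1; apply: HQ => //=; first by rewrite ej h.
by move=> r r4 r6; rewrite (eqn_neq r4) (eqn_neq r6).
Qed.

Lemma hhord_lower (k k' : nat -> K) x l : hhord k (x, l) -> x \notin nodes l ->
  (forall y, y <> x -> k' y = k y) -> (k' x <= k x)%O -> hhord k' (x, l).
Proof.
move=> [ho1 ho2] xl ek kx; have ne y : y \in nodes l -> k' y = k y.
  by move=> yl; apply: ek => e; rewrite -e yl in xl.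
split=> [y yl|]; last by apply: hord_ext ho2 => y yl; rewrite ne.
by rewrite [in leRHS]ne //; apply: le_trans kx _; apply: ho1.
Qed.

(** The structure is known for the old keys [k], while memory already holds the decreased key. Heap
    order can fail only above [x], and it is restored by making [x] a root. *)
Lemma liftP M P lv k a x g Q :
  str n M P (fd a) k lv -> x \in fnodes (lv g) -> rg a 5 = x -> rg a 4 = g ->
  (forall y, y <> x -> ky a y = k y) -> (ky a x <= k x)%O ->
  (forall t a' s, perm_eq (fnodes s) (fnodes (lv g)) ->
     t + 1000 * fpot s <= 1000 * fpot (lv g) + 60 * 100 ->
     lrep (fd a') (ky a) s (fd a' 9 g) -> ky a' = ky a ->
     (forall r, r < 7 -> rg a' r = rg a r) -> fd a' 3 0 = 0 ->
     (forall f i, 3 < f -> f <> 9 -> fd a' f i = fd a f i) ->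
     (forall i, i <> g -> fd a' 9 i = fd a 9 i) ->
     (forall f i, f < 4 -> i \notin fnodes (lv g) -> i <> 0 -> fd a' f i = fd a f i) ->
     Q t a') ->
  tri w clift a Q.
Proof.
move=> S xg r5 r4 ek kx HQ; have gn := node_le S xg.
have /andP[x0 xn] := node_n S xg; have ug := suniq S g.
have [hm hc hr ho hmi] := slrep S gn.
have nb y : y \in fnodes (lv g) -> 0 < y <= n by apply: (node_n S).
have u9 : fd a 9 g <= n by rewrite (mu_mn S gn) (mu_n S).
have [h hs xh] := flatten_mapP xg; have [h0 h2 hrh] := hr h hs.
have uh := uniq_hnodes ug hs.
have e2 : fd a 2 x <= n.
  move: xh; rewrite inE => /orP[/eqP ->|xl]; first by rewrite h2.
  have [c [l [r e]]] := zipper xl; move: hrh; rewrite e => /rep_plug[u [q [cr /= [_ _ -> _ _]]]].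
  have [uin _] := crep_up h0 h2 cr.
  have /nb/andP[] // : u \in fnodes (lv g).
  apply: (hnodes_sub hs); move: uin; rewrite !inE => /orP[->//|ui].
  by rewrite e (perm_mem (nodes_plug _ _)) mem_cat ui !orbT.
have [sA [sB es]] : exists sA sB : seq htree, lv g = sA ++ h :: sB.
  by case/splitPr: hs => sA sB; exists sA, sB.
rewrite /clift; stp w16; stp w16; stp w16.
  rewrite r5 => up; have xl : x \in nodes h.2.
    by move: xh; rewrite inE => /orP[/eqP e|//]; rewrite e h2 in up.
  case: h => ro l0 /= in hs xh h0 h2 hrh uh es xl *.
  have xro : x <> ro by move=> e; case/andP: uh; rewrite -e xl.
  stp w16; apply: (@cutP w n _ K W x ro l0) => //=.
  - by rewrite (srk0 S).
  - by move=> y /(hnodes_sub hs)/nb/andP[].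
  move=> t1 a1 c l r el ht1 ky1 rg1 fdh1 fdo1 hrr hrx e1x.
  do 4!(stp w16); set a2 := setr _ 21 _.
  pose s1 := sA ++ (ro, plug c r) :: sB; pose s2 : seq htree := [:: (x, l)].
  have pn : perm_eq (nodes l0) (x :: nodes l ++ nodes (plug c r)).
    rewrite el; apply: perm_trans (nodes_plug _ _) _.
    have := nodes_plug c r => /permP X; apply/permP => p; have := X p.
    by rewrite /= ?count_cat /= ?count_cat; clear; lia.
  have pp : perm_eq (fnodes (s1 ++ s2)) (fnodes (lv g)).
    rewrite es /s1 /s2 !fnodes_cat !fnodes_cons; move/permP: pn => X; apply/permP => p.
    by have := X p; rewrite /= ?count_cat /= ?count_cat /= ?count_cat; clear; lia.
  have rE : [seq h.1 | h <- s1] = [seq h.1 | h <- lv g] by rewrite es /s1 !map_cat.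
  have inner y : y \in nodes l0 -> y \notin [seq h.1 | h <- lv g].
    by move=> yl; apply: (inner_not_root ug hs).
  have u12 : uniq (fnodes (s1 ++ s2)) by rewrite (perm_uniq pp).
  have ui : uniq (x :: nodes l ++ nodes (plug c r)) by rewrite -(perm_uniq pn); case/andP: uh.
  have kroot y : y \in [seq h.1 | h <- lv g] -> ky a y = k y.
    by move=> yr; apply: ek => e; move: (inner x xl); rewrite -e yr.
  have lr1 : lrep (fd a1) (ky a1) s1 (fd a1 9 g).
    rewrite fdh1 // ky1; split; rewrite ?rE //.
    - apply: (circ_ext (F := fd a)); last by rewrite /circ rE.
      rewrite rE => y yr; apply: fdo1; [|by left|by left].
      by apply/negP => yl; move: (inner y yl); rewrite yr.
    - move=> h'; rewrite /s1 mem_cat inE => hh; case: (h' =P (ro, plug c r)) => [-> //|ne].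
      have hAB : h' \in sA ++ sB by move: hh; rewrite mem_cat (introF eqP ne).
      have hg : h' \in lv g by rewrite es; move: hAB; rewrite !mem_cat inE => /orP[->|->]; rewrite ?orbT.
      have dj y : y \in hnodes h' -> y \notin ro :: nodes l0.
        move=> yh; apply/negP => yi; have yAB : y \in fnodes (sA ++ sB) by apply: hnodes_sub hAB _ yh.
        have : uniq ((ro :: nodes l0) ++ fnodes (sA ++ sB)).
          by rewrite -(perm_uniq (s1 := fnodes (lv g))) // es !fnodes_cat fnodes_cons /hnodes /=; perml.
        by rewrite cat_uniq => /and3P[_ /hasPn/(_ y yAB)]; rewrite yi.
      apply: hrep_ext (hr h' hg) => [f y f4 yh _|]; last by case/andP: (uniq_hnodes ug hg).
      have := dj y yh; rewrite inE negb_or => /andP[/eqP yro yl]; apply: fdo1 => //; first by right.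
      by right=> e; have /nb := hnodes_sub hg yh; rewrite e.
    - move=> h'; rewrite /s1 mem_cat inE => hh; case: (h' =P (ro, plug c r)) => [->|ne].
        have [o1 o2] := ho _ hs; have nx : x \notin ro :: nodes (plug c r).
          rewrite inE negb_or; apply/andP; split; first exact/eqP.
          by case/andP: ui; rewrite mem_cat negb_or => /andP[].
        apply: (@hhord_ext _ _ k) => [y yi|].
          by apply/esym/ek => e; rewrite -e yi in nx.
        split=> /= [y yi|]; first by apply: o1; rewrite /= (perm_mem pn) inE mem_cat yi !orbT.
        move: o2; rewrite /= el => o2; apply: (hord_plug _ _ o2).
          by move=> y yr; rewrite /= inE mem_cat yr !orbT.
        by move: (hord_plugl o2) => /= [].
      have hAB : h' \in sA ++ sB by move: hh; rewrite mem_cat (introF eqP ne).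
      have hg : h' \in lv g by rewrite es; move: hAB; rewrite !mem_cat inE => /orP[->|->]; rewrite ?orbT.
      apply: hhord_ext (ho h' hg) => y yh; apply/esym/ek => e.
      have yAB : y \in fnodes (sA ++ sB) by apply: hnodes_sub hAB _ yh.
      have : uniq ((ro :: nodes l0) ++ fnodes (sA ++ sB)).
        by rewrite -(perm_uniq (s1 := fnodes (lv g))) // es !fnodes_cat fnodes_cons /hnodes /=; perml.
      by rewrite cat_uniq => /and3P[_ /hasPn/(_ y yAB)]; rewrite e inE xl orbT.
    - move=> y yr; rewrite !kroot //; first exact: hmi.
      by rewrite hm es map_cat; case: (sA) => [|? ?] /=; rewrite inE eqxx.
  have lr2 : lrep (fd a1) (ky a1) s2 x.
    rewrite ky1; split=> //.
    - by rewrite /circ /= e1x eqxx.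
    - by move=> h'; rewrite inE => /eqP ->.
    - move=> h'; rewrite inE => /eqP ->.
      have [_ o2] := ho _ hs; move: o2; rewrite /= el => /hord_plugl /= [o3 o4 _].
      apply: (@hhord_lower k) => //.
      by case/andP: ui; rewrite mem_cat negb_or => /andP[].
    - by move=> y; rewrite inE => /eqP ->.
  apply: (@meldP w n _ K W a2 s1 s2 g x) => //=; rewrite ?rg1 //.
    by move=> y; rewrite (perm_mem pp) => /nb/andP[].
  move=> t2 a3 s ht2 ky3 rg3 fd3 fd13 fd93 ps lr3; rewrite /= in rg3 fd3 fd13 fd93 ky3 lr3.
  apply: (HQ _ _ s) => //=.
  - exact: perm_trans (perm_fnodes ps) pp.
  (* The new root adds 5 units, that is 5000 of the allowed 6000; the corrected ranks are paid for
     by [cut_dsum]. *)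
  - rewrite (perm_fpot ps) es /s1 /s2 !fpot_cat !fpot_cons /pot /= el.
    have := cut_dsum c x l r; move: ht1 ht2; clear; rewrite /fpot /=.
    move: (sumn _) (sumn _) (steps _ _ _) (dsum (plug c r)) (dsum (plug c (T x l r))) (dsum l) => *.
    lia.
  - by rewrite ky1 in lr3.
  - by rewrite ky3 ky1.
  - move=> q q7; rewrite rg3; last by apply: leq_trans q7 _.
    by rewrite (eqn_lt q7) // (eqn_lt q7) // rg1 //= (eqn_lt q7).
  - rewrite fd3 // fdo1 ?(srk0 S) //; [|by left|by left].
    by apply/negP => h; have := nb 0; rewrite es fnodes_cat fnodes_cons mem_cat inE mem_cat /= h !orbT => /(_ isT).
  - by move=> f i f3 f9; rewrite fd3 // ?fdh1 // => e; rewrite e in f3.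
  - by move=> i ig; rewrite fd93 // fdh1.
  - move=> f i f4 ig i0.
    have il : i \notin nodes l0.
      by apply: contra ig => il; apply: (hnodes_sub hs); rewrite inE il orbT.
    have iro : i <> ro by move=> e; case/negP: ig; apply: (hnodes_sub hs); rewrite inE e eqxx.
    have fi : fd a1 f i = fd a f i by apply: fdo1 => //; right.
    case: (f =P 1) => f1; last by rewrite fd3 // => e; rewrite e in f4.
    rewrite -fi f1 fd13 //; apply: contra ig => /roots_sub.
    by rewrite (perm_mem pp).
rewrite r5 => up; have xr : x = h.1.
  move: xh; rewrite inE => /orP[/eqP //|/(hrep_up (hr h hs))].
  by rewrite up.
case: h => ro l0 /= in hs xh h0 h2 hrh uh es xr *; rewrite -xr in hs es uh * => {ro xh h0 h2 hrh xr}.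
have hord' h' : h' \in lv g -> hhord (ky a) h'.
  move=> hg; case: (h' =P (x, l0)) => [->|ne].
    by apply: (@hhord_lower k) => //; [exact: ho|case/andP: uh].
  apply: hhord_ext (ho h' hg) => y yh; apply/esym/ek => e.
  have hAB : h' \in sA ++ sB by move: hg; rewrite es !mem_cat inE (introF eqP ne).
  have yAB : y \in fnodes (sA ++ sB) by apply: hnodes_sub hAB _ yh.
  have : uniq ((x :: nodes l0) ++ fnodes (sA ++ sB)).
    by rewrite -(perm_uniq (s1 := fnodes (lv g))) // es !fnodes_cat fnodes_cons /hnodes /=; perml.
  by rewrite cat_uniq => /and3P[_ /hasPn/(_ y yAB)]; rewrite e inE eqxx.
have kle y : (ky a y <= k y)%O by case: (y =P x) => [->//|/ek ->].
stp w16; rewrite ?r5 ?r4 ?nat_of_bool_neq0.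
  move=> le; stp w16; apply: (HQ _ _ (lv g)) => //=.
  - by move: (fpot _); clear; lia.
  - split=> // y yr; case: (y =P x) => [->//|yx].
    by apply: le_trans (kle _) _; rewrite (ek y yx); apply: hmi.
  - by move=> r r7; rewrite (eqn_lt r7).
  - exact: srk0 S.
move/nat_of_bool_eq0/negbT; rewrite -ltNge => lt.
(* The circle is the same, rotated so that its list begins at the new minimum. *)
stp w16; rewrite r5 r4; apply: (HQ _ _ ((x, l0) :: sB ++ sA)) => //=.
- by rewrite es fnodes_cat !fnodes_cons fnodes_cat; perml.
- by rewrite es fpot_cons !fpot_cat fpot_cons; move: (fpot _) (fpot _) (pot _); clear; lia.
- have pr : perm_eq ((x, l0) :: sB ++ sA) (lv g) by rewrite es; perml.
  rewrite eqxx; apply: (@lrep_ext _ _ (fd a) _ (ky a)) => //.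
  + by move=> f y f4 _; rewrite (eqn_lt f4).
  + by rewrite -(perm_uniq (s1 := fnodes (lv g))) // perm_sym perm_fnodes.
  split=> //.
  + have : circ (fd a) (rot (size sA) (lv g)) by rewrite /circ map_rot rot_cycle.
    by rewrite es rot_size_cat.
  + by move=> h'; rewrite (perm_mem pr) => /hr.
  + by move=> h'; rewrite (perm_mem pr) => /hord'.
  + move=> y; rewrite (perm_mem (perm_map _ pr)) => yr; case: (y =P x) => [->//|yx].
    apply: le_trans (ltW lt) _; apply: le_trans (kle _) _; rewrite (ek y yx); exact: hmi.
- by move=> r r7; rewrite (eqn_lt r7).
- exact: srk0 S.
- by move=> f i _ f9; rewrite (eqn_neq f9).
- by move=> i ig; case: eqP.
- by move=> f i f4 _ _; rewrite (eqn_lt f4).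
Qed.

Lemma decreaseP a P lv x Q :
  str n (rg a 2) P (fd a) (ky a) lv ->
  (forall j, bit j (rg a 3) <-> isrec (mu lv) (ky a) j) ->
  x \in P -> rg a 0 = x -> (ky a 0 <= ky a x)%O ->
  (forall t a' lv', str n (rg a 2) P (fd a') (ky a') lv' ->
     (forall j, bit j (rg a' 3) <-> isrec (mu lv') (ky a') j) ->
     rg a' 1 = rg a 1 -> rg a' 2 = rg a 2 -> ky a' x = ky a 0 ->
     (forall y, y <> x -> ky a' y = ky a y) ->
     (forall j, fnodes (lv' j) =i fnodes (lv j)) ->
     t + phi w (rg a 2) (rg a' 3) P lv' <= phi w (rg a 2) (rg a 3) P lv + 70 * 100 ->
     Q t a') ->
  tri w cdecrease a Q.
Proof.
move=> S hR xP r0 kx HQ; have [g xg] := scov S xP.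
have /andP[x0 xn] := node_n S xg; have gn := node_le S xg; have [_ il] := slev S xg.
rewrite /cdecrease; do 4!(stp w16); rewrite r0; set a1 := setk _ _ _.
have ek y : y <> x -> ky a1 y = ky a y by move=> /eqP/negbTE yx; rewrite /= yx.
have ex : ky a1 x = ky a 0 by rewrite /= eqxx.
stp w16; apply: (@levelP (rg a 2) a1 x g) => //=; [exact: sM S|exact: sbl S|].
move=> t1 a2 ht1 fd2 ky2 r42 rg2.
have r52 : rg a2 5 = x by rewrite rg2.
rewrite -[fun i' => _]/(ky a1) in ky2.
have S2 : str n (rg a 2) P (fd a2) (ky a) lv by rewrite fd2.
stp w16; apply: (@liftP _ _ _ _ a2 x g _ S2 xg); rewrite ?ky2 ?r52 ?r42 ?ex //.
move=> t2 a3 s ps tS l3 ky3 rg3 z3 fd3 fd93 fdo3.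
do 2!(stp w16).
rewrite {1}rg3 // r42; set a4 := setr _ 24 _.
pose lv' := updl lv g s.
have fE j : fnodes (lv' j) =i fnodes (lv j).
  by move=> y; rewrite /lv' /updl; case: eqP => // ->; rewrite (perm_mem ps).
have gw : g < w.
  rewrite -(ltn_exp2l _ _ (isT : 1 < 2)); apply: leq_ltn_trans (_ : 2 ^ top (rg a 2) < _).
    by rewrite leq_exp2l // ltnW // (node_top S xg).
  by have := top_le S; move: W; clear; lia.
have fd3a f i : 3 < f -> f <> 9 -> fd a3 f i = fd a f i by move=> f3 f9; rewrite fd3 // fd2.
have S4 : str n (rg a 2) P (fd a3) (ky a1) lv'.
  split.
  - exact: sM S.
  - exact: sP S.
  - exact: sPn S.
  - have [d1 d2] := sdll S; split; last by move=> y yP; rewrite !fd3a // d2.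
    by rewrite (eq_cycle (e' := frel (fd a 5))) // => y1 y2 /=; rewrite fd3a.
  - by move=> y1 y2 p1 p2 /(spos S p1 p2); rewrite !fd3a.
  - by move=> j y; rewrite fE => /(slev S); rewrite fd3a.
  - by move=> y /(scov S)[j yj]; exists j; rewrite fE.
  - move=> j; rewrite /lv' /updl; case: eqP => _; last exact: suniq S j.
    by rewrite (perm_uniq ps) (suniq S).
  - move=> j jn; rewrite /lv' /updl; case: (j =P g) => [->|jg]; first by [].
    apply: (other_level S jg jn) => //.
    + by move=> f i f4 ig i0; rewrite fdo3 // fd2.
    + by rewrite fd93 // fd2.
    + by move=> y yP yg; apply: ek => e; rewrite e xg in yg.
  - move=> j jn; rewrite fd3a // (scnt S) // /lv' /updl; case: eqP => // ->.
    by rewrite (perm_size ps).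
  - by move=> q qn; rewrite fd3a // (sbl S).
  - by move=> q qn; rewrite fd3a // (slsb S).
  - by rewrite !fd3a //; apply: stab0 S.
  - by move=> q qn; rewrite fd3a // (sslot S).
  - by [].
have e3 : rg a3 3 = rg a 3 by rewrite rg3 // rg2.
have kE := ky3.
have mo j : j <> g -> mu lv' j = mu lv j by move=> jg; rewrite /mu /lv' /updl (introF eqP jg).
have ko j : j <> g -> ky a1 (mu lv j) = ky a (mu lv j).
  move=> jg; apply: ek => e; apply: jg; apply: (node_disj S (x := x)) => //.
  by rewrite -e; apply: mu_node; rewrite e => e'; rewrite e' in x0.
have mg : mu lv' g <> 0.
  by move/(mu_nil S4) => e; move: xg; rewrite -fE e.
have mg0 : mu lv g <> 0 by move/(mu_nil S) => e; rewrite e in xg.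
have kg : (ky a1 (mu lv' g) <= ky a (mu lv g))%O.
  apply: le_trans (_ : (ky a1 (mu lv g) <= _)%O).
    rewrite -(mu_mn S4 gn); apply: lrep_min (slrep S4 gn) _ _.
    by rewrite fE; apply: mu_node.
  by case: (mu lv g =P x) => [->|/ek ->//]; rewrite ex.
apply: (@lowerP w n _ K W (mu lv') (top (rg a 2)) (mu_top S4) (top_le S4) (mu_n S4) g) => //=.
- exact: mu_mn S4.
- exact: slsb S4.
- exact: sbl S4.
- move=> j; rewrite e3 => /hR [nz _]; case: (j =P g) => [->//|jg]; by rewrite mo.
- move=> j gj; rewrite e3 kE (hR j) /isrec; have jg : j <> g by move=> e; rewrite e ltnn in gj.
  rewrite mo // ko //; split=> -[h1 h2]; split=> // j' jj'.
    have jg' : j' <> g by move=> e; rewrite e in jj'; have := ltn_trans gj jj'; rewrite ltnn.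
    by rewrite mo // ko // => ?; apply: h2.
  have jg' : j' <> g by move=> e; rewrite e in jj'; have := ltn_trans gj jj'; rewrite ltnn.
  by have := h2 j' jj'; rewrite mo // ko.
- rewrite e3 kE => /hR [h1 h2]; split=> // j' jj'.
  have jg' : j' <> g by move=> e; rewrite e ltnn in jj'.
  by rewrite mo // ko // => nz; apply: le_lt_trans kg _; apply: h2.
- move=> j jg; rewrite e3 kE (hR j) /isrec; have jg' : j <> g by move=> e; rewrite e ltnn in jg.
  rewrite mo // ko //; split.
    case=> h1 h2; split; last by apply: h2.
    split=> // j' jj' nz; case: (j' =P g) => [e|ne].
      by rewrite e; apply: lt_le_trans kg; apply: h2.
    by have := h2 j' jj'; rewrite mo // ko // => /(_ nz).
  case=> -[h1 h2] h3; split=> // j' jj'; case: (j' =P g) => [-> //|ne].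
  by rewrite mo // ko // => nz; apply: h2.
- move=> j j' jj' jg j'g; rewrite e3 kE => /hR[h1 h2].
  have jg' : j <> g by move=> e; rewrite e ltnn in jg.
  by rewrite !mo // !ko // => nz; apply: h2.
move=> t3 a5 t35 fd5 ky5 rg5 hR5; rewrite e3 in t35.
apply: (HQ _ _ lv') => //.
- by rewrite fd5 ky5 kE.
- by move=> j; rewrite (hR5 j) ky5.
- by rewrite rg5 //= rg3 // rg2.
- by rewrite rg5 //= rg3 // rg2.
- by rewrite ky5 kE ex.
- by move=> y /ek yx; rewrite ky5 kE yx.
rewrite /phi; have := sum_updl lv s gw; rewrite -/lv'; move: t35 tS ht1; clear.
set q1 := \sum_(j < w) _; set q2 := \sum_(j < w) _.
move: (popc w (rg a5 3)) (popc w (rg a 3)) (popc w (rg a 2)) (fpot s) (fpot (lv g)) => *.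
lia.
Qed.

End Procedures.

(** * Insertion *)

(** The tables of bit lengths and valuations grow with the queue: the entries of a new record follow
    from those of half its index, so nothing is precomputed. *)
Definition cnew : hcmd :=
  HSet 1 (HV 1 +! HC 1) ;;
  HKey (HV 1) (HC 0) ;;
  HPut 0 (HV 1) (HC 0) ;;
  HPut 1 (HV 1) (HV 1) ;;
  HPut 2 (HV 1) (HC 0) ;;
  HPut 7 (HV 1) (HF 7 (HV 1 /! HC 2) +! HC 1) ;;
  HPut 8 (HV 1) ((HC 1 -! HV 1 %! HC 2) *! (HF 8 (HV 1 /! HC 2) +! HC 1)) ;;
  HPut 9 (HV 1) (HC 0) ;;
  HPut 10 (HV 1) (HC 0) ;;
  HPut 11 (HV 1) (HC 0) ;;
  HSet 4 (HF 5 (HC 0)) ;;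
  HPut 6 (HV 4) (HV 1) ;;
  HPut 5 (HV 1) (HV 4) ;;
  HPut 6 (HV 1) (HC 0) ;;
  HPut 5 (HC 0) (HV 1).

(* Moves the levels one step up as long as the element of level [i] in the
   way of a carry is justified by the [L] more recent elements. *)
Definition cshift : hcmd :=
  HWhile ((HV 7 %! HC 2) *! (HV 5 <! HV 6 +! HC 1))
    (HSet 6 (HV 6 +! HF 10 (HV 4)) ;;
     HSet 10 (HF 9 (HV 4)) ;;
     HPut 9 (HV 4) (HV 8) ;;
     HSet 8 (HV 10) ;;
     HSet 10 (HF 10 (HV 4)) ;;
     HPut 10 (HV 4) (HV 9) ;;
     HSet 9 (HV 10) ;;
     HSet 4 (HV 4 +! HC 1) ;;
     HSet 5 (HV 5 +! HV 5) ;;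
     HSet 7 (HV 7 /! HC 2)).

Definition ccarry : hcmd :=
  HSet 4 (HC 0) ;;
  HSet 5 (HC 1) ;;
  HSet 6 (HC 1) ;;
  HSet 7 (HV 2) ;;
  HSet 8 (HV 1) ;;
  HSet 9 (HC 1) ;;
  cshift.

Definition shift (lv : nat -> seq htree) (x j : nat) : seq htree :=
  if j is j'.+1 then lv j' else [:: (x, E)].

Section Procedures.
Variables (w m : nat) (disp : Order.disp_t) (K : orderType disp).
Notation n := m.+1.
Hypothesis W : 256 * n.+1 <= 2 ^ w.
Let w16 := w16 W.
Implicit Types (a : ast K) (Q : nat -> ast K -> Prop).

Lemma fcycle_in (f : nat -> nat) p y : fcycle f p -> y \in p -> f y \in p.
Proof. by move=> cy yp; have /eqP -> := next_cycle cy yp; rewrite mem_next. Qed.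

Lemma dll_cons (F F' : nat -> nat -> nat) P x : dll F P -> uniq (0 :: x :: P) ->
  F' 5 x = F 5 0 -> F' 5 0 = x -> F' 6 x = 0 -> F' 6 (F 5 0) = x ->
  (forall y, y <> x -> y <> 0 -> F' 5 y = F 5 y) ->
  (forall y, y <> x -> y <> F 5 0 -> F' 6 y = F 6 y) -> dll F' (x :: P).
Proof.
move=> [cy inv] un ex e0 e6 eo e5 e66.
have [xP zP] : x \notin P /\ 0 \notin P.
  by move: un; rewrite /= inE negb_or -andbA => /and4P[_ ? ? _].
have x0 : x <> 0 by move=> e; rewrite e in un.
split.
  rewrite /= e0 eqxx /=; apply: path_switch ex _ cy => y yP; apply: e5 => e; by rewrite e ?(negbTE xP) ?(negbTE zP) in yP.
move=> y; rewrite !inE => /or3P[/eqP ->|/eqP ->|yP]; rewrite ?e0 ?ex //.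
have yx : y <> x by move=> e; rewrite e (negbTE xP) in yP.
have y0 : y <> 0 by move=> e; rewrite e (negbTE zP) in yP.
have yP' : y \in 0 :: P by rewrite inE yP orbT.
have nx : F 5 y \in 0 :: P.
  exact: fcycle_in cy yP'.
rewrite e5 // e66; first exact: inv.
  by move=> e; move: nx; rewrite e inE (negbTE xP) orbF => /eqP.
by move=> e; apply: y0; rewrite -(inv y yP') e inv // inE eqxx.
Qed.

Lemma bl_half x : 0 < x -> trunc_log 2 x = if x %/ 2 is y.+1 then (trunc_log 2 y.+1).+1 else 0.
Proof.
move=> x0; case E: (x %/ 2) => [|y].
  by apply: trunc_log_eq => //; move: E x0; clear; lia.
apply: trunc_log_eq => //; have /andP[] := @trunc_log_bounds 2 y.+1 isT isT; rewrite !expnS -E.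
by clear; move: (2 ^ _) => u; lia.
Qed.

Lemma logn_half x : 0 < x -> logn 2 x = (1 - x %% 2) * (logn 2 (x %/ 2)).+1.
Proof.
move=> x0; rewrite modn2; case o: (odd x); first by rewrite lognE dvdn2 o andbF.
have e : x = (x %/ 2) * 2 by move: o; clear; lia.
have h0 : 0 < x %/ 2 by move: o x0; clear; lia.
by rewrite {1}e lognM // mul1n addn1.
Qed.

Lemma newP M P lv a Q :
  str m M P (fd a) (ky a) lv -> rg a 1 = m ->
  (forall t a', t <= 200 -> (forall r, 1 < r -> r <> 4 -> rg a' r = rg a r) -> rg a' 1 = n ->
     ky a' n = ky a 0 -> (forall y, y <> n -> ky a' y = ky a y) ->
     (forall f i, f <> 5 -> f <> 6 -> i <> n -> fd a' f i = fd a f i) ->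
     [/\ fd a' 0 n = 0, fd a' 1 n = n, fd a' 2 n = 0, fd a' 9 n = 0 & fd a' 10 n = 0] ->
     (forall s, 0 < s <= n -> fd a' 7 s = (trunc_log 2 s).+1) ->
     (forall s, 0 < s <= n -> fd a' 8 s = logn 2 s) -> fd a' 11 n = 0 ->
     dll (fd a') (n :: P) -> Q t a') ->
  tri w cnew a Q.
Proof.
move=> S r1 HQ; have [z7 z8] := stab0 S.
have [h0 h1] : n %/ 2 <= m /\ n %% 2 <= 1 by clear; lia.
have b7 : fd a 7 (n %/ 2) <= n.
  case E: (n %/ 2) => [|y]; first by rewrite z7.
  rewrite (sbl S) -?E ?h0 ?E //; apply: leq_trans (_ : y.+2 <= _); last by move: E; clear; lia.
  by rewrite ltnS; apply: leq_trans (@trunc_logP 2 y.+1 isT isT); apply: ltnW; apply: ltn_expl.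
have b8 : fd a 8 (n %/ 2) <= n.
  case E: (n %/ 2) => [|y]; first by rewrite z8.
  rewrite (slsb S) -?E ?h0 ?E //; apply: leq_trans (_ : y.+1 <= _); last by move: E; clear; lia.
  by apply: ltnW; apply: ltn_logl.
have bm : (1 - n %% 2) * (fd a 8 (n %/ 2) + 1) <= n.+1 by move: b8 h1; clear; nia.
have o5 : fd a 5 0 <= m.
  have [cy _] := sdll S; have := fcycle_in cy (mem_head _ _).
  by rewrite inE => /orP[/eqP ->//|/(sPn S)/andP[]].
rewrite /cnew; do 2!(stp w16); rewrite r1 addn1.
do 27!(stp w16).
set a' := setf _ 5 0 _.
have nn f i : f <> 5 -> f <> 6 -> i <> n -> fd a' f i = fd a f i.
  by move=> f5 f6 /eqP/negbTE h; rewrite /= h !andbF (eqn_neq f5) (eqn_neq f6).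
have un : uniq (0 :: n :: P).
  rewrite /= inE negb_or /= (str_uniqP S) andbT; apply/andP; split.
    by apply/negP => /(sPn S).
  by apply/negP => /(sPn S)/andP[_]; rewrite ltnn.
apply: HQ => //=; rewrite ?eqxx //.
- by move=> r r1' r4; rewrite (eqn_neq r4) eqn_neq // => e; rewrite e in r1'.
- by move=> y /eqP/negbTE ->.
- move=> s /andP[s0 sn]; case: (s =P n) => [->|ne]; last first.
    by rewrite (sbl S) // s0 -ltnS ltn_neqAle sn andbT; apply/eqP.
  rewrite addn1 bl_half //; case E: (n %/ 2) => [|y]; first by rewrite z7.
  by rewrite (sbl S) -?E ?h0 ?E.
- move=> s /andP[s0 sn]; case: (s =P n) => [->|ne]; last first.
    by rewrite (slsb S) // s0 -ltnS ltn_neqAle sn andbT; apply/eqP.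
  rewrite addn1 logn_half //; case E: (n %/ 2) => [|y]; first by rewrite z8.
  by rewrite (slsb S) -?E ?h0 ?E.
have no : n <> fd a 5 0 by move=> e; rewrite -e ltnn in o5.
apply: dll_cons (sdll S) un _ _ _ _ _ _ => //=; rewrite ?eqxx //.
- by case: eqP => // e; case: no.
- by move=> y /eqP/negbTE -> /eqP/negbTE ->.
- by move=> y /eqP/negbTE -> /eqP/negbTE ->.
Qed.

(** * Carries: moving whole levels one step up *)

Section Carry.
Variables (M : nat) (f9 f10 : nat -> nat).
Hypothesis Mn : 0 < M <= n.

Let s9 j := if j is j'.+1 then f9 j' else n.
Let s10 j := if j is j'.+1 then f10 j' else 1.
Let L i := (\sum_(j < i) f10 j).+1.
Hypothesis Ln : forall i, L i <= n.

(** Registers 8 and 9 hold the circle displaced from level [i.-1], or the new element when [i] is 0,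
    and its size; they wait for a place in level [i]. [L i] counts the new element together with
    those that were in the levels below [i]. *)
Definition carried (a0 a : ast K) (i : nat) : Prop :=
  [/\ [/\ rg a 4 = i, rg a 5 = 2 ^ i, rg a 6 = L i & rg a 7 = M %/ 2 ^ i],
      rg a 8 = s9 i /\ rg a 9 = s10 i,
      2 ^ i %| M.+1 /\ forall k, k < i -> 2 ^ k <= L k,
      [/\ forall j, fd a 9 j = if j < i then s9 j else fd a0 9 j,
          forall j, fd a 10 j = if j < i then s10 j else fd a0 10 j &
          forall f j, f <> 9 -> f <> 10 -> fd a f j = fd a0 f j] &
      ky a = ky a0 /\ forall r, r < 4 -> rg a r = rg a0 r].

Lemma shiftP a a1 i0 Q : rg a 1 = n -> rg a 2 = M ->
  (forall j, j <= n -> fd a 9 j = f9 j) -> (forall j, j <= n -> fd a 10 j = f10 j) ->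
  carried a a1 i0 ->
  (forall t a' i, t + 100 * i0 <= 100 * i + 50 -> carried a a' i ->
     ~~ odd (M %/ 2 ^ i) || (L i < 2 ^ i) -> Q t a') ->
  tri w cshift a1 Q.
Proof.
move=> r1 r2 e9 e10; have dvn i : 2 ^ i %| M.+1 -> 2 ^ i <= n.+1.
  by move=> /dvdn_leq h; apply: leq_trans (h isT) _; rewrite ltnS; case/andP: Mn.
have [d] := ubnP (n.+2 - i0); elim: d i0 a1 Q => // d IH i0 a1 Q hd c1 HQ.
case: (c1) => -[r4 r5 r6 r7] [r8 r9] [dv ev] [g9 g10 go] [kE rE].
have i2 := dvn _ dv; have L1 := Ln i0; have L2 := Ln i0.+1.
have i0n : i0 <= n by rewrite -ltnS; apply: leq_trans i2; apply: ltn_expl.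
have x9 : fd a1 9 i0 = f9 i0 by rewrite g9 ltnn e9.
have x10 : fd a1 10 i0 = f10 i0 by rewrite g10 ltnn e10.
have LS : L i0 + f10 i0 = L i0.+1 by rewrite /L big_ord_recr addSn.
have qb : (M %/ 2 ^ i0 %% 2) * (2 ^ i0 < L i0 + 1) = odd (M %/ 2 ^ i0) && (2 ^ i0 <= L i0) :> nat.
  by rewrite modn2 addn1 ltnS mulnb.
rewrite /cshift; apply: (tri_while w16); rewrite /= ?r7 ?r5 ?r6.
- by do ?split=> //; rewrite ?qb ?modn2; try alia; case: (odd _); rewrite ?mul1n ?mul0n; apply: leq_ltn_trans (leq_b1 _) _; alia.
- rewrite qb nat_of_bool_neq0 => /andP[od le].
  have f10n : f10 i0 <= n by move: LS L2; clear; lia.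
  have z10 : rg a1 6 + fd a1 10 (rg a1 4) <= n by rewrite r6 r4 x10 LS.
  do 19!(stp w16); rewrite ?r4 ?r5 ?r6 ?r7 ?r8 ?r9 ?x9 ?x10 ?eqxx; set a2 := setr _ 7 _.
  apply: (IH i0.+1); first by move: hd i0n; clear; lia.
    split.
    - split=> //=; [by rewrite addn1|by rewrite addnn expnS mul2n|].
      by rewrite expnSr divnMA.
    - by split.
    - split; first exact: dvd_carry.
      by move=> k; rewrite ltnS leq_eqVlt => /orP[/eqP ->//|/ev].
    - split=> [j|j|f j n9 n10] /=; last by rewrite (eqn_neq n9) (eqn_neq n10) go.
        by rewrite g9 ltnS (leq_eqVlt j); case: eqP => [->|_] //=.
      by rewrite g10 ltnS (leq_eqVlt j); case: eqP => [->|_] //=.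
    - split=> // r rr /=; rewrite -rE //; do ?rewrite (eqn_lt rr) //.
  move=> t a' i ht; apply: HQ; move: ht; clear; lia.
rewrite qb => h; apply: (HQ _ _ i0) => //; first by clear; lia.
by move: h; case: (odd _) => //=; rewrite ltnNge; case: (_ <= _).
Qed.

Lemma carryP a Q : rg a 1 = n -> rg a 2 = M ->
  (forall j, j <= n -> fd a 9 j = f9 j) -> (forall j, j <= n -> fd a 10 j = f10 j) ->
  (forall t a' i, t <= 100 * i + 100 -> carried a a' i ->
     ~~ odd (M %/ 2 ^ i) || (L i < 2 ^ i) -> Q t a') ->
  tri w ccarry a Q.
Proof.
move=> r1 r2 e9 e10 HQ; have Mn' : M <= n by case/andP: Mn.
rewrite /ccarry; do 12!(stp w16); rewrite r1 r2; set a1 := setr _ 9 1.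
have c1 : carried a a1 0.
  split=> //.
  - by split=> //=; rewrite /L ?big_ord0 ?divn1.
  - by split=> // r r4 /=; rewrite !(eqn_lt r4).
by apply: (shiftP (i0 := 0) r1 r2 e9 e10 c1) => t a' i ht; apply: HQ; move: ht; clear; lia.
Qed.

End Carry.

End Procedures.

(** * Levels before and after an increment *)

Section Levels.
Variables (i M : nat).
Hypotheses (dv : 2 ^ i %| M.+1) (ev : ~~ odd (M %/ 2 ^ i)).

Lemma inlev_incr_lo j p : j < i -> inlev M p j -> inlev M.+1 p j.+1.
Proof.
move=> ji /andP[a b]; rewrite /inlev (C_incr_lo dv ji) b andbT; apply: leq_trans a.
move: ji; rewrite leq_eqVlt => /orP[/eqP e|lt]; last by rewrite (C_incr_lo dv).
by rewrite e (C_incr_hi dv ev) // C_anti.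
Qed.

Lemma inlev_incr_hi j p : i <= j -> inlev M p j -> inlev M.+1 p j.
Proof.
move=> ij /andP[a b]; rewrite /inlev (C_incr_hi dv ev) ?ltnS // a /=; apply: leq_trans b _.
by move: ij; rewrite leq_eqVlt => /orP[/eqP <-|lt]; [exact: C_incr_eq|rewrite (C_incr_hi dv ev)].
Qed.

(** The new element takes position [M.-1], which is [C M 0], the first one above all occupied
    positions; the incremented counter puts it into level 0. *)
Lemma inlev_incr_new : 0 < M -> inlev M.+1 M.-1 0.
Proof.
move=> M0; have e0 : C M.+1 0 = M by rewrite C0.
rewrite /inlev e0 prednK // leqnn andbT -C0; case: (posnP i) => [e|i0].
  by rewrite (C_incr_hi dv ev) ?e // C_anti.
by rewrite (C_incr_lo dv i0) leqnn.
Qed.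

End Levels.

(** [A], [D] and [B] stand for the potentials of the old, the shifted and the new levels. Adding the
    old low levels on the left avoids a subtraction. *)
Lemma sum_merge (A B D : nat -> nat) i w : i < w ->
  (forall j, j < i -> B j = D j) -> B i = A i + D i -> (forall j, i < j -> B j = A j) ->
  \sum_(j < w) B j + \sum_(j < i) A j = \sum_(j < w) A j + \sum_(j < i.+1) D j.
Proof.
move=> iw lo eq hi; elim: w iw => // w IH; rewrite ltnS leq_eqVlt => /orP[/eqP <-|iw].
  rewrite !big_ord_recr /= eq (eq_bigr (fun j : 'I_i => D j)); first by clear; lia.
  by move=> j _; apply: lo.
by rewrite !big_ord_recr /= (hi w iw); move: (IH iw); rewrite big_ord_recr /=; clear; lia.
Qed.

Definition cfinish : hcmd :=
  HPut 4 (HV 1) (HV 2 -! HC 1) ;;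
  HSet 2 (HV 2 +! HC 1) ;;
  HPut 10 (HV 4) (HF 10 (HV 4) +! HV 9) ;;
  HSet 20 (HV 4) ;;
  HSet 21 (HV 8) ;;
  cmeld.

(** * Insertion that completes the increment *)

Section Procedures.
Variables (w m : nat) (disp : Order.disp_t) (K : orderType disp).
Notation n := m.+1.
Hypothesis W : 256 * n.+1 <= 2 ^ w.
Let w16 := w16 W.
Implicit Types (a : ast K) (Q : nat -> ast K -> Prop).

(* The state of an insertion after [i] carries; the fields of the present
   elements are still those given by [F0]. *)
Record mid M P (F0 : nat -> nat -> nat) k lv i a : Prop := Mid {
  mdS : str m M P F0 k lv;
  mdk : {in P, ky a =1 k};
  mddll : dll (fd a) (n :: P);
  mdbl : forall s, 0 < s <= n -> fd a 7 s = (trunc_log 2 s).+1;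
  mdlsb : forall s, 0 < s <= n -> fd a 8 s = logn 2 s;
  mdtab0 : fd a 7 0 = 0 /\ fd a 8 0 = 0;
  mdslot : forall r, 0 < r <= n -> fd a 11 r = 0;
  mdrk0 : fd a 3 0 = 0;
  mdf : forall f y, f < 5 -> y \in P -> fd a f y = F0 f y;
  mdx : [/\ fd a 0 n = 0, fd a 1 n = n & fd a 2 n = 0];
  md9 : forall j, j <= n -> fd a 9 j = if j < i then mu (shift lv n) j else mu lv j;
  md10 : forall j, j <= n -> fd a 10 j = size (fnodes (if j < i then shift lv n j else lv j));
  mdr : rg a 1 = n /\ rg a 2 = M;
  mdr4 : [/\ rg a 4 = i, rg a 5 = 2 ^ i & rg a 6 = (\sum_(j < i) size (fnodes (lv j))).+1];
  mdr8 : rg a 8 = mu (shift lv n) i /\ rg a 9 = size (fnodes (shift lv n i));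
  mddv : 2 ^ i %| M.+1;
  mdev : forall k, k < i -> 2 ^ k <= (\sum_(j < k) size (fnodes (lv j))).+1
}.

Section Mid.
Variables (M : nat) (P : seq nat) (F0 : nat -> nat -> nat) (k : nat -> K)
  (lv : nat -> seq htree) (i : nat) (a : ast K).
Hypothesis md : mid M P F0 k lv i a.
Let S := mdS md.

Lemma mid_nP : n \notin P.
Proof. by apply/negP => /(sPn S)/andP[_]; rewrite ltnn. Qed.

Lemma mid_lt y : y \in P -> y < n.
Proof. by case/(sPn S)/andP. Qed.

Lemma mid_sorted : sorted gtn (n :: P).
Proof.
rewrite /= path_sortedE; last by move=> y1 y2 y3 /=; clear; lia.
by rewrite (sP S) andbT; apply/allP => y /mid_lt.
Qed.

Lemma mid_uniq : uniq (n :: P).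
Proof. by rewrite /= mid_nP (str_uniqP S). Qed.

Lemma mid_n : {in n :: P, forall y, 0 < y <= n}.
Proof.
move=> y; rewrite inE => /orP[/eqP ->|/(sPn S)/andP[y0 yn]]; first by rewrite leqnn.
by rewrite y0 leqW.
Qed.

Lemma mid_i : 2 ^ i <= n.+1.
Proof.
apply: leq_trans (dvdn_leq _ (mddv md)) _ => //; rewrite ltnS.
by case/andP: (sM S).
Qed.

Lemma mid_in : i <= n.
Proof. by rewrite -ltnS; apply: leq_trans mid_i; apply: ltn_expl. Qed.

Lemma mid_lv j y : y \in fnodes (lv j) -> y \in P.
Proof. by case/(slev S). Qed.

Lemma mid_lvm j : m < j -> lv j = [::].
Proof. by move=> h; apply: (lv_top S); apply: leq_trans (top_n S) (ltnW h). Qed.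

Lemma mid_lrep j : lrep (fd a) (ky a) (lv j) (mu lv j).
Proof.
case: (leqP j m) => [jm|/mid_lvm e]; last by rewrite /mu e; apply: lrep_nil.
apply: (lrep_ext (F := F0) (k := k)); last by rewrite -(mu_mn S jm); exact: (slrep S jm).
- by move=> f y f4 /mid_lv yP; apply: (mdf md) => //; apply: ltnW.
- exact: suniq S j.
- by move=> y /mid_lv yP; rewrite (mdk md).
Qed.

Lemma lrep_single F (kk : nat -> K) y : 0 < y -> F 0 y = 0 -> F 1 y = y -> F 2 y = 0 ->
  lrep F kk [:: (y, E)] y.
Proof.
move=> y0 e0 e1 e2; split=> //.
- by rewrite /circ /= e1 eqxx.
- by move=> h; rewrite inE => /eqP ->.
- by move=> h; rewrite inE => /eqP ->.
- by move=> z; rewrite inE => /eqP ->.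
Qed.

Lemma mid_lrep_shift j : lrep (fd a) (ky a) (shift lv n j) (mu (shift lv n) j).
Proof.
case: j => [|j]; last exact: mid_lrep.
by have [e0 e1 e2] := mdx md; apply: lrep_single.
Qed.

Lemma mid_uniq_shift j : uniq (fnodes (shift lv n j)).
Proof. by case: j => [|j] //=; apply: suniq S j. Qed.

Lemma mid_shift_in j y : y \in fnodes (shift lv n j) -> y \in n :: P.
Proof.
case: j => [|j] /=; first by rewrite fnodes_cons /= inE => /eqP ->; rewrite inE eqxx.
by move/mid_lv => yP; rewrite inE yP orbT.
Qed.

Lemma mid_shift_disj j j' y : y \in fnodes (shift lv n j) -> y \in fnodes (shift lv n j') -> j = j'.
Proof.
have X q : y \in fnodes (shift lv n 0) -> y \in fnodes (lv q) -> False.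
  by rewrite fnodes_cons /= inE => /eqP -> /mid_lv; rewrite (negbTE mid_nP).
case: j j' => [|j] [|j'] //= h1 h2; [by case: (X j')|by case: (X j)|].
by rewrite (node_disj S h1 h2).
Qed.

Lemma mid_lv_shift j j' y : j' <> j.+1 ->
  y \in fnodes (lv j) -> y \in fnodes (shift lv n j') = false.
Proof.
move=> ne yj; apply/negP => h; apply: ne; have h' : y \in fnodes (shift lv n j.+1) by [].
exact: mid_shift_disj h h'.
Qed.

(* The elements below level [j] are more recent than those of level [j]. *)
Lemma mid_newer j y : j < i -> y \in fnodes (lv j) ->
  2 ^ j.+1 <= 2 * size [seq z <- n :: P | y <= z].
Proof.
move=> ji yj; have [yP /andP[_ yl]] := slev S yj.
rewrite expnS leq_pmul2l //; apply: leq_trans (mdev md ji) _.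
rewrite (cnt_low S) size_filter /= (ltnW (mid_lt yP)) add1n ltnS.
rewrite (@eq_in_count _ _ (fun z => (C M j <= F0 4 z) && (y <= z))); first by apply: sub_count => z /andP[].
move=> z zP /=; case h: (_ <= _) => //=; apply/esym; rewrite leqNgt; apply/negP => zy.
have := spos S zP yP zy; rewrite ltnNge => /negP[]; apply: ltnW.
exact: leq_trans yl h.
Qed.

(** The mask enters [phi] as 0 because it is recomputed afterwards. The term [400 * i], released by
    the trailing ones of [M], is set aside for the carries already made, the refresh and the bits it
    may create. *)
Lemma finishP Q : ~~ odd (M %/ 2 ^ i) ->
  (forall t a' lv', str n (rg a' 2) (n :: P) (fd a') (ky a) lv' ->
     ky a' = ky a -> rg a' 1 = n -> rg a' 3 = rg a 3 -> rg a' 4 = i ->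
     (forall j, i < j -> lv' j = lv j) ->
     (forall j y, y \in fnodes (lv' j) ->
        y \in fnodes (lv j) \/ 2 ^ j <= 2 * size [seq z <- n :: P | y <= z]) ->
     t + phi w (rg a' 2) 0 (n :: P) lv' + 400 * i <= phi w M 0 P lv + 60 * 100 ->
     Q t a') ->
  tri w cfinish a Q.
Proof.
move=> ev HQ; have dv := mddv md; have [r1 r2] := mdr md; have [r4 r5 r6] := mdr4 md.
have [r8 r9] := mdr8 md; have /andP[M0 Mm] := sM S; have i_n := mid_in.
have u2 : uniq (fnodes (lv i ++ shift lv n i)).
  rewrite fnodes_cat cat_uniq (suniq S) mid_uniq_shift andbT /=; apply/hasPn => y yi.
  by apply/negP => yl; rewrite (mid_lv_shift _ yl) // in yi; move=> e; move: (ltnSn i); rewrite -e ltnn.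
have nb y : y \in fnodes (lv i ++ shift lv n i) -> y \in n :: P.
  rewrite fnodes_cat mem_cat => /orP[/mid_lv yP|/mid_shift_in //]; by rewrite inE yP orbT.
have sz : size (fnodes (lv i ++ shift lv n i)) <= n.
  by apply: bounded_size u2 _ _ => y /nb/mid_n/andP[].
have c10 : fd a 10 i = size (fnodes (lv i)) by rewrite (md10 md) // ltnn.
have szz : fd a 10 (rg a 4) + rg a 9 <= n by rewrite r4 c10 r9 -size_cat -fnodes_cat.
rewrite /cfinish; do 10!(stp w16); rewrite r1 r2 r4 r8 r9; set a1 := setr _ 21 _.
have fd1 f y : f <> 4 -> f <> 10 -> fd a1 f y = fd a f y.
  by move=> f4 f10; rewrite /= (eqn_neq f4) (eqn_neq f10).
have fd14 f y : f < 4 -> fd a1 f y = fd a f y by move=> f4; rewrite /= !(eqn_lt f4).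
apply: (@meldP w n _ K W a1 (lv i) (shift lv n i) i (mu (shift lv n) i)) => //.
- apply: (lrep_ext (F := fd a) (k := ky a)) => //; [by move=> f y /fd14|exact: suniq S i|].
  by rewrite fd1 // (md9 md) // ltnn; apply: mid_lrep.
- apply: (lrep_ext (F := fd a) (k := ky a)) => //; [by move=> f y /fd14|exact: mid_uniq_shift|].
  exact: mid_lrep_shift.
- by move=> y /nb/mid_n/andP[].
move=> t a2 s ht ky2 rg2 fd2 fd21 fd29 ps lr2.
pose lv' j := if j < i then shift lv n j else if j == i then s else lv j.
have ps' := perm_fnodes ps.
have memE j y : y \in fnodes (lv' j) =
    ((j <= i) && (y \in fnodes (shift lv n j))) || ((i <= j) && (y \in fnodes (lv j))).
  rewrite /lv'; case: (ltngtP j i) => h; rewrite ?andbT ?orbF //=.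
  by rewrite (perm_mem ps') fnodes_cat mem_cat orbC h.
have p4 y : y \in P -> fd a2 4 y = F0 4 y.
  move=> yP; rewrite fd2 //= -(mdf md) //; case: eqP => // e; move: (mid_lt yP).
  by rewrite e ltnn.
have pn : fd a2 4 n = M.-1 by rewrite fd2 //= eqxx subn1.
have f4 f y : f < 4 -> y \notin fnodes (lv i ++ shift lv n i) -> fd a2 f y = fd a f y.
  move=> ff yn; rewrite -fd14 //; case: (f =P 1) => [->|f1]; last by rewrite fd2 // => e; rewrite e in ff.
  by apply: fd21; apply: contra yn => /roots_sub.
have f5 f y : 4 < f -> f <> 9 -> f <> 10 -> fd a2 f y = fd a f y.
  by move=> f4' f9 f10; rewrite fd2 // ?fd1 // => e; rewrite e in f4'.
have lr j : lrep (fd a) (ky a) (lv' j) (mu lv' j) -> j <> i -> lrep (fd a2) (ky a) (lv' j) (mu lv' j).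
  move=> h ji; apply: lrep_ext h => //.
    move=> f y ff yj; apply: f4 => //; apply/negP; rewrite fnodes_cat mem_cat.
    move: yj; rewrite memE; case: (ltngtP j i) ji => // lt _; rewrite ?andbF ?orbF //= => yj.
      case/orP=> h; first by rewrite (mid_lv_shift _ h) // in yj; move: lt; clear; lia.
      by have := mid_shift_disj yj h; move: lt; clear; lia.
    case/orP=> h; first by have := node_disj S yj h; move: lt; clear; lia.
    by rewrite (mid_lv_shift _ yj) // in h; move: lt; clear; lia.
  by rewrite /lv'; case: ltngtP ji => // _ _; [exact: mid_uniq_shift|exact: suniq S j].
have mulo j : j < i -> mu lv' j = mu (shift lv n) j by move=> h; rewrite /mu /lv' h.
have muhi j : i < j -> mu lv' j = mu lv j.
  by move=> h; rewrite /mu /lv' ltnNge (ltnW h) /=; case: eqP => // e; rewrite e ltnn in h.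
have S' : str n M.+1 (n :: P) (fd a2) (ky a) lv'.
  split.
  - by rewrite /= ltnS.
  - exact: mid_sorted.
  - exact: mid_n.
  - have [d1 d2] := mddll md; split; last by move=> y yP; rewrite !f5 // d2.
    by rewrite (eq_cycle (e' := frel (fd a 5))) // => y1 y2 /=; rewrite f5.
  - move=> y1 y2; rewrite !inE => /orP[/eqP ->|p1] /orP[/eqP ->|p2].
    + by rewrite ltnn.
    + by move/mid_lt: p2; clear; lia.
    + by rewrite pn p4 // => _; apply: (pos_lt S).
    + by rewrite !p4 //; exact: (spos S).
  - move=> j y; rewrite memE => /orP[/andP[ji]|/andP[ij]].
      case: j ji => [|j] ji /=; first rewrite fnodes_cons /= inE => /eqP ->.
        by rewrite inE eqxx pn; split=> //; apply: inlev_incr_new dv ev M0.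
      case/(slev S) => yP yl; rewrite inE yP orbT p4 //; split=> //.
      exact: (inlev_incr_lo dv ev ji yl).
    by case/(slev S) => yP yl; rewrite inE yP orbT p4 //; split=> //; exact: (inlev_incr_hi dv ev ij yl).
  - move=> y; rewrite inE => /orP[/eqP ->|/(scov S)[j yj]].
      by exists 0; rewrite memE /= fnodes_cons inE eqxx.
    case: (leqP i j) => ij; first by exists j; rewrite memE ij yj orbT.
    by exists j.+1; rewrite memE ij yj.
  - move=> j; rewrite /lv'; case: ltngtP => h; [exact: mid_uniq_shift|exact: suniq S j|].
    by rewrite (perm_uniq ps').
  - move=> j jn; case: (j =P i) => [->|ji].
      by rewrite /lv' ltnn eqxx.
    have [h|h] : j < i \/ i < j by move: ji; clear; lia.
      have -> : fd a2 9 j = mu lv' j by rewrite fd29 //= (md9 md) // h mulo.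
      by apply: lr => //; rewrite mulo // /lv' h; apply: mid_lrep_shift.
    have e : lv' j = lv j by rewrite /lv' ltnNge (ltnW h) (introF eqP ji).
    have -> : fd a2 9 j = mu lv' j by rewrite fd29 //= (md9 md) // ltnNge (ltnW h) muhi.
    by apply: lr => //; rewrite muhi // e; apply: mid_lrep.
  - move=> j jn; rewrite fd2 //= /lv'; case: (ltngtP j i) => h.
    + by rewrite (md10 md) // h.
    + by rewrite (md10 md) // ltnNge (ltnW h).
    + by rewrite (perm_size ps') c10 fnodes_cat size_cat.
  - by move=> q qn; rewrite f5 // (mdbl md).
  - by move=> q qn; rewrite f5 // (mdlsb md).
  - by rewrite !f5 //; apply: mdtab0 md.
  - by move=> q qn; rewrite f5 // (mdslot md).
  - rewrite f4 ?(mdrk0 md) //; apply/negP => /nb/mid_n //.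
have r22 : rg a2 2 = M.+1 by rewrite rg2 //= addn1.
have iw : i < w.
  rewrite -(ltn_exp2l _ _ (isT : 1 < 2)); have := mid_i; move: W; clear; lia.
apply: (HQ _ _ lv'); rewrite ?r22 ?rg2 //.
- by move=> j ij; rewrite /lv' ltnNge (ltnW ij) /=; case: eqP => // e; rewrite e ltnn in ij.
- move=> j y; rewrite memE => /orP[/andP[ji]|/andP[ij ->]]; last by left.
  case: j ji => [|j] ji yj; right; last exact: mid_newer.
  move: yj; rewrite fnodes_cons /= inE => /eqP ->; rewrite leqnn /=; clear; lia.
(* The counter and the number of elements both grow by one, so the free positions are unchanged; the
   half tree of the new element takes 5000 of the bound. *)
rewrite /phi; have := popc_incr dv ev (ltnW iw).
have Z : popc w 0 = 0 by apply: big1 => j _; rewrite /bit div0n.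
have := @sum_merge (fun j => fpot (lv j)) (fun j => fpot (lv' j)) (fun j => fpot (shift lv n j)) i w iw.
have -> : \sum_(j < i.+1) fpot (shift lv n j) = 5 + \sum_(j < i) fpot (lv j).
  by rewrite big_ord_recl.
move=> X; have {X} := X _ _ _; rewrite Z /= => X pc.
have {}X : \sum_(j < w) fpot (lv' j) + \sum_(j < i) fpot (lv j) =
    \sum_(j < w) fpot (lv j) + (5 + \sum_(j < i) fpot (lv j)).
  apply: X => [j ji||j ij]; rewrite /lv'; first by rewrite ji.
    by rewrite ltnn eqxx (perm_fpot ps) fpot_cat.
  by rewrite ltnNge (ltnW ij) /=; case: eqP => // e; rewrite e ltnn in ij.
have := size_P S; move: X pc ht M0; clear.
set q1 := \sum_(j < w) _; set q2 := \sum_(j < w) _; set q3 := \sum_(j < i) _.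
move: (popc w M) (popc w M.+1) (size P) => *; lia.
Qed.

End Mid.
End Procedures.

(** * Insertion that rebuilds the low levels *)

Definition cclear : hcmd :=
  HWhile (HV 10)
    (HSet 10 (HV 10 -! HC 1) ;;
     HPut 9 (HV 10) (HC 0) ;;
     HPut 10 (HV 10) (HC 0)).

(** Register 10 runs through the elements from the most recent one, and register 11 is the rank [q]
    of the current one. Position [M - (q + 2)], for the lowered counter in register 2, belongs to
    the level given by the bit length of [q + 1]. *)
Definition cplace : hcmd :=
  HWhile (HV 11 <! HV 6)
    (HPut 4 (HV 10) (HV 2 -! (HV 11 +! HC 2)) ;;
     HPut 0 (HV 10) (HC 0) ;;
     HPut 1 (HV 10) (HV 10) ;;
     HPut 2 (HV 10) (HC 0) ;;
     HSet 20 (HF 7 (HV 11 +! HC 1) -! HC 1) ;;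
     HSet 21 (HV 10) ;;
     HPut 10 (HV 20) (HF 10 (HV 20) +! HC 1) ;;
     cmeld ;;
     HSet 10 (HF 5 (HV 10)) ;;
     HSet 11 (HV 11 +! HC 1)).

Definition crebuild : hcmd :=
  HSet 2 (HV 2 +! HC 1 -! HV 5) ;;
  HSet 10 (HV 4) ;;
  cclear ;;
  HSet 10 (HF 5 (HC 0)) ;;
  HSet 11 (HC 0) ;;
  cplace.

(** The list decreases and [p] is upward closed, so the elements satisfying [p] form a prefix, of
    length [count p P]. *)
Lemma index_ge (p : pred nat) P y : sorted gtn P ->
  {in P &, forall z1 z2, z1 < z2 -> p z1 -> p z2} -> y \in P -> ~~ p y ->
  count p P <= index y P.
Proof.
elim: P => //= h P IH pa up; rewrite inE.
have : path gtn h P by []; rewrite path_sortedE; last by move=> y1 y2 y3 /=; clear; lia.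
case/andP=> /allP lt so; case: (h =P y) => [<- _ py|hy].
  rewrite (negbTE py) add0n leqn0 eqn0Ngt -has_count; apply/hasPn => z zP; apply: contra py.
  by apply: (up z h) (lt z zP); rewrite inE ?zP ?eqxx ?orbT.
by rewrite eq_sym (introF eqP hy) /= => yP py; apply: leq_add (leq_b1 _) (IH _ _ _ _) => // z1 z2 h1 h2; apply: up; rewrite inE ?h1 ?h2 orbT.
Qed.

Lemma index_lt (p : pred nat) P y : sorted gtn P ->
  {in P &, forall z1 z2, z1 < z2 -> p z1 -> p z2} -> y \in P -> p y ->
  index y P < count p P.
Proof.
elim: P => //= h P IH pa up; rewrite inE.
have : path gtn h P by []; rewrite path_sortedE; last by move=> y1 y2 y3 /=; clear; lia.
case/andP=> /allP lt so; case: (h =P y) => [<- _ -> //|hy].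
rewrite eq_sym (introF eqP hy) /= => yP py.
have ph : p h by apply: (up y h) py; rewrite ?inE ?yP ?eqxx ?orbT //; apply: lt.
by rewrite ph add1n ltnS; apply: IH => // z1 z2 h1 h2; apply: up; rewrite inE ?h1 ?h2 orbT.
Qed.

Lemma dll_nth F P q : dll F P -> q < size P -> F 5 (nth 0 P q) = nth 0 P q.+1.
Proof.
case=> cy _ qs; have /(pathP 0) : fpath (F 5) 0 (rcons P 0) by [].
move/(_ q.+1); rewrite size_rcons ltnS qs => /(_ isT) /eqP /=.
by rewrite !nth_rcons_default.
Qed.

Lemma dll_head F P : dll F P -> F 5 0 = nth 0 P 0.
Proof.
case=> cy _; have /(pathP 0) : fpath (F 5) 0 (rcons P 0) by [].
by move/(_ 0); rewrite size_rcons => /(_ isT) /eqP /=; rewrite nth_rcons_default.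
Qed.

(** For a multiple of [2 ^ i] the boundaries up to [i] are [M - 2 ^ h], so the level is the [j] with
    [2 ^ j <= q.+1 < 2 ^ j.+1]. *)
Lemma inlev_lower i M q : 2 ^ i %| M -> 0 < M -> q.+1 < 2 ^ i ->
  inlev M (M - (q + 2)) (trunc_log 2 q.+1).
Proof.
move=> dv M0 lt; have /andP[b1 b2] := @trunc_log_bounds 2 q.+1 isT isT.
set j := trunc_log 2 q.+1 in b1 b2 *.
have ji : j < i by rewrite -(ltn_exp2l _ _ (isT : 1 < 2)); apply: leq_ltn_trans b1 lt.
have CE h : h <= i -> C M h = M - 2 ^ h.
  by move=> hi; rewrite /C divnK //; apply: dvdn_trans dv; rewrite dvdn_exp2l.
have Mi := dvdn_leq M0 dv.
have e1 : 2 ^ j.+1 <= 2 ^ i by rewrite leq_exp2l.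
rewrite /inlev !CE // ?(ltnW ji) //; move: b1 b2 e1 Mi lt; rewrite expnS; clear.
move: (2 ^ j) (2 ^ i) => *; lia.
Qed.

Section Procedures.
Variables (w n : nat) (disp : Order.disp_t) (K : orderType disp).
Hypothesis W : 256 * n.+1 <= 2 ^ w.
Let w16 := w16 W.
Implicit Types (a : ast K) (Q : nat -> ast K -> Prop).

Lemma clearP a i Q : rg a 10 = i -> i <= n.+1 ->
  (forall t a', t <= 50 * i + 10 ->
     (forall f j, fd a' f j = if ((f == 9) || (f == 10)) && (j < i) then 0 else fd a f j) ->
     ky a' = ky a -> (forall r, r <> 10 -> rg a' r = rg a r) -> Q t a') ->
  tri w cclear a Q.
Proof.
elim: i a Q => [|i IH] a Q r10 i_n HQ; rewrite /cclear; stp w16; rewrite r10 //.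
  by move=> _; apply: HQ => // f j; rewrite ltn0 andbF.
move=> _; do 5!(stp w16); rewrite r10 subn1 /=.
apply: (IH _ _ _ (ltnW i_n)) => //= t a' ht fdE kyE rgE.
apply: HQ => //.
- by move: ht; clear; lia.
- move=> f j; rewrite fdE ltnS (leq_eqVlt j).
  have -> : eqn f 10 = (f == 10) by []; have -> : eqn f 9 = (f == 9) by [].
  by case: (f == 9); case: (f == 10); case: (j < i); case: (j == i).
- by move=> r r10'; rewrite rgE //= (eqn_neq r10').
Qed.

Section Place.
Variables (PP : seq nat) (i L M : nat) (lv0 : nat -> seq htree) (a0 : ast K).
Hypotheses (uP : uniq PP) (Pn : {in PP, forall y, 0 < y <= n}) (dl : dll (fd a0) PP).
Hypotheses (LP : L <= size PP) (L2 : L < 2 ^ i) (LM : L < M) (i2 : 2 ^ i <= n.+1) (Mn : M <= n.+1).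
Hypothesis old : forall j y, i <= j -> y \in fnodes (lv0 j) -> L <= index y PP /\ y \in PP.
Hypothesis disj : forall j j' y, i <= j -> i <= j' ->
  y \in fnodes (lv0 j) -> y \in fnodes (lv0 j') -> j = j'.
Hypothesis bl : forall s, 0 < s <= n -> fd a0 7 s = (trunc_log 2 s).+1.

(** Elements beyond the first [q] keep their former positions. The old trees of the low levels are
    forgotten, and every placed element returns as a half tree of potential 5; the listed fields are
    the only ones rewritten. *)
Record placed q a lv : Prop := Placed {
  plr : [/\ rg a 2 = M, rg a 6 = L, rg a 11 = q, rg a 10 = nth 0 PP q & q <= L];
  plr4 : [/\ rg a 1 = rg a0 1, rg a 3 = rg a0 3 & rg a 4 = rg a0 4];
  plk : ky a = ky a0;
  plf : forall f y, f \notin [:: 0; 1; 2; 4; 9; 10] -> fd a f y = fd a0 f y;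
  plp : {in PP, forall y, fd a 4 y = if index y PP < q then M - (index y PP + 2) else fd a0 4 y};
  plold : forall j, i <= j -> lv j = lv0 j;
  plnew : forall j y, j < i ->
    (y \in fnodes (lv j)) = (index y PP < q) && (trunc_log 2 (index y PP).+1 == j);
  pluniq : forall j, uniq (fnodes (lv j));
  pllrep : forall j, j <= n -> lrep (fd a) (ky a0) (lv j) (fd a 9 j);
  plcnt : forall j, j <= n -> fd a 10 j = size (fnodes (lv j));
  plpot : \sum_(j < w) fpot (lv j) <= \sum_(j < w) fpot (lv0 j) + 5 * q
}.

Lemma placed_disj q a lv : placed q a lv -> forall j j' y,
  y \in fnodes (lv j) -> y \in fnodes (lv j') -> j = j'.
Proof.
move=> pl j j' y; have [_ _ _ _ qL] := plr pl.
have lo h : h < i -> y \in fnodes (lv h) -> index y PP < L /\ trunc_log 2 (index y PP).+1 = h.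
  by move=> hi; rewrite (plnew pl) // => /andP[h1 /eqP h2]; split=> //; apply: leq_trans h1 qL.
have hi h : i <= h -> y \in fnodes (lv h) -> L <= index y PP.
  by move=> ih; rewrite (plold pl) // => /(old ih)[].
case: (leqP i j) => h1; case: (leqP i j') => h2 y1 y2.
- by rewrite !(plold pl) // in y1 y2; apply: disj y1 y2.
- by have [X _] := lo _ h2 y2; have := hi _ h1 y1; rewrite leqNgt X.
- by have [X _] := lo _ h1 y1; have := hi _ h2 y2; rewrite leqNgt X.
- by have [_ <-] := lo _ h1 y1; have [_ <-] := lo _ h2 y2.
Qed.

Lemma placed_in q a lv j y : placed q a lv -> y \in fnodes (lv j) -> y \in PP.
Proof.
move=> pl; have [_ _ _ _ qL] := plr pl; case: (leqP i j) => h.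
  by rewrite (plold pl) // => /(old h)[].
rewrite (plnew pl) // -index_mem => /andP[h1 _]; apply: leq_trans LP.
exact: leq_trans h1 qL.
Qed.

Lemma placeP q a lv Q : placed q a lv ->
  (forall t a' lv', placed L a' lv' -> t + 300 * q <= 300 * L + 50 -> Q t a') ->
  tri w cplace a Q.
Proof.
have [d] := ubnP (L - q); elim: d q a lv Q => // d IH q a lv Q hd pl HQ.
have [r2 r6 r11 r10 qL] := plr pl.
rewrite /cplace; stp w16; rewrite ?nat_of_bool_neq0 r11 r6; last first.
  move/nat_of_bool_eq0 => h; have e : q = L by move: h qL; clear; lia.
  by apply: (HQ _ _ lv); rewrite -?e //; clear; lia.
move=> lt; have qs : q < size PP by apply: leq_trans lt LP.
set y := nth 0 PP q; have yP : y \in PP by apply: mem_nth.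
have /andP[y0 yn] := Pn yP; have iy : index y PP = q by apply: index_uniq.
set g := trunc_log 2 q.+1; have /andP[b1 b2] := @trunc_log_bounds 2 q.+1 isT isT; rewrite -/g in b1 b2.
have gi : g < i by rewrite -(ltn_exp2l _ _ (isT : 1 < 2)); apply: leq_ltn_trans L2; apply: leq_trans b1 lt.
have i_n : i <= n by rewrite -ltnS; apply: leq_trans i2; apply: ltn_expl.
have gn : g <= n by apply: leq_trans (ltnW gi) i_n.
have ny j : y \notin fnodes (lv j).
  case: (leqP i j) => h; last by rewrite (plnew pl) // iy ltnn.
  rewrite (plold pl) //; apply/negP => /(old h)[]; rewrite iy leqNgt lt //.
have e7 : fd a 7 (q + 1) = g.+1.
  rewrite (plf pl) // addn1 bl //=; move: lt L2 i2; clear; lia.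
have cg : fd a 10 g = size (fnodes (lv g)) by apply: plcnt pl _ gn.
have sg : fd a 10 g <= n.
  by rewrite cg; apply: bounded_size (pluniq pl g) _ _ => z /(placed_in pl)/Pn/andP[].
have Ln : L <= n by move: L2 i2; clear; lia.
have q2M : q + 2 <= M by move: lt LM; clear; lia.
have e7' : fd a 7 (rg a 11 + 1) = g.+1 by rewrite r11.
have sg' : fd a 10 (fd a 7 (rg a 11 + 1) - 1) <= n by rewrite e7' subn1.
do 15!(stp w16); rewrite e7' r11 r10 r2 -/y !subn1 /=.
set a1 := setf _ 10 g _.
have fd1 f z : f \notin [:: 0; 1; 2; 4; 10] -> fd a1 f z = fd a f z.
  by move=> hf; rewrite /= !eqn_neq // => e; rewrite e in hf.
have fd1y f z : z <> y -> f <> 10 -> fd a1 f z = fd a f z.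
  by move=> /eqP/negbTE zy f10; rewrite /= zy !andbF (eqn_neq f10).
have pp : perm_eq (fnodes (lv g ++ [:: (y, E)])) (y :: fnodes (lv g)).
  by rewrite fnodes_cat fnodes_cons; perml.
have up : uniq (fnodes (lv g ++ [:: (y, E)])).
  by rewrite (perm_uniq pp) /= (negbTE (ny g)) (pluniq pl).
have l1 j : j <= n -> lrep (fd a1) (ky a0) (lv j) (fd a 9 j).
  move=> jn; apply: lrep_ext (pllrep pl jn) => //; last exact: pluniq pl j.
  move=> f z f4 zj; apply: fd1y => e; last by rewrite e in f4.
  by move: (ny j); rewrite -e zj.
apply: (@meldP w n _ K W a1 (lv g) [:: (y, E)] g y) => //.
- by rewrite fd1 //= (plk pl); apply: l1.
- by apply: lrep_single => //=; rewrite ?eqxx.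
- move=> z; rewrite (perm_mem pp) inE => /orP[/eqP -> //|/(placed_in pl)/Pn/andP[]] //.
move=> t2 a2 s ht2 ky2 rg2 fd2 fd21 fd29 ps lr2; have ps' := perm_fnodes ps.
have memS z : (z \in fnodes s) = (z == y) || (z \in fnodes (lv g)).
  by rewrite (perm_mem ps') (perm_mem pp) inE.
have r10' : rg a2 10 = y by rewrite rg2.
have r11' : rg a2 11 = q by rewrite rg2.
do 3!(stp w16); rewrite r10' r11' addn1; set a3 := setr _ 11 _.
pose lv' := updl lv g s.
have gw : g < w.
  by rewrite -(ltn_exp2l _ _ (isT : 1 < 2)); move: W b1 lt Ln; clear; lia.
have fd3 f z : f \notin [:: 0; 1; 2; 4; 9; 10] -> fd a3 f z = fd a0 f z.
  move=> hf; rewrite /a3 [LHS]/= fd2; try by move=> e; rewrite e in hf.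
  rewrite fd1 ?(plf pl) //; move: hf; rewrite !inE !negb_or; clear; by case/and5P=> -> -> -> -> /andP[_ ->].
have e5 : fd a2 5 y = nth 0 PP q.+1.
  by rewrite -[LHS]/(fd a3 5 y) fd3 // (dll_nth dl).
have pl' : placed q.+1 a3 lv'.
  split.
  - by split=> //=; rewrite rg2.
  - by have [e1 e3 e4] := plr4 pl; split; rewrite /= rg2.
  - by rewrite /= ky2 /= (plk pl).
  - exact: fd3.
  - move=> z zP /=; rewrite fd2 //=; case: (z =P y) => [->|zy].
      by rewrite iy ltnSn.
    rewrite (plp pl) // ltnS (leq_eqVlt (index z PP)); case: (_ =P q) => //= e.
    by case: zy; rewrite -(nth_index 0 zP) e.
  - by move=> j ij; rewrite /lv' /updl (plold pl) //; case: eqP => // e; move: ij; rewrite e leqNgt gi.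
  - move=> j z ji; rewrite /lv' /updl; case: (j =P g) => [e|jg].
      rewrite memS e (plnew pl) // ltnS (leq_eqVlt (index z PP)); case: (z =P y) => [->|zy] /=.
        by rewrite iy eqxx /= -/g eqxx.
      case: (_ =P q) => //= e'; rewrite e' ltnn /=; case: zy.
      by rewrite /y -e' nth_index // -index_mem e'.
    rewrite (plnew pl) // ltnS (leq_eqVlt (index z PP)); case: (_ =P q) => //= e'.
    by rewrite e' ltnn -/g eq_sym (introF eqP jg).
  - move=> j; rewrite /lv' /updl; case: eqP => // _; last exact: pluniq pl j.
    by rewrite (perm_uniq ps').
  - move=> j jn; rewrite /lv' /updl; case: (j =P g) => [->|jg].
      by move: lr2; rewrite /= (plk pl).
    have -> : fd a3 9 j = fd a 9 j by rewrite /= fd29.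
    apply: lrep_ext (l1 j jn) => //; last exact: pluniq pl j.
    move=> f z f4 zj /=; case: (f =P 1) => [->|f1]; last by rewrite fd2 // => e; rewrite e in f4.
    apply: fd21; apply/negP => /roots_sub; rewrite (perm_mem pp) inE => /orP[/eqP e|zg].
      by move: (ny j); rewrite -e zj.
    by apply: jg; apply: placed_disj pl _ _ _ zj zg.
  - move=> j jn /=; rewrite fd2 //= /lv' /updl; case: (j =P g) => [_|jg]; last by rewrite (plcnt pl).
    by rewrite (perm_size ps') (perm_size pp) /= cg addn1.
  - have := sum_updl lv s gw; rewrite -/lv' (perm_fpot ps) fpot_cat; have := plpot pl.
    have -> : fpot [:: (y, E)] = 5 by []; clear.
    by move: (\sum_(j < w) _) (\sum_(j < w) _) (\sum_(j < w) _) => *; lia.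
apply: (IH _ _ _ _ _ pl'); first by move: hd lt; clear; lia.
move=> t a' lv'' pl'' ht; apply: (HQ _ _ _ pl''); move: ht ht2; clear; lia.
Qed.

End Place.
End Procedures.

Lemma sorted_gtn_index P y z : sorted gtn P -> y \in P -> z \in P -> y < z ->
  index z P < index y P.
Proof.
move=> so yP zP lt; have tr : transitive gtn by move=> a b c /=; clear; lia.
case: (ltngtP (index z P) (index y P)) => // [h|e].
  by have := sorted_ltn_index tr so _ _ yP zP h; rewrite /= ltnNge (ltnW lt).
have e' : z = y by rewrite -(nth_index 0 zP) e nth_index.
by rewrite e' ltnn in lt.
Qed.

(** In a decreasing list, the elements up to [y] are those not older than [y]: the index gives the
    size of the working set at the present moment. *)
Lemma count_ge_index P y : sorted gtn P -> y \in P ->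
  (index y P).+1 = size [seq z <- P | y <= z].
Proof.
elim: P => //= h P IH pa; rewrite inE.
have : path gtn h P by []; rewrite path_sortedE; last by move=> y1 y2 y3 /=; clear; lia.
case/andP=> /allP lt so; case: (h =P y) => [e _|hy].
  rewrite e leqnn /=; congr _.+1; apply/esym/eqP; rewrite size_filter eqn0Ngt -has_count.
  by apply/hasPn => z /lt /=; rewrite -ltnNge e.
rewrite eq_sym (introF eqP hy) /= => yP.
by rewrite (ltnW (lt y yP)) /= IH.
Qed.

Section Procedures.
Variables (w m : nat) (disp : Order.disp_t) (K : orderType disp).
Notation n := m.+1.
Hypothesis W : 256 * n.+1 <= 2 ^ w.
Let w16 := w16 W.
Implicit Types (a : ast K) (Q : nat -> ast K -> Prop).

(** The counter becomes [M.+1 - 2 ^ i] and one element is added, so the free positions decrease by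
    [2 ^ i]; this pays for placing fewer than [2 ^ i] elements and for work linear in [i]. The
    element at index [q] has [q.+1] elements in its current working set and enters the level [j]
    with [2 ^ j <= q.+1]. *)
Lemma rebuildP M P F0 (k : nat -> K) lv i a Q : mid m M P F0 k lv i a ->
  odd (M %/ 2 ^ i) -> (\sum_(j < i) size (fnodes (lv j))).+1 < 2 ^ i ->
  (forall t a' lv', str n (rg a' 2) (n :: P) (fd a') (ky a) lv' ->
     ky a' = ky a -> rg a' 1 = n -> rg a' 3 = rg a 3 -> rg a' 4 = i ->
     (forall j, i < j -> lv' j = lv j) ->
     (forall j y, y \in fnodes (lv' j) ->
        y \in fnodes (lv j) \/ 2 ^ j <= 2 * size [seq z <- n :: P | y <= z]) ->
     t + phi w (rg a' 2) 0 (n :: P) lv' + 400 * i <= phi w M 0 P lv + 60 * 100 ->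
     Q t a') ->
  tri w crebuild a Q.
Proof.
move=> md od; set L := (\sum_(j < i) _).+1 => L2 HQ; have dv := mddv md.
have S := mdS md; have [r1 r2] := mdr md; have [r4 r5 r6] := mdr4 md; rewrite -/L in r6.
have /andP[M0 Mm] := sM S; have i_n := mid_in md; have i2 := mid_i md.
have Mge := lower_ge od; have Meq := lower_eq dv; set M' := M.+1 - 2 ^ i in Meq *.
have M'0 : 0 < M' by move: Mge; rewrite /M'; clear; lia.
have dv' : 2 ^ i %| M' by rewrite Meq dvdn_mull.
have M'i := dvdn_leq M'0 dv'.
rewrite /crebuild; do 5!(stp w16); rewrite r4.
pose p y := C M i <= F0 4 y.
have LE : L = (count p P).+1 by rewrite /L (cnt_low S).
have pup : {in P &, forall z1 z2, z1 < z2 -> p z1 -> p z2}.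
  by move=> z1 z2 h1 h2 lt /leq_trans; apply; apply: ltnW; apply: (spos S).
have pold j y : i <= j -> y \in fnodes (lv j) -> ~~ p y.
  move=> ij yj; have [_ /andP[_ h]] := slev S yj.
  by rewrite /p -ltnNge; apply: leq_trans h (C_anti M ij).
have pnew j y : j < i -> y \in fnodes (lv j) -> p y.
  move=> ji yj; have [_ /andP[h _]] := slev S yj.
  by apply: leq_trans h; apply: C_anti.
have idx y : y \in P -> index y (n :: P) = (index y P).+1.
  by move=> yP /=; case: eqP => // e; move: (mid_nP md); rewrite e yP.
have iold j y : i <= j -> y \in fnodes (lv j) -> L <= index y (n :: P) /\ y \in n :: P.
  move=> ij yj; have yP := mid_lv md yj; rewrite inE yP orbT idx // LE ltnS; split=> //.
  by apply: index_ge => //; [exact: sP S|exact: pold yj].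
apply: (@clearP w n _ K W _ i) => //=; rewrite ?r4 //.
  exact: leqW.
move=> t1 a1 ht1 fd1 ky1 rg1; have dl1 : dll (fd a1) (n :: P).
  have [d1 d2] := mddll md; split; last by move=> y yP; rewrite !fd1 /= d2.
  by rewrite (eq_cycle (e' := frel (fd a 5))) // => y1 y2 /=; rewrite fd1.
do 4!(stp w16); rewrite (dll_head dl1) /=; set a3 := setr _ 11 0.
have fd3 f y : f <> 9 -> f <> 10 -> fd a3 f y = fd a f y.
  by move=> f9 f10; rewrite /a3 /= fd1 (introF eqP f9) (introF eqP f10).
pose lv0 j := if j < i then [::] else lv j.
have lv0E j : i <= j -> lv0 j = lv j by rewrite /lv0 leqNgt => /negbTE ->.
have lv0N j : j < i -> lv0 j = [::] by rewrite /lv0 => ->.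
have LM : L < M' by apply: leq_trans L2 M'i.
have pl0 : placed w n (n :: P) i L M' lv0 a3 0 a3 lv0.
  split=> //.
  - by split=> //=; rewrite rg1 //= ?r2 ?r5 ?r6 ?addn1.
  - by move=> j y ji; rewrite lv0N.
  - by move=> j; rewrite /lv0; case: ifP => // _; apply: (suniq S).
  - move=> j jn; rewrite /a3 /= fd1 /= ky1; case: (ltnP j i) => ji.
      by rewrite lv0N //; apply: lrep_nil.
    rewrite lv0E // (md9 md) // ltnNge ji /=.
    apply: lrep_ext (mid_lrep md j) => //; last exact: (suniq S).
    by move=> f y f4 _; rewrite fd3 // => e; rewrite e in f4.
  - move=> j jn; rewrite /a3 /= fd1 /=; case: (ltnP j i) => ji; first by rewrite lv0N.
    by rewrite lv0E // (md10 md) // ltnNge ji.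
  - by rewrite addn0.
have LP : L <= size (n :: P) by rewrite LE /= ltnS count_size.
apply: (@placeP w n _ K W (n :: P) i L M' lv0 a3 _ _ _ _ _ _ _ _ _ _ _ 0 a3 lv0 _ pl0) => //.
- exact: mid_uniq md.
- exact: mid_n md.
- by move: M'0; rewrite /M'; move: Mm; clear; lia.
- by move=> j y ij; rewrite lv0E //; apply: iold.
- by move=> j j' y ij ij'; rewrite !lv0E //; apply: (node_disj S).
- by move=> s sn; rewrite fd3 // (mdbl md).
move=> t2 a2 lv' pl ht2.
have [p2 p6 p11 p10 _] := plr pl; have [q1 q3 q4] := plr4 pl.
have pE y : y \in P -> L <= index y (n :: P) -> fd a2 4 y = F0 4 y.
  move=> yP h; rewrite (plp pl) ?inE ?yP ?orbT // ltnNge h /= fd3 // (mdf md) //.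
have pN y : y \in n :: P -> index y (n :: P) < L -> fd a2 4 y = M' - (index y (n :: P) + 2).
  by move=> yP h; rewrite (plp pl) // h.
have inE' y : y \in n :: P -> L <= index y (n :: P) -> y \in P.
  by rewrite inE => /orP[/eqP ->|//]; rewrite /= eqxx LE.
have Lp y : y \in P -> L <= index y (n :: P) -> ~~ p y.
  move=> yP; rewrite idx // LE ltnS; apply: contraTN => py; rewrite -ltnNge.
  by apply: index_lt => //; exact: sP S.
have CM : C M' i = M' - 2 ^ i by rewrite /C divnK.
have CMi : C M' i = C M i by exact: (C_lower_hi dv (leqnn i)).
have f5 f y : f \in [:: 5; 6; 7; 8; 11; 3] -> fd a2 f y = fd a f y.
  by move=> h; rewrite (plf pl) ?fd3 //; [move=> e|move=> e|]; move: h; rewrite ?e // !inE; case/or4P => [|||/or3P[]] /eqP ->.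
have S' : str n M' (n :: P) (fd a2) (ky a) lv'.
  split.
  - by rewrite M'0 /=; move: M'0; rewrite /M'; move: Mm; clear; lia.
  - exact: mid_sorted md.
  - exact: mid_n md.
  - have [d1 d2] := mddll md; split; last by move=> y yP; rewrite !f5 // d2.
    by rewrite (eq_cycle (e' := frel (fd a 5))) // => y1 y2 /=; rewrite f5.
  (* The [L] most recent elements are put at or above [C M' i = C M i], in order of age, and the
     others keep positions below that boundary. *)
  - move=> y1 y2 h1 h2 lt; have li := sorted_gtn_index (mid_sorted md) h1 h2 lt.
    case: (ltnP (index y1 (n :: P)) L) => i1; case: (ltnP (index y2 (n :: P)) L) => i3.
    + by rewrite !pN //; move: li i1 LM; clear; lia.
    + by have := leq_trans i3 (ltnW (leq_trans li (ltnW i1))); move: i3 li i1; clear; lia.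
    + rewrite (pN y2) // (pE y1) ?inE' //; have := Lp _ (inE' _ h1 i1) i1; rewrite /p -ltnNge -CMi CM.
      by move: i3 L2 M'i; clear; move: (2 ^ i) => *; lia.
    + by rewrite !pE ?inE' //; apply: (spos S); rewrite ?inE'.
  - move=> j y yj; case: (leqP i j) => ij.
      have yl : y \in fnodes (lv j) by move: yj; rewrite (plold pl) // lv0E.
      have [h1 h2] := iold j y ij yl; have yP := inE' _ h2 h1; split=> //.
      have [_] := slev S yl; rewrite pE // /inlev.
      by rewrite !(C_lower_hi dv) // leqW.
    move: yj; rewrite (plnew pl) // => /andP[h1 /eqP h2].
    have yP : y \in n :: P by rewrite -index_mem (leq_trans h1).
    by split=> //; rewrite pN // -h2; apply: inlev_lower dv' M'0 _; move: h1 L2; clear; lia.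
  - move=> y yP; case: (ltnP (index y (n :: P)) L) => iy.
      exists (trunc_log 2 (index y (n :: P)).+1); rewrite (plnew pl) ?iy ?eqxx //.
      rewrite -(ltn_exp2l _ _ (isT : 1 < 2)); apply: leq_ltn_trans (@trunc_logP 2 (index y (n :: P)).+1 isT isT) _.
      exact: leq_ltn_trans iy L2.
    have yP' := inE' _ yP iy; have [j yj] := scov S yP'; exists j.
    have ij : i <= j by rewrite leqNgt; apply/negP => /pnew/(_ yj); rewrite (negbTE (Lp _ yP' iy)).
    by rewrite (plold pl) // lv0E.
  - exact: pluniq pl.
  - by move=> j jn; have := pllrep pl jn; rewrite /a3 /= ky1.
  - exact: plcnt pl.
  - by move=> s sn; rewrite f5 // (mdbl md).
  - by move=> s sn; rewrite f5 // (mdlsb md).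
  - by rewrite !f5 //; apply: mdtab0 md.
  - by move=> s sn; rewrite f5 // (mdslot md).
  - by rewrite f5 // (mdrk0 md).
apply: (HQ _ _ lv'); rewrite ?p2 //.
- by rewrite (plk pl) /a3 /= ky1.
- by rewrite q1 /a3 /= rg1.
- by rewrite q3 /a3 /= rg1.
- by rewrite q4 /a3 /= rg1.
- by move=> j ij; rewrite (plold pl) ?lv0E // ltnW.
- move=> j y yj; case: (leqP i j) => ij; first by left; move: yj; rewrite (plold pl) // lv0E.
  right; move: yj; rewrite (plnew pl) // => /andP[h1 /eqP h2].
  have yP : y \in n :: P by rewrite -index_mem (leq_trans h1).
  rewrite -(count_ge_index (mid_sorted md) yP) -h2.
  by apply: leq_trans (@trunc_logP 2 (index y (n :: P)).+1 isT isT) _; clear; lia.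
have := size_P S'; have := plpot pl; have := popc_lower dv w.
have : \sum_(j < w) fpot (lv0 j) <= \sum_(j < w) fpot (lv j).
  by apply: leq_sum => j _; rewrite /lv0; case: ifP.
have : i < 2 ^ i by apply: ltn_expl.
rewrite /phi /= -/M'; have Z : popc w 0 = 0 by apply: big1 => j _; rewrite /bit div0n.
have eM : M' = M.+1 - 2 ^ i by [].
rewrite Z; move: ht1 ht2 L2 Mge eM; clearbody M' L; clear.
move: (popc w M) (popc w M') (size P) (2 ^ i) (\sum_(j < w) _) (\sum_(j < w) _) (\sum_(j < w) _) => *.
lia.
Qed.

End Procedures.

(** * The complete insertion *)

Definition cinsert : hcmd :=
  cnew ;;
  ccarry ;;
  HIf (HV 7 %! HC 2) crebuild cfinish ;;
  HSet 24 (HV 4) ;;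
  crefresh ;;
  HSet 0 (HV 1).

Section Procedures.
Variables (w m : nat) (disp : Order.disp_t) (K : orderType disp).
Notation n := m.+1.
Hypothesis W : 256 * n.+1 <= 2 ^ w.
Let w16 := w16 W.
Implicit Types (a : ast K) (Q : nat -> ast K -> Prop).

Lemma insertP a P lv Q :
  str m (rg a 2) P (fd a) (ky a) lv -> rg a 1 = m ->
  (forall j, bit j (rg a 3) <-> isrec (mu lv) (ky a) j) ->
  (forall t a' lv', str n (rg a' 2) (n :: P) (fd a') (ky a') lv' ->
     (forall j, bit j (rg a' 3) <-> isrec (mu lv') (ky a') j) ->
     rg a' 0 = n -> rg a' 1 = n -> ky a' n = ky a 0 ->
     (forall y, y <> n -> ky a' y = ky a y) ->
     (forall j y, y \in fnodes (lv' j) ->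
        y \in fnodes (lv j) \/ 2 ^ j <= 2 * size [seq z <- n :: P | y <= z]) ->
     t + phi w (rg a' 2) (rg a' 3) (n :: P) lv' <= phi w (rg a 2) (rg a 3) P lv + 100 * 100 ->
     Q t a') ->
  tri w cinsert a Q.
Proof.
move=> S r1 hR HQ; have /andP[M0 Mm] := sM S; set M := rg a 2 in S M0 Mm HQ.
have nP : n \notin P by apply/negP => /(sPn S)/andP[_]; rewrite ltnn.
have Pn y : y \in P -> y <> n by move=> yP e; rewrite -e yP in nP.
have lvm j : m < j -> lv j = [::].
  by move=> h; apply: (lv_top S); apply: leq_trans (top_n S) (ltnW h).
rewrite /cinsert; stp w16; apply: (@newP w m _ K W M P lv a _ S r1) => t1 a1 ht1 rg1 r11 kn1 ko1 fo1 x1 bl1 lsb1 s11 dl1.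
have [x10 x11 x12 x19 x110] := x1.
have e9 j : j <= n -> fd a1 9 j = mu lv j.
  rewrite leq_eqVlt ltnS => /orP[/eqP ->|jm]; first by rewrite x19 /mu lvm.
  by rewrite fo1 ?(mu_mn S) // => e; rewrite e ltnn in jm.
have e10 j : j <= n -> fd a1 10 j = size (fnodes (lv j)).
  rewrite leq_eqVlt ltnS => /orP[/eqP ->|jm]; first by rewrite x110 lvm.
  by rewrite fo1 ?(scnt S) // => e; rewrite e ltnn in jm.
have Ln i : (\sum_(j < i) size (fnodes (lv j))).+1 <= n.
  rewrite ltnS (cnt_low S); apply: leq_trans (count_size _ _) _.
  by apply: leq_trans (size_P S) _; move: M0 Mm; clear; lia.
have Mn : 0 < M <= n by rewrite M0.
have r12 : rg a1 2 = M by rewrite rg1.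
stp w16; apply: (@carryP w m _ K W M (mu lv) (fun j => size (fnodes (lv j))) Mn Ln a1 _ r11 r12 e9 e10).
move=> t2 a2 i ht2 [[q4 q5 q6 q7] [q8 q9] [dv ev] [g9 g10 go] [kE rE]] od.
have sh9 j : (if j is j'.+1 then mu lv j' else n) = mu (shift lv n) j by case: j.
have sh10 j : (if j is j'.+1 then size (fnodes (lv j')) else 1) = size (fnodes (shift lv n j)) by case: j.
have f2 f y : f <> 9 -> f <> 10 -> f <> 5 -> f <> 6 -> y <> n -> fd a2 f y = fd a f y.
  by move=> f9 f10 f5 f6 yn; rewrite go // fo1.
have md : mid m M P (fd a) (ky a) lv i a2.
  split.
  - exact: S.
  - by move=> y yP; rewrite kE ko1 //; apply: Pn.
  - have [d1 d2] := dl1; split; last by move=> y yP; rewrite !go // d2.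
    by rewrite (eq_cycle (e' := frel (fd a1 5))) // => y1 y2 /=; rewrite go.
  - by move=> s sn; rewrite go // bl1.
  - by move=> s sn; rewrite go // lsb1.
  - by rewrite !f2 //; apply: stab0 S.
  - move=> r /andP[r0]; rewrite leq_eqVlt ltnS go // => /orP[/eqP -> //|rn].
    by rewrite fo1 ?(sslot S) ?r0 // => e; rewrite e ltnn in rn.
  - by rewrite f2 // (srk0 S).
  - move=> f y ff yP; by apply: f2; [| | | |exact: Pn] => e; rewrite e in ff.
  - by rewrite !go.
  - by move=> j jn; rewrite g9 sh9 e9.
  - by move=> j jn; rewrite g10 sh10 e10 //; case: ifP.
  - by rewrite !rE.
  - by [].
  - by rewrite q8 q9 sh9 sh10.
  - exact: dv.
  - exact: ev.
have i_n := mid_in md.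
have i2 := mid_i md.
have iw : i < w by rewrite -(ltn_exp2l _ _ (isT : 1 < 2)); move: W i2; clear; lia.
(* The end of the program, shared by both branches: only the bits up to [i] can have changed. [t0]
   stands for the time of the test. *)
have fin : forall t a' lv', str n (rg a' 2) (n :: P) (fd a') (ky a2) lv' ->
     ky a' = ky a2 -> rg a' 1 = n -> rg a' 3 = rg a2 3 -> rg a' 4 = i ->
     (forall j, i < j -> lv' j = lv j) ->
     (forall j y, y \in fnodes (lv' j) ->
        y \in fnodes (lv j) \/ 2 ^ j <= 2 * size [seq z <- n :: P | y <= z]) ->
     t + phi w (rg a' 2) 0 (n :: P) lv' + 400 * i <= phi w M 0 P lv + 60 * 100 ->
     tri w (HSet 24 (HV 4) ;; crefresh ;; HSet 0 (HV 1)) a'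
       (fun t3 a3 => forall t0, t0 <= 20 -> Q (t1 + (t2 + (t0 + t + t3))) a3).
  move=> t a3 lv' S3 ky3 r31 r33 r34 hi evd ht.
  have R3 : rg a3 3 = rg a 3 by rewrite r33 rE // rg1.
  do 3!(stp w16); rewrite r34.
  apply: (@refreshP w n _ K W (mu lv') (top (rg a3 2)) (mu_top S3) (top_le S3) (mu_n S3) i) => //=.
  - exact: mu_mn S3.
  - exact: slsb S3.
  - move=> j ij; rewrite R3 ky3 (hR j) (isrec_hi (m := mu lv) (m' := mu lv')); last first.
      by move=> j' jj'; rewrite /mu hi //; apply: leq_trans ij jj'.
    apply: iff_sym; apply: isrec_ext => j' nz; rewrite kE ko1 //; apply: Pn.
    by have [] := slev S (mu_node nz).
  move=> t4 a4 ht4 fd4 ky4 rg4; rewrite R3 => pc4 hR4.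
  stp w16.
  move=> t0 ht0; apply: (HQ _ _ lv') => //=.
  - by rewrite fd4 ky4 ky3 rg4 //=.
  - by move=> j; rewrite (hR4 j) ky4.
  - by rewrite rg4.
  - by rewrite rg4.
  - by rewrite ky4 ky3 kE.
  - by move=> y yn; rewrite ky4 ky3 kE ko1.
  rewrite rg4 //=; move: ht; rewrite /phi; have Z : popc w 0 = 0 by apply: big1 => j _; rewrite /bit div0n.
  rewrite Z; move: ht0 ht1 ht2 ht4 pc4; clear.
  move: (popc w M) (popc w (rg a3 2)) (popc w (rg a4 3)) (popc w (rg a 3)) (\sum_(j < w) _) (\sum_(j < w) _) (100 * 100 * (_ - _)) (100 * 100 * (_ - _)) => *.
  lia.
stp w16; stp w16; rewrite q7 modn2.
  rewrite nat_of_bool_neq0 => o; apply: (rebuildP W md o); first by move: od; rewrite o.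
  move=> t a3 lv' h1 h2 h3 h4 h5 h6 h7 h8; apply: tri_conseq (fin t a3 lv' h1 h2 h3 h4 h5 h6 h7 h8).
  by move=> t3 a4 X; apply: (X ((1 + 1).+1).+1).
move/nat_of_bool_eq0/negbT => o; apply: (finishP W md o).
move=> t a3 lv' h1 h2 h3 h4 h5 h6 h7 h8; apply: tri_conseq (fin t a3 lv' h1 h2 h3 h4 h5 h6 h7 h8).
by move=> t3 a4 X; apply: (X ((1 + 1).+1).+1).
Qed.

End Procedures.

(** * Runs *)

Definition cfind : hcmd :=
  HSet 4 (HF 9 (HF 8 (HV 3))) ;;
  HSet 0 (HV 4) ;;
  HKey (HC 0) (HV 4).

(** The memory may contain anything: only record 0, which also serves level 0, is prepared here, and
    [cnew] sets up every other record when its element arrives. *)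
Definition cinit : hcmd :=
  HSet 1 (HC 0) ;;
  HSet 2 (HC 1) ;;
  HSet 3 (HC 0) ;;
  HPut 3 (HC 0) (HC 0) ;;
  HPut 5 (HC 0) (HC 0) ;;
  HPut 6 (HC 0) (HC 0) ;;
  HPut 7 (HC 0) (HC 0) ;;
  HPut 8 (HC 0) (HC 0) ;;
  HPut 9 (HC 0) (HC 0) ;;
  HPut 10 (HC 0) (HC 0).

Definition queue : pq_program :=
  PQProgram (ccmd cinit) (ccmd cinsert) (ccmd cextract) (ccmd cdecrease) (ccmd cfind).

(** Element [x] of a history is record [x.+1], since record 0 is the sentinel. *)
Lemma rem_map_S x s : [seq y.+1 | y <- rem x s] = rem x.+1 [seq y.+1 | y <- s].
Proof. by elim: s => //= y s <-; rewrite eqSS; case: ifP. Qed.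

Lemma mem_map_S x s : (x.+1 \in [seq y.+1 | y <- s]) = (x \in s).
Proof. by rewrite mem_map // => y z []. Qed.

Section Procedures.
Variables (w : nat) (disp : Order.disp_t) (K : orderType disp).
Implicit Types (a : ast K) (Q : nat -> ast K -> Prop) (h : history K) (s : state w K).

Section Word.
Variable n : nat.
Hypothesis W : 256 * n.+1 <= 2 ^ w.
Let w16 := w16 W.

Lemma initP a Q :
  (forall t a', t <= 200 -> str 0 (rg a' 2) [::] (fd a') (ky a') (fun=> [::]) ->
     rg a' 1 = 0 -> rg a' 2 = 1 -> rg a' 3 = 0 -> Q t a') ->
  tri w cinit a Q.
Proof.
move=> HQ; rewrite /cinit; do 19!(stp w16).
apply: HQ => //; split=> //=; try by case.
- by split=> // x; rewrite inE => /eqP ->.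
Qed.

Lemma findP a P lv Q :
  str n (rg a 2) P (fd a) (ky a) lv ->
  (forall j, bit j (rg a 3) <-> isrec (mu lv) (ky a) j) -> P <> [::] ->
  (forall t a' x, t <= 100 -> x \in P -> {in P, forall y, (ky a x <= ky a y)%O} ->
     fd a' = fd a -> (forall r, 0 < r < 4 -> rg a' r = rg a r) -> rg a' 0 = x ->
     ky a' 0 = ky a x -> (forall y, y <> 0 -> ky a' y = ky a y) -> Q t a') ->
  tri w cfind a Q.
Proof.
move=> S hR P0 HQ.
have [x0 x0P] : exists x, x \in P by case: (P) P0 => // x ? _; exists x; rewrite inE eqxx.
have [j0 x0j] := scov S x0P.
have m0 : mu lv j0 <> 0 by move/(mu_nil S) => e; rewrite e in x0j.
have [R0 ir _] := rec_min (mu_top S) hR m0.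
set g := logn 2 (rg a 3) in ir; have mg : mu lv g <> 0 by case: ir.
have gn : g <= n := node_le S (mu_node mg).
have Rn : rg a 3 <= n.
  rewrite -ltnS; apply: leq_trans (top_le S); apply: (rec_bound (mu_top S) (k := ky a)) => j.
  by move/hR.
have e8 : fd a 8 (rg a 3) = g by rewrite (slsb S) // R0.
have r8n : fd a 8 (rg a 3) <= n by rewrite e8.
have e9 : fd a 9 (fd a 8 (rg a 3)) = mu lv g by rewrite e8 (mu_mn S gn).
have mn := mu_n S g.
have /andP[xp xn] := node_n S (mu_node mg).
rewrite /cfind; do 5!(stp w16); rewrite e9.
apply: (HQ _ _ (mu lv g)) => //=.
- by case: (slev S (mu_node mg)).
- move=> y yP; have [j yj] := scov S yP; have jn := node_le S yj.
  have mj : mu lv j <> 0 by move/(mu_nil S) => e; rewrite e in yj.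
  have [_ _ le] := rec_min (mu_top S) hR mj; apply: le_trans le _.
  by rewrite -(mu_mn S jn); apply: lrep_min (slrep S jn) _ _.
- by case=> [|[|[|[|]]]].
- by move=> y /eqP/negbTE ->.
Qed.

Lemma sim_setk s a k : sim s a -> sim (set_key s (mkword w 0) k) (setk a 0 k).
Proof.
case=> h1 h2 h3; split=> //= i iw; rewrite /upd -val_eqE /= !modn_small ?expn_gt0 //.
by case: eqP => // _; apply: h3.
Qed.

Lemma sim_setr s a r (v : word w) : sim s a -> sim (set_reg s r v) (setr a r v).
Proof.
case=> h1 h2 h3; split=> //= r'; rewrite /upd.
by have -> : (r' == r) = eqn r' r by []; case: eqn.
Qed.

End Word.

Lemma sim_init s : sim s (Ast (fun r => reg s r) (fun f i => wmem s (mkword w (i * 16 + f)))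
  (fun i => kmem s (mkword w i))).
Proof. by split. Qed.

(** * The invariant of a run and its budget *)

Fixpoint budget h : nat :=
  match h with
  | [::] => 1000
  | EvExtractMin x :: h' => budget h' + 1000 * 100 * (trunc_log 2 (2 * size (working_set h' x))).+1
  | _ :: h' => budget h' + 100 * 100
  end.

(** A set that was large at one past moment bounds [working_set] from below; this is how evidence
    survives later extractions. *)
Lemma working_set_max h x t : t <= size h -> x \in present h -> x \in present (drop t h) ->
  size (working_set_at (drop t h) x) <= size (working_set h x).
Proof.
move=> th x0 xt; rewrite /working_set.
case: arg_maxnP => [|u _ mx]; first by rewrite /= drop0.
by have := mx (Ordinal (th : t < (size h).+1)) xt.
Qed.

(** [inv_evid] asks for a large working set at some past moment, not now. It is created by the
    insertion that raises or places the element and is never lost afterwards, whereas the current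
    set may shrink. *)
Record inv (g : config w K) (T : nat) a (lv : nat -> seq htree) : Prop := Inv {
  inv_sim : sim (mach g) a;
  inv_r1 : rg a 1 = insertions (hist g);
  inv_str : str (insertions (hist g)) (rg a 2) [seq x.+1 | x <- present (hist g)] (fd a) (ky a) lv;
  inv_rec : forall j, bit j (rg a 3) <-> isrec (mu lv) (ky a) j;
  inv_key : {in present (hist g), forall x, key (hist g) x = Some (ky a x.+1)};
  inv_handle : {in present (hist g), forall x, handle g x = x.+1 :> nat};
  inv_evid : forall j x, x.+1 \in fnodes (lv j) -> exists t,
    [/\ t <= size (hist g), x \in present (drop t (hist g)) &
        2 ^ j <= 2 * size (working_set_at (drop t (hist g)) x)];
  inv_pot : T + phi w (rg a 2) (rg a 3) [seq x.+1 | x <- present (hist g)] lv <= budget (hist g)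
}.

Lemma inv_init s : fits 256 w 0 -> exists t s',
  exec (pq_init queue) s t s' /\ exists a lv, inv (Config [::] (fun=> mkword w 0) s') t a lv.
Proof.
move=> W; have [] := @initP 0 W _ (fun t a => t <= 200 /\
  str 0 (rg a 2) [::] (fd a) (ky a) (fun=> [::]) /\ rg a 1 = 0 /\ rg a 2 = 1 /\ rg a 3 = 0) _ s (sim_init s).
  by move=> t a ht S r1 r2 r3.
move=> t [s' [a [e sm [ht [S [r1 [r2 r3]]]]]]]; exists t, s'; split=> //; exists a, (fun=> [::]); split=> //=.
  by move=> j; rewrite r3 /bit div0n; split=> // -[].
rewrite r2 r3 /phi; have -> : popc w 0 = 0 by apply: big1 => j _; rewrite /bit div0n.
have -> : \sum_(j < w) fpot [::] = 0 by apply: big1.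
have : popc w 1 <= 1.
  have := @popc_incr 0 0 _ _ w; rewrite !expn0 => /(_ isT isT isT).
  have -> : popc w 0 = 0 by apply: big1 => j _; rewrite /bit div0n.
  by rewrite addn0.
by move: ht; clear; lia.
Qed.

(** A history grows at its head, so the same past moment is reached by dropping one more event. *)
Lemma evid_cons h e j x : (exists t,
    [/\ t <= size h, x \in present (drop t h) & 2 ^ j <= 2 * size (working_set_at (drop t h) x)]) ->
  exists t, [/\ t <= size (e :: h), x \in present (drop t (e :: h)) &
    2 ^ j <= 2 * size (working_set_at (drop t (e :: h)) x)].
Proof. by case=> t [h1 h2 h3]; exists t.+1. Qed.

Lemma inv_insert g T a lv k : inv g T a lv -> fits 256 w (insertions (hist g)).+1 ->
  exists t g', serve queue g (Insert k) t g' /\ exists a' lv', inv g' (T + t) a' lv'.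
Proof.
case: g => h hd s [/= sm r1 S hR hk hh evd pot] W.
set m := insertions h in r1 S W; set P := [seq x.+1 | x <- present h] in S pot.
have S0 : str m (rg a 2) P (fd a) (ky (setk a 0 k)) lv.
  by apply: str_key S => y /eqP/negbTE y0; rewrite /= y0.
have hR0 j : bit j (rg a 3) <-> isrec (mu lv) (ky (setk a 0 k)) j.
  by rewrite hR; apply: iff_sym; apply: isrec_ext => i /eqP/negbTE i0; rewrite /= i0.
pose Q t (a' : ast K) := exists lv', [/\ [/\ str m.+1 (rg a' 2) (m.+1 :: P) (fd a') (ky a') lv',
     forall j, bit j (rg a' 3) <-> isrec (mu lv') (ky a') j, rg a' 0 = m.+1 & rg a' 1 = m.+1],
     ky a' m.+1 = k, forall y, y <> m.+1 -> y <> 0 -> ky a' y = ky a y,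
     forall j y, y \in fnodes (lv' j) ->
        y \in fnodes (lv j) \/ 2 ^ j <= 2 * size [seq z <- m.+1 :: P | y <= z] &
     t + phi w (rg a' 2) (rg a' 3) (m.+1 :: P) lv' <= phi w (rg a 2) (rg a 3) P lv + 100 * 100].
have [] := @insertP w m _ K W (setk a 0 k) P lv Q S0 r1 hR0 _ _ (sim_setk k sm).
  move=> t a' lv' S' hR' r0 r1' kx ko ev pt; exists lv'; split=> //.
  by move=> y yx /eqP/negbTE y0; rewrite ko //= y0.
move=> t [s' [a' [ex sm' [lv' [[S' hR' r0 r1'] kx ko ev pt]]]]].
have pP x : x \in present h -> x < m by move=> xp; have /andP[] : 0 < x.+1 <= m by apply: (sPn S); rewrite mem_map_S.
have rx : reg s' 0 = m.+1 :> nat by rewrite (sim_reg sm').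
exists t, (Config (EvInsert k :: h) (upd hd m (reg s' 0)) s'); split.
  apply: serve_insert => // y yp /(congr1 val) /=; rewrite rx hh // => -[e].
  by have := pP y yp; rewrite e ltnn.
exists a', lv'; split=> //=.
- move=> x; rewrite inE -/m; case: (x =P m) => [-> _|xm /= xp]; first by rewrite kx.
  by rewrite hk // ko // => -[].
- move=> x; rewrite inE -/m /upd; case: (x =P m) => [->|_] //=; exact: hh.
- move=> j x /[dup] xj /ev[xj'|le]; first by apply: evid_cons; apply: evd.
  exists 0; split=> //=.
    by have [+ _] := slev S' xj; rewrite -/m -/[seq _ | _ <- _] -map_cons mem_map_S.
  apply: leq_trans le _; rewrite leq_pmul2l // !size_filter /= -/m.
  by rewrite /P count_map.
- move: pot pt; rewrite -/m; clear; move: (phi _ _ _ _ _) (phi _ _ _ _ _) (budget h) => *; lia.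
Qed.

Lemma inv_extract g T a lv : inv g T a lv -> valid (hist g) ExtractMin -> fits 256 w (insertions (hist g)) ->
  exists t g', serve queue g ExtractMin t g' /\ exists a' lv', inv g' (T + t) a' lv'.
Proof.
case: g => h hd s [/= sm r1 S hR hk hh evd pot] P0 W.
set m := insertions h in r1 S W; set P := [seq x.+1 | x <- present h] in S pot.
have P0' : P <> [::] by rewrite /P; case: (present h) P0.
pose Q t (a' : ast K) := exists lv' x g, [/\ [/\ x \in fnodes (lv g), x \in P &
       {in P, forall y, (ky a x <= ky a y)%O}],
     [/\ str m (rg a 2) (rem x P) (fd a') (ky a') lv',
       forall j, bit j (rg a' 3) <-> isrec (mu lv') (ky a') j,
       rg a' 1 = rg a 1, rg a' 2 = rg a 2 & rg a' 0 = x],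
     ky a' 0 = ky a x /\ forall y, y <> 0 -> ky a' y = ky a y,
     forall j y, y \in fnodes (lv' j) -> y \in fnodes (lv j) &
     t + phi w (rg a 2) (rg a' 3) (rem x P) lv' <= phi w (rg a 2) (rg a 3) P lv + 1000 * 100 * g.+1].
have [] := @extractP w m _ K W a P lv Q S hR P0' _ _ sm.
  by move=> t a' lv' x g h1 h2 h3 h4 h5 h6 h7 h8 h9 h10 h11 h12; exists lv', x, g.
move=> t [s' [a' [ex sm' [lv' [x' [g [[xg xP xmin] [S' hR' r1' r2' r0'] [k0 ko] sub pt]]]]]]].
case: x' xg xP xmin S' r0' k0 pt => [|x] xg xP xmin S' r0' k0 pt; first by have := sPn S xP.
have xp : x \in present h by rewrite -mem_map_S.
have rE : [seq y.+1 | y <- rem x (present h)] = rem x.+1 P by exact: rem_map_S.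
exists t, (Config (EvExtractMin x :: h) hd s'); split.
  apply: serve_extract_min => //.
  - split=> // y kx ky0 yp; rewrite !hk // => -[<-] [<-]; apply: xmin.
    by rewrite mem_map_S.
  - by apply: val_inj; rewrite /= (sim_reg sm') r0' hh.
  - by rewrite hk // (sim_key sm') ?expn_gt0 // k0.
exists a', lv'; split=> //=; rewrite ?r1' ?r2' ?rE //.
- by move=> y /mem_rem yp; rewrite hk // ko.
- by move=> y /mem_rem yp; rewrite hh.
- by move=> j y /sub yj; apply: evid_cons; apply: evd.
(* The evidence for the extracted element turns a cost linear in its level [g] into the logarithm of
   its working set. *)
have [t0 [h1 h2 h3]] := evd g x xg.
have le := working_set_max h1 xp h2.
have gb : g <= trunc_log 2 (2 * size (working_set h x)).
  by apply: trunc_log_max => //; apply: leq_trans h3 _; rewrite leq_pmul2l.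
move: pot pt gb; clear; move: (phi _ _ _ _ _) (phi _ _ _ _ _) (budget h) (trunc_log _ _) => *; lia.
Qed.

Lemma inv_decrease g T a lv x k : inv g T a lv -> valid (hist g) (DecreaseKey x k) ->
  fits 256 w (insertions (hist g)) ->
  exists t g', serve queue g (DecreaseKey x k) t g' /\ exists a' lv', inv g' (T + t) a' lv'.
Proof.
case: g => h hd s [/= sm r1 S hR hk hh evd pot] [xp [k0 kx kle]] W.
set m := insertions h in r1 S W; set P := [seq x.+1 | x <- present h] in S pot.
pose a0 := setk (setr a 0 x.+1) 0 k.
have S0 : str m (rg a0 2) P (fd a0) (ky a0) lv.
  by apply: str_key S => y /eqP/negbTE y0; rewrite /= y0.
have hR0 j : bit j (rg a0 3) <-> isrec (mu lv) (ky a0) j.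
  by rewrite /= hR; apply: iff_sym; apply: isrec_ext => i /eqP/negbTE i0; rewrite /= i0.
have sm0 : sim (set_key (set_reg s 0 (hd x)) (mkword w 0) k) a0.
  by apply: sim_setk; rewrite -(hh x xp); apply: sim_setr.
have xP : x.+1 \in P by rewrite mem_map_S.
have kx' : (ky a0 0 <= ky a0 x.+1)%O by move: kx; rewrite /= hk // => -[->].
pose Q t (a' : ast K) := exists lv', [/\ [/\ str m (rg a 2) P (fd a') (ky a') lv',
     forall j, bit j (rg a' 3) <-> isrec (mu lv') (ky a') j, rg a' 1 = rg a 1 & rg a' 2 = rg a 2],
     ky a' x.+1 = k, forall y, y <> x.+1 -> y <> 0 -> ky a' y = ky a y,
     forall j, fnodes (lv' j) =i fnodes (lv j) &
     t + phi w (rg a 2) (rg a' 3) P lv' <= phi w (rg a 2) (rg a 3) P lv + 70 * 100].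
have [] := @decreaseP w m _ K W a0 P lv x.+1 Q S0 hR0 xP erefl kx' _ _ sm0.
  move=> t a' lv' h1 h2 h3 h4 h5 h6 h7 h8; exists lv'; split=> //.
  by move=> y yx /eqP/negbTE y0; rewrite h6 //= y0.
move=> t [s' [a' [ex sm' [lv' [[S' hR' r1' r2'] ka ko sub pt]]]]].
exists t, (Config (EvDecreaseKey x k :: h) hd s'); split; first by apply: serve_decrease_key.
exists a', lv'; split=> //=; rewrite ?r1' ?r2' //.
- by move=> y yp; case: eqP => [->|yx]; rewrite ?ka // hk // ko // => -[].
- by move=> j y; rewrite sub => /evd; apply: evid_cons.
by move: pot pt; clear; move: (phi _ _ _ _ _) (phi _ _ _ _ _) (budget h) => *; lia.
Qed.

Lemma inv_find g T a lv : inv g T a lv -> valid (hist g) FindMin -> fits 256 w (insertions (hist g)) ->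
  exists t g', serve queue g FindMin t g' /\ exists a' lv', inv g' (T + t) a' lv'.
Proof.
case: g => h hd s [/= sm r1 S hR hk hh evd pot] P0 W.
set m := insertions h in r1 S W; set P := [seq x.+1 | x <- present h] in S pot.
have P0' : P <> [::] by rewrite /P; case: (present h) P0.
pose Q t (a' : ast K) := t <= 100 /\ exists x, [/\ x \in P /\ {in P, forall y, (ky a x <= ky a y)%O},
     fd a' = fd a, forall r, 0 < r < 4 -> rg a' r = rg a r, rg a' 0 = x &
     ky a' 0 = ky a x /\ forall y, y <> 0 -> ky a' y = ky a y].
have [] := @findP m W a P lv Q S hR P0' _ _ sm.
  by move=> t a' x h1 h2 h3 h4 h5 h6 h7 h8; split=> //; exists x.
move=> t [s' [a' [ex sm' [ht [x' [[xP xmin] fdE rE r0' [k0 ko]]]]]]].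
case: x' xP xmin r0' k0 => [|x] xP xmin r0' k0; first by have := sPn S xP.
have xp : x \in present h by rewrite -mem_map_S.
exists t, (Config (EvFindMin x :: h) hd s'); split.
  apply: serve_find_min => //.
  - split=> // y kx ky0 yp; rewrite !hk // => -[<-] [<-]; apply: xmin.
    by rewrite mem_map_S.
  - by apply: val_inj; rewrite /= (sim_reg sm') r0' hh.
  - by rewrite hk // (sim_key sm') ?expn_gt0 // k0.
exists a', lv; split=> //=; rewrite ?rE //.
- by rewrite fdE; apply: str_key S.
- by move=> j; rewrite hR; apply: iff_sym; apply: isrec_ext => i i0; apply: ko.
- by move=> y yp; rewrite hk // ko.
- by move=> j y /evd; apply: evid_cons.
by move: pot ht; clear; move: (phi _ _ _ _ _) (budget h) => *; lia.
Qed.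

Lemma inv_serve g T a lv o : inv g T a lv -> valid (hist g) o ->
  fits 256 w (insertions (hist g) + (if o is Insert _ then 1 else 0)) ->
  exists t g', serve queue g o t g' /\ exists a' lv', inv g' (T + t) a' lv'.
Proof.
case: o => [k||x k|] I v; rewrite ?addn0 ?addn1 => W.
- exact: inv_insert I W.
- exact: inv_extract I v W.
- exact: inv_decrease I v W.
- exact: inv_find I v W.
Qed.

(** * Determinism, and the invariant along a given run *)

Lemma serve_det (Z : pq_program) (g : config w K) o t1 g1 t2 g2 :
  {in present (hist g) &, injective (handle g)} ->
  serve Z g o t1 g1 -> serve Z g o t2 g2 -> t1 = t2 /\ g1 = g2.
Proof.
move=> inj H1 H2; case: H1 inj H2 => [h a s k|h a s x|h a s x k|h a s x] t s' e.
- move=> _ _ H2; inversion H2 as [? ? ? ? ? ? e2| | |]; subst.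
  by have [-> ->] := exec_det e e2.
- move=> [xp _] r _ inj H2; inversion H2 as [|? ? ? y ? ? e2 [yp _] r2| |]; subst.
  have [-> es] := exec_det e e2; rewrite -es in r2 *.
  by have -> : x = y by apply: inj => //=; rewrite -r -r2.
- move=> _ H2; inversion H2 as [| |? ? ? ? ? ? ? e2|]; subst.
  by have [-> ->] := exec_det e e2.
- move=> [xp _] r _ inj H2; inversion H2 as [| | |? ? ? y ? ? e2 [yp _] r2]; subst.
  have [-> es] := exec_det e e2; rewrite -es in r2 *.
  by have -> : x = y by apply: inj => //=; rewrite -r -r2.
Qed.

Lemma serve_insertions (Z : pq_program) (g : config w K) o t g' : serve Z g o t g' ->
  insertions (hist g') = insertions (hist g) + (if o is Insert _ then 1 else 0).
Proof. by case=> *; rewrite /= ?addn0 ?addn1. Qed.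

(** Each step of the given run is the one built by [inv_serve]: execution is deterministic, and the
    answered element is identified by its handle, as handles of present elements are distinct. *)
Lemma run_inv g T : run queue g T -> fits 256 w (insertions (hist g)) ->
  exists a lv, inv g T a lv.
Proof.
elim=> {g T} [s t s' e W|g T o t g' _ IH v sv].
  have [t1 [s1 [e1 I]]] := inv_init s W.
  by have [-> ->] := exec_det e e1.
rewrite (serve_insertions sv) => W; have W' : fits 256 w (insertions (hist g)).
  by move: W; rewrite /fits; clear; lia.
have [a [lv I]] := IH W'; have [t1 [g1 [sv1 I1]]] := inv_serve I v W.
have inj : {in present (hist g) &, injective (handle g)}.
  move=> x y xp yp /(congr1 val); rewrite /= !(inv_handle I) //; by case.
by have [-> ->] := serve_det inj sv sv1.
Qed.

End Procedures.

Lemma queue_correct : pq_correct queue 256.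
Proof.
move=> w disp K W; split=> [s|g T o r v W'].
  by have [t [s' [e _]]] := inv_init s W; exists t, s'.
have [a [lv I]] : exists a lv, inv g T a lv.
  by apply: run_inv r _; move: W'; rewrite /fits; clear; lia.
by have [t [g' [sv _]]] := inv_serve I v W'; exists t, g'.
Qed.

Lemma run_budget w (disp : Order.disp_t) (K : orderType disp) (g : config w K) T :
  run queue g T -> fits 256 w (insertions (hist g)) -> T <= budget (hist g).
Proof.
move=> r W; have [a [lv I]] := run_inv r W.
by apply: leq_trans (inv_pot I); apply: leq_addr.
Qed.

(** * From truncated to real logarithms *)

Import GRing.Theory Num.Theory.
Local Open Scope ring_scope.

Section Logarithm.
Variable R : realType.

Lemma ln2_gt0 : 0 < ln (2 : R).
Proof. by apply: ln_gt0; rewrite ltr1n. Qed.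

Lemma log2_nat_ge0 n : 0 <= log2 (n%:R : R).
Proof.
rewrite /log2; case: n => [|n]; first by rewrite ln0 // mul0r.
by rewrite divr_ge0 ?(ltW ln2_gt0) // ln_ge0 // ler1n.
Qed.

Lemma trunc_log_double n : (trunc_log 2 (2 * n))%:R <= 1 + log2 (n%:R : R).
Proof.
(* At 0 both logarithms take the default value 0. *)
case: n => [|n]; first by rewrite muln0 trunc_log0 addr_ge0 ?log2_nat_ge0.
have n0 : (0 : R) < n.+1%:R by rewrite ltr0n.
have le : ((2 : R) ^+ trunc_log 2 (2 * n.+1)) <= 2 * n.+1%:R.
  by rewrite -natrX -natrM ler_nat trunc_logP.
have p2 : (0 : R) < 2 by rewrite ltr0n.
have le2 : ln ((2 : R) ^+ trunc_log 2 (2 * n.+1)) <= ln (2 * n.+1%:R).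
  by rewrite ler_ln // posrE ?exprn_gt0 // mulr_gt0.
rewrite lnXn // lnM ?posrE // -[X in X <= _]mulr_natl in le2.
rewrite /log2 -(ler_pM2r ln2_gt0) mulrDl mul1r divfK ?gt_eqF ?ln2_gt0 //.
Qed.

(** An extraction costs at most [1000 * 100] times [2 + log2 |W|]; doubling the factor gives the
    form [c * (1 + log2 |W|)], as the logarithm is nonnegative. The same constant exceeds the cost
    of every other operation and of the initialization. *)
Lemma budget_amortized disp (K : orderType disp) (c : R) (h : history K) : c = 1000 * 200 ->
  (budget h)%:R <= c + amortized_total (fun (h : history K) (e : event K) =>
    match e with
    | EvInsert _ | EvDecreaseKey _ _ | EvFindMin _ => c
    | EvExtractMin x => c * (1 + log2 (size (working_set h x))%:R)
    end) h.
Proof.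
move=> ec; elim: h => [|e h IH] /=; first by rewrite ec; lra.
have X f : c + amortized_total f h + (100 * 100)%:R <= c + (amortized_total f h + c).
  by rewrite ec natrM; lra.
case: e => [k|x|x k|x]; rewrite natrD; try by apply: le_trans (X _); rewrite lerD2r.
rewrite addrA lerD // !natrM -addn1 natrD.
have := trunc_log_double (size (working_set h x)); have := log2_nat_ge0 (size (working_set h x)).
by rewrite ec; set l := log2 _; set t := (trunc_log _ _)%:R => *; lra.
Qed.

End Logarithm.

Theorem mainTheorem4 (R : realType) :
  exists (P : pq_program) (b : nat),
    pq_correct P b /\
    exists c : R, forall (disp : Order.disp_t) (K : orderType disp) (w : nat),
      amortized_cost P b w c
        (fun (h : history K) (e : event K) =>
           match e with
           | EvInsert _ | EvDecreaseKey _ _ | EvFindMin _ => c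
           | EvExtractMin x => c * (1 + log2 (size (working_set h x))%:R)
           end).
Proof.
exists queue, 256; split; first exact: queue_correct.
exists (1000 * 200) => disp K w g T r W.
apply: le_trans (budget_amortized (hist g) erefl).
by rewrite ler_nat; apply: run_budget r W.
Qed.
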